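(* Let $(E,C)$ be an adaptable separated graph. The groupoid $\mathcal G_{tight}(S(E,C))$ is amenable.
   Context: **Adaptable separated graphs.** $\mathbb N=\{1,2,\dots\}$. For a directed graph $E=(E^0,E^1,s,r)$, paths are $e_1\cdots e_n$ with $r(e_i)=s(e_{i+1})$; vertices are paths of length $0$. A separated graph $(E,C)$ is a directed graph $E$ with $C=\bigsqcup_{v\in E^0}C_v$, where $C_v$ is a partition of $s^{-1}(v)$ into nonempty subsets ($C_v=\emptyset$ if $v$ is a sink). It is finitely separated if all sets in $C$ are finite. Put $v\le w$ if there is a path from $w$ to $v$; let $(I,\le)$ be the antisymmetrization of $(E^0,\le)$, whose elements are the transitive components. A finitely separated graph $(E,C)$ is adaptable if $I$ is finite and there are a partition $I=I_{free}\sqcup I_{reg}$ and subgraphs $(E_p)_{p\in I}$, with $E_p^0$ the vertex set of the component $p$, such that: (1) $E^0=\bigsqcup_p E_p^0$; $E_p$ is a transitive (any two vertices joined by a directed path) row-finite graph if $p\in I_{reg}$; $E_p^0=\{v^p\}$ if $p\in I_{free}$. (2) For $p\in I_{reg}$, $w\in E_p^0$: $|C_w|=1$, $|s_{E_p}^{-1}(w)|\ge 2$, and every edge with source $w$ lies in $E_p$ or has range in $E_q^0$ with $q<p$. (3) For $p\in I_{free}$: $s^{-1}(v^p)=\emptyset$ iff $p$ is minimal in $I$ (then put $k(p)=0$). If $p$ is not minimal, $C_{v^p}=\{X_1^{(p)},\dots,X_{k(p)}^{(p)}\}$ is finite with $X_i^{(p)}=\{\alpha(p,i),\beta(p,i,1),\dots,\beta(p,i,g(p,i))\}$,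 $g(p,i)\ge1$, $\alpha(p,i)$ a loop at $v^p$, $r(\beta(p,i,t))\in E_q^0$ with $q<p$; and $E_p^1=\{\alpha(p,1),\dots,\alpha(p,k(p))\}$. **The inverse semigroup $S(E,C)$.** It is the $*$-semigroup with $0$ ($*$-semigroup: $s^{**}=s$, $(st)^*=t^*s^*$) generated by $E^0\cup E^1\cup\{(t_i^v)^{\pm1}: i\in\mathbb N,v\in E^0\}$ with relations: (R1) $vw=\delta_{v,w}v$, $v^*=v$ for $v,w\in E^0$; (R2) $e=s(e)e=er(e)$ for $e\in E^1$, and $e^*f=\delta_{e,f}r(e)$ for $e,f$ in the same set $X\in C$; (R3) for $p\in I_{free}$, $i\ne j$: $\alpha(p,i)\alpha(p,j)=\alpha(p,j)\alpha(p,i)$, $\alpha(p,i)\alpha(p,j)^*=\alpha(p,j)^*\alpha(p,i)$; (R4) for $p\in I_{free}$: $\beta(p,i,s)^*\beta(p,j,t)=0$ if $(i,s)\neq(j,t)$; (R5) for each $v$ the elements $(t_i^v)^{\pm1}$ commute mutually, $vt_i^v=t_i^v=t_i^vv$, $t_i^v(t_i^v)^{-1}=v=(t_i^v)^{-1}t_i^v$, $(t_i^v)^*=(t_i^v)^{-1}$; (R6) $t_i^{s(e)}e=e\,t_i^{r(e)}$ if $s(e)\in E_p^0$, $p\in I_{reg}$; (R7) for $p\in I_{free}$: $(t_i^{v^p})^{\pm1}\beta(p,j,s)=\beta(p,j,s)(t^{r(\beta(p,j,s))}_{i+k(p)-1})^{\pm1}$; (R8) for $p\in I_{free}$, $i\ne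 j$: $\alpha(p,i)\beta(p,j,s)=\beta(p,j,s)t^{r(\beta(p,j,s))}_{\sigma_j^p(i)}$ and $\alpha(p,i)^*\beta(p,j,s)=\beta(p,j,s)(t^{r(\beta(p,j,s))}_{\sigma_j^p(i)})^{-1}$, where $\sigma_j^p$ is the increasing bijection $\{1,\dots,k(p)\}\setminus\{j\}\to\{1,\dots,k(p)-1\}$; (R9) for $p\in I_{free}$: $t_i^{v^p}$ commutes with $\alpha(p,j)$ and $\alpha(p,j)^*$. $S(E,C)$ is an inverse semigroup; $\mathcal E$ is its semilattice of idempotents ($e\le f$ iff $ef=e$). **Tight groupoid.** A filter on $\mathcal E$ is a nonempty $\eta\subseteq\mathcal E$ with $0\notin\eta$, closed under products and upward closed. Filters are topologized as a subspace of $\{0,1\}^{\mathcal E}$. A finite cover of $\mathcal F_e=\{f\in\mathcal E:f\le e\}$ is a finite $Z\subseteq\mathcal F_e$ such that every $0\ne f\in\mathcal F_e$ has $fz\neq0$ for some $z\in Z$. A filter $\eta$ is tight if $e\in\eta$ implies $Z\cap\eta\ne\emptyset$ for every finite cover $Z$ of $\mathcal F_e$; $\widehat{\mathcal E}_{tight}$ is the space of tight filters. For $e\in\mathcal E$ let $D_e=\{\eta\in\widehat{\mathcal E}_{tight}: e\in\eta\}$; $s\in S(E,C)$ acts by $\alpha_s\colon D_{s^*s}\to D_{ss^*}$, $\alpha_s(\eta)=\{f\in\mathcal E: s^*fs\in\eta\}$. $\mathcal G_{tight}(S(E,C))$ is the groupoid of germs $[s,x]$, $x\in D_{s^*s}$,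 where $[s,x]=[s',y]$ iff $x=y$ and $sf=s'f$ for some $f\in\mathcal E$ with $f\in x$; source $x$, range $\alpha_s(x)$, $[s,\alpha_t(x)][t,x]=[st,x]$, $[s,x]^{-1}=[s^*,\alpha_s(x)]$. Its topology is generated by $\Theta(s,U)=\{[s,x]:x\in U\}$, $U\subseteq D_{s^*s}$ open. It is a (second-countable) ample Hausdorff groupoid. Amenability is (topological) amenability in the sense of Anantharaman-Delaroche and Renault. *)

(* Defs.v *)
From HB Require Import structures.
From mathcomp Require Import all_boot all_order all_algebra.
From mathcomp Require Import all_classical all_reals all_analysis.

Set Implicit Arguments.
Unset Strict Implicit.
Unset Printing Implicit Defensive.

Import Order.TTheory GRing.Theory Num.Theory.
Import numFieldNormedType.Exports.

Local Open Scope classical_set_scope.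

Record sepgraph := Sepgraph {
  vertex : Type;
  edge : Type;
  src : edge -> vertex;
  rng : edge -> vertex;
  sep : vertex -> set (set edge);
  sep_partition : forall v, partition (sep v) id (src @^-1` [set v])
}.

Section Sepgraph.
Variable E : sepgraph.
Implicit Types (v w : vertex E) (D : set (edge E)).

Definition out_edges v : set (edge E) := @src E @^-1` [set v].

(* [s] is a path from [v] to [w] with all its edges in [D] *)
Fixpoint is_path D v (s : seq (edge E)) w : Prop :=
  if s is e :: s' then [/\ D e, src e = v & is_path D (rng e) s' w] else v = w.

Definition vle v w := exists s, is_path setT w s v.

Definition transitive_class v : set (vertex E) := [set w | vle v w /\ vle w v].

(* The elements of I, each represented by its set of vertices. *)
Definition component := set_type (range transitive_class).

Definition vset (p : component) : set (vertex E) := val p.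

Definition comp_of v : component :=
  SigSub (mem_set (imageT transitive_class v)).

Definition cle (p q : component) :=
  exists v w, [/\ vset p v, vset q w & vle v w].

Definition clt (p q : component) := cle p q /\ p <> q.

Definition cminimal (p : component) := forall q, cle q p -> q = p.

End Sepgraph.

(* Indices are shifted by one: X_1, ..., X_k are indexed by 'I_k, and          *)
(* beta(p,i,1), ..., beta(p,i,g) by 'I_g. The functions [nX], [alpha], [nbeta] *)
(* and [beta] are only meaningful on the components in [free].                 *)
Record adaptable (E : sepgraph) := Adaptable {
  free : set (component E);
  reg : set (component E) := ~` free;
  sub_edge : component E -> set (edge E);
  nX : component E -> nat;
  alpha : forall p : component E, 'I_(nX p) -> edge E;
  nbeta : forall p : component E, 'I_(nX p) -> nat;
  beta : forall (p : component E) (i : 'I_(nX p)), 'I_(nbeta i) -> edge E;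
  block : forall p : component E, 'I_(nX p) -> set (edge E) :=
    fun p i => alpha i |` range (@beta p i);
  finitely_separated : forall v X, @sep E v X -> finite_set X;
  finite_components : finite_set [set: component E];
  sub_edgeP : forall p e, sub_edge p e -> vset p (src e) /\ vset p (rng e);

  reg_transitive : forall p, reg p -> forall v w, vset p v -> vset p w ->
    exists s, is_path (sub_edge p) v s w;
  reg_row_finite : forall p, reg p -> forall w, vset p w ->
    finite_set (sub_edge p `&` out_edges w);
  free_vertex : forall p, free p -> exists v, vset p = [set v];

  reg_sep : forall p, reg p -> forall w, vset p w ->
    exists X, @sep E w = [set X];
  reg_two : forall p, reg p -> forall w, vset p w ->
    exists e f, [/\ e <> f, (sub_edge p `&` out_edges w) e
                  & (sub_edge p `&` out_edges w) f];
  reg_edge : forall p, reg p -> forall e, vset p (src e) ->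
    sub_edge p e \/ exists2 q, clt q p & vset q (rng e);

  free_sink : forall p, free p -> forall v, vset p v ->
    (out_edges v = set0 <-> cminimal p);
  free_minimal : forall p, free p -> cminimal p -> nX p = 0%N;
  free_sep : forall p, free p -> ~ cminimal p -> forall v, vset p v ->
    @sep E v = range (@block p);
  block_inj : forall p, free p -> injective (@block p);
  nbeta_gt0 : forall p, free p -> forall i : 'I_(nX p), (0 < nbeta i)%N;
  alpha_loop : forall p, free p -> forall v, vset p v ->
    forall i : 'I_(nX p), src (alpha i) = v /\ rng (alpha i) = v;
  beta_inj : forall p, free p -> forall i : 'I_(nX p), injective (@beta p i);
  beta_range : forall p, free p -> forall (i : 'I_(nX p)) (t : 'I_(nbeta i)),
    exists2 q, clt q p & vset q (rng (beta t));
  free_sub_edge : forall p, free p -> ~ cminimal p ->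
    sub_edge p = range (@alpha p)
}.

Record star_semigroup := StarSemigroup {
  scarrier :> Type;
  smul : scarrier -> scarrier -> scarrier;
  star : scarrier -> scarrier;
  szero : scarrier;
  smulA : associative smul;
  smul0s : left_zero szero smul;
  smuls0 : right_zero szero smul;
  starK : involutive star;
  starM : forall a b, star (smul a b) = smul (star b) (star a)
}.

Arguments szero {s}.

Section SEC.
Variables (E : sepgraph) (A : adaptable E).

(* [TT true i v] is t_{i+1}^v and [TT false i v] is its inverse. *)
Inductive term :=
  | T0
  | TV of vertex E
  | TE of edge E
  | TT of bool & nat & vertex E
  | TMul of term & term
  | TStar of term.

HB.instance Definition _ := gen_eqMixin term.
HB.instance Definition _ := gen_choiceMixin term.

Declare Scope term_scope.
Delimit Scope term_scope with T.
Local Infix "*" := TMul : term_scope.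
Local Notation "x ^*" := (TStar x) : term_scope.
Local Open Scope term_scope.

Inductive srel : term -> term -> Prop :=
  | srel_refl x : srel x x
  | srel_sym x y : srel x y -> srel y x
  | srel_trans x y z : srel x y -> srel y z -> srel x z
  | srel_mul x x' y y' : srel x x' -> srel y y' -> srel (x * y) (x' * y')
  | srel_star x x' : srel x x' -> srel (x^*) (x'^*)
  | srel_mulA x y z : srel (x * (y * z)) ((x * y) * z)
  | srel_mul0s x : srel (T0 * x) T0
  | srel_muls0 x : srel (x * T0) T0
  | srel_starK x : srel (x^*^*) x
  | srel_starM x y : srel ((x * y)^*) (y^* * x^*)
  | R1_id v : srel (TV v * TV v) (TV v)
  | R1_orth v w : v <> w -> srel (TV v * TV w) T0
  | R1_star v : srel ((TV v)^*) (TV v)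
  | R2_src e : srel (TE e) (TV (src e) * TE e)
  | R2_rng e : srel (TE e) (TE e * TV (rng e))
  | R2_eq v X e : sep v X -> X e -> srel ((TE e)^* * TE e) (TV (rng e))
  | R2_neq v X e f : sep v X -> X e -> X f -> e <> f ->
      srel ((TE e)^* * TE f) T0
  | R3 p (i j : 'I_(nX A p)) : free A p -> i <> j ->
      srel (TE (alpha i) * TE (alpha j)) (TE (alpha j) * TE (alpha i))
  | R3_star p (i j : 'I_(nX A p)) : free A p -> i <> j ->
      srel (TE (alpha i) * (TE (alpha j))^*) ((TE (alpha j))^* * TE (alpha i))
  | R4 p (i j : 'I_(nX A p)) (s : 'I_(nbeta i)) (t : 'I_(nbeta j)) :
      free A p -> Tagged (fun i => 'I_(nbeta i)) s <> Tagged _ t ->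
      srel ((TE (beta s))^* * TE (beta t)) T0
  | R5_comm b c i j v : srel (TT b i v * TT c j v) (TT c j v * TT b i v)
  | R5_unitl i v : srel (TV v * TT true i v) (TT true i v)
  | R5_unitr i v : srel (TT true i v * TV v) (TT true i v)
  | R5_invr i v : srel (TT true i v * TT false i v) (TV v)
  | R5_invl i v : srel (TT false i v * TT true i v) (TV v)
  | R5_star i v : srel ((TT true i v)^*) (TT false i v)
  | R6 i e : reg A (comp_of (src e)) ->
      srel (TT true i (src e) * TE e) (TE e * TT true i (rng e))
  | R7 b i p v (j : 'I_(nX A p)) (s : 'I_(nbeta j)) : free A p -> vset p v ->
      srel (TT b i v * TE (beta s))
           (TE (beta s) * TT b (i + nX A p - 1) (rng (beta s)))
  (* [unbump j] is sigma_j, the increasing bijection from 'I_k minus j to     *)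
  (* 'I_k.-1, for indices starting from 0.                                    *)
  | R8 p (i j : 'I_(nX A p)) (s : 'I_(nbeta j)) : free A p -> i <> j ->
      srel (TE (alpha i) * TE (beta s))
           (TE (beta s) * TT true (unbump j i) (rng (beta s)))
  | R8_star p (i j : 'I_(nX A p)) (s : 'I_(nbeta j)) : free A p -> i <> j ->
      srel ((TE (alpha i))^* * TE (beta s))
           (TE (beta s) * TT false (unbump j i) (rng (beta s)))
  | R9 i p v (j : 'I_(nX A p)) : free A p -> vset p v ->
      srel (TT true i v * TE (alpha j)) (TE (alpha j) * TT true i v)
  | R9_star i p v (j : 'I_(nX A p)) : free A p -> vset p v ->
      srel (TT true i v * (TE (alpha j))^*) ((TE (alpha j))^* * TT true i v).

Definition srelb : rel term := fun x y => `[< srel x y >].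

Lemma srelb_refl : reflexive srelb.
Proof. by move=> x; apply/asboolP/srel_refl. Qed.
Lemma srelb_sym : symmetric srelb.
Proof. by move=> x y; apply/asboolP/asboolP; exact: srel_sym. Qed.
Lemma srelb_trans : transitive srelb.
Proof.
by move=> y x z /asboolP xy /asboolP yz; apply/asboolP; exact: srel_trans yz.
Qed.

Canonical srel_equiv := EquivRel srelb srelb_refl srelb_sym srelb_trans.

Definition sec_type := {eq_quot srel_equiv}%qT.

Local Open Scope quotient_scope.

Definition sec_mul (a b : sec_type) : sec_type := \pi_sec_type (repr a * repr b).
Definition sec_star (a : sec_type) : sec_type := \pi_sec_type ((repr a)^*).
Definition sec_zero : sec_type := \pi_sec_type T0.

Lemma sec_eq x y : srel x y -> \pi_sec_type x = \pi_sec_type y.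
Proof. by move=> xy; apply/eqmodP/asboolP. Qed.

Lemma repr_srel x : srel (repr (\pi_sec_type x)) x.
Proof. by apply/asboolP/(eqmodP srel_equiv); rewrite reprK. Qed.

Lemma sec_mulE x y : sec_mul (\pi x) (\pi y) = \pi_sec_type (x * y).
Proof. by apply: sec_eq; apply: srel_mul; exact: repr_srel. Qed.

Lemma sec_starE x : sec_star (\pi x) = \pi_sec_type (x^*).
Proof. by apply: sec_eq; apply: srel_star; exact: repr_srel. Qed.

Lemma sec_mulA : associative sec_mul.
Proof.
move=> a b c; rewrite -[a]reprK -[b]reprK -[c]reprK !sec_mulE.
exact/sec_eq/srel_mulA.
Qed.
Lemma sec_mul0s : left_zero sec_zero sec_mul.
Proof. by move=> a; rewrite -[a]reprK sec_mulE; exact/sec_eq/srel_mul0s. Qed.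
Lemma sec_muls0 : right_zero sec_zero sec_mul.
Proof. by move=> a; rewrite -[a]reprK sec_mulE; exact/sec_eq/srel_muls0. Qed.
Lemma sec_starK : involutive sec_star.
Proof. by move=> a; rewrite -[a]reprK !sec_starE; exact/sec_eq/srel_starK. Qed.
Lemma sec_starM a b :
  sec_star (sec_mul a b) = sec_mul (sec_star b) (sec_star a).
Proof.
rewrite -[a]reprK -[b]reprK !(sec_starE, sec_mulE).
exact/sec_eq/srel_starM.
Qed.

Definition SEC : star_semigroup :=
  StarSemigroup sec_mulA sec_mul0s sec_muls0 sec_starK sec_starM.

End SEC.

(* Only data: the groupoid laws play no role in the definition of amenability. *)
(* [gmul g h] is only meaningful when [dom g = ran h].                         *)
Record groupoid_data := GroupoidData {
  obj : topologicalType;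
  arr : topologicalType;
  dom : arr -> obj;
  ran : arr -> obj;
  gmul : arr -> arr -> arr;
  ginv : arr -> arr
}.

Section Tight.
Variable S : star_semigroup.
Local Infix "*" := (@smul S).
Local Notation "x ^*" := (@star S x).

Definition idem : set S := [set e | e * e = e].

Definition ile (e f : S) := e * f = e.

Definition below (e : S) : set S := [set f | idem f /\ ile f e].

(* A subset of S is given by its characteristic function, so that sets of      *)
(* idempotents are points of {0,1}^S which vanish off [idem].                  *)
Definition filterE (eta : S -> bool) : Prop :=
  [/\ forall e, eta e -> idem e,
      exists e, eta e,
      ~ eta szero,
      forall e f, eta e -> eta f -> eta (e * f)
    & forall e f, idem f -> eta e -> ile e f -> eta f].

Definition finite_cover (e : S) (Z : set S) : Prop :=
  [/\ finite_set Z, Z `<=` below e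
    & forall f, below e f -> f <> szero -> exists2 z, Z z & f * z <> szero].

Definition tight (eta : S -> bool) : Prop :=
  filterE eta /\
  forall e, eta e -> forall Z, finite_cover e Z -> exists2 z, Z z & eta z.

Definition tight_spectrum := set_type [set eta : {ptws S -> bool} | tight eta].

HB.instance Definition _ := Topological.on tight_spectrum.

Definition fval (x : tight_spectrum) : {ptws S -> bool} := val x.

Definition D_ (e : S) : set tight_spectrum := [set x | fval x e].

Definition act_fun (s : S) (x : tight_spectrum) : S -> bool :=
  fun f => `[< idem f >] && fval x (s^* * f * s).

(* [act_fun s x] is a tight filter for [D_ (s^* * s) x]; otherwise [act s x]   *)
(* takes the junk value [x].                                                   *)
Definition act (s : S) (x : tight_spectrum) : tight_spectrum :=
  insubd x (act_fun s x).

Definition germ_dom : set (S * tight_spectrum) :=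
  [set sx | D_ (sx.1^* * sx.1) sx.2].

(* The germ [s,x] as an equivalence class. *)
Definition germ_class (sx : S * tight_spectrum) : set (S * tight_spectrum) :=
  [set sx' | [/\ germ_dom sx', sx'.2 = sx.2
    & exists f, [/\ idem f, fval sx.2 f & sx.1 * f = sx'.1 * f]]].

Definition germ := set_type (germ_class @` germ_dom).

Definition theta (s : S) (U : set tight_spectrum) : set germ :=
  [set g | exists2 x, U x & val g = germ_class (s, x)].

HB.instance Definition _ := Choice.on germ.
HB.instance Definition _ := @isSubBaseTopological.Build germ (set germ)
  [set B | exists s (U : set tight_spectrum),
    [/\ open U, U `<=` D_ (s^* * s) & B = theta s U]] id.

Lemma germ_repr_subproof (g : germ) :
  exists sx, germ_dom sx /\ germ_class sx = val g.
Proof. by have [sx sxd sxg] := set_valP g; exists sx. Qed.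

Definition germ_repr (g : germ) : S * tight_spectrum :=
  projT1 (cid (germ_repr_subproof g)).

Definition germ_src (g : germ) : tight_spectrum := (germ_repr g).2.

Definition germ_rng (g : germ) : tight_spectrum :=
  act (germ_repr g).1 (germ_repr g).2.

(* In [germ_mul] and [germ_inv] the first argument of [insubd] is a junk value *)
(* which is only used for pairs of germs that are not composable, respectively *)
(* never.                                                                      *)
Definition germ_mul (g h : germ) : germ :=
  insubd h (germ_class ((germ_repr g).1 * (germ_repr h).1, germ_src h)).

Definition germ_inv (g : germ) : germ :=
  insubd g (germ_class ((germ_repr g).1^*, germ_rng g)).

Definition tight_groupoid : groupoid_data :=
  @GroupoidData tight_spectrum germ germ_src germ_rng germ_mul germ_inv.

End Tight.

Local Open Scope ring_scope.
Local Open Scope ereal_scope.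

(* Measurable types have to be pointed: [t0] plays no other role. *)
Definition point_at (T : topologicalType) (t0 : T) : Type := T.

HB.instance Definition _ (T : topologicalType) (t0 : T) :=
  Topological.on (point_at t0).
HB.instance Definition _ (T : topologicalType) (t0 : T) :=
  isPointed.Build (point_at t0) t0.

Definition borel (T : topologicalType) (t0 : T) :=
  g_sigma_algebraType (@open (point_at t0)).

(* The total variation of the signed measure [mu - nu], for finite measures. *)
Definition tv_norm d (T : measurableType d) (R : realType)
    (mu nu : set T -> \bar R) : \bar R :=
  ereal_sup [set a | exists n (F : nat -> set T),
    [/\ forall i, measurable (F i), trivIset setT F
      & a = \sum_(i < n) `|mu (F i) - nu (F i)| ]].

Definition compactly_supported_continuous (T : topologicalType) (R : realType)
    (f : T -> R) : Prop :=
  continuous f /\ compact (closure [set x | f x <> 0%R]).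

Section Amenable.
Variables (R : realType) (G : groupoid_data).

(* The measure [g . mu] on G^(r(g)), for [mu] on G^(s(g)). *)
Definition translate (g : arr G) (mu : set (arr G) -> \bar R)
    (A : set (arr G)) : \bar R :=
  mu [set h | ran h = dom g /\ A (gmul g h)].

(* A family (m^x) of probability measures, m^x being concentrated on          *)
(* G^x = r^-1(x), which is continuous in the weak sense. On second-countable   *)
(* locally compact Hausdorff spaces, Borel probability measures are Radon.     *)
Definition continuous_probability_system (g0 : arr G)
    (m : obj G -> probability (borel g0) R) : Prop :=
  (forall x, m x (@ran G @^-1` [set x]) = 1) /\
  forall f : arr G -> R, compactly_supported_continuous f ->
    continuous (fun x : obj G => (\int[m x]_(g in [set: borel g0]) f g)%R).

(* Topological amenability: existence of a net of continuous systems of        *)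
(* probability measures, asymptotically invariant uniformly on compact sets.   *)
(* A groupoid without arrows is amenable.                                      *)
Definition amenable : Prop :=
  forall g0 : arr G,
  exists (I : Type) (le : I -> I -> Prop)
         (m : I -> obj G -> probability (borel g0) R),
    [/\ [/\ inhabited I,
            forall i, le i i,
            forall i j k, le i j -> le j k -> le i k
          & forall i j, exists k, le i k /\ le j k],
        forall i, continuous_probability_system (m i)
      & forall K : set (arr G), compact K -> forall eps : R, (0 < eps)%R ->
          exists i0, forall i, le i0 i -> forall g, K g ->
            tv_norm (translate g (m i (dom g)) : set (borel g0) -> \bar R)
                    (m i (ran g)) < eps%:E].

End Amenable.

(* Main.v *)
(* Approximate invariant means are built by hand. A unit is a tight filter x,  *)
(* and tightness makes x choose an edge in every block at its vertex. To each  *)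
(* x is attached a finitely supported mean F x on the arrows with range x, by  *)
(* induction on the height of the component p of the vertex of x. Such an x    *)
(* either leaves p through a path c of some length n, so that c^* x lies over  *)
(* a lower component, or stays in p forever. In the second case use a mean B x *)
(* living in p: the average of the first N prefixes of x if p is regular, a    *)
(* box of monomials in the loops alpha_i if p is free, both thickened by a box *)
(* in the t_i. In the first case use c F(c^* x) if n is small, B x if n is     *)
(* large, and in between a convex combination whose weights vary slowly with   *)
(* n. Relations R6-R9 turn invariance under loops and t_i at p into invariance *)
(* under t_j one level below, up to a bounded shift of indices. The lists F x  *)
(* are locally constant in x, hence weakly continuous. Approximate invariance  *)
(* under the generators passes to all of S(E,C), and a compact set of germs is *)
(* covered by finitely many Theta(s, D_(s^* s)). No normal form uniqueness is  *)
(* needed: coincidences between germs can only decrease the total variation.   *)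
From HB Require Import structures.
From mathcomp Require Import all_boot all_order all_algebra finmap.
From mathcomp Require Import all_classical all_reals all_analysis.
From mathcomp Require Import lra ring zify measurable_realfun.
Require Import Defs.

Set Implicit Arguments.
Unset Strict Implicit.
Unset Printing Implicit Defensive.

Import Order.TTheory GRing.Theory Num.Theory.
Import numFieldNormedType.Exports.

Local Open Scope classical_set_scope.

Declare Scope star_scope.
Delimit Scope star_scope with S.
Local Notation "a * b" := (@smul _ a b) : star_scope.
Local Notation "a ^*" := (@star _ a) : star_scope.
Local Notation "0" := (@szero _) : star_scope.
Local Open Scope star_scope.

(** Topological amenability asks for probability measures on the arrows with range x, weakly
    continuous in x and almost invariant under translation. They are produced from formal means:
    each tight filter x gets a finite list [F n x] of weighted elements s of the semigroup, standing
    for the arrows [s, s^* x]. By [amenable_of_means] four properties suffice: the weights form a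
    probability, s s^* belongs to x whenever s has nonzero weight, the list is locally constant in
    x, and for each fixed u the lists u F(x) and F(u x) become close in l^1, uniformly in x. The
    last property passes to products, so only generators and their adjoints have to be examined.

    Points are understood through normal forms. The relations write every element as a b^* with a
    and b free of stars ([normalP]). Hence S(E,C) is an inverse semigroup ([sec_regular],
    [range_comm]) and the ranges of the edges of a block cover their vertex ([block_cover]). A tight
    filter therefore picks an edge in every block at its vertex ([block_head]) and can be read edge
    by edge, while the t_i fix all points ([act_pt]).

    The means are built upwards along the finite poset of components ([good_exists]). For points
    that stay long in a component p there is a mean B. If p is regular, the first edge of x is
    unique and B averages over the prefixes of x of length less than N; an edge of p merely shifts
    this average, at cost 2/N. If p is free, the loops at its vertex commute, and B is a box of
    monomials in them, moved by at most 2/N by each loop. A box in the first M of the t_i is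
    appended in both cases. A point that leaves p along a path c of length n also has the lower mean
    c F(c^* x), and [extend] interpolates: the weight of B grows from 0 at n = N to 1 at n = 2N in
    steps of 1/N. Prepending an edge of p usually lengthens c by one and changes the weight
    slightly. At a free vertex a loop may instead satisfy alpha_i c = c t_j, and then invariance of
    F under t_j is what is needed. Moving a t past c shifts its index by less than the number of
    loops. So one level costs an error 4/N and asks the level below for a bounded number of further
    t_j; the height being finite, both demands can be met. *)

Lemma smul_eqr (S : star_semigroup) (a b c : S) :
  a * b = c -> forall x, x * a * b = x * c.
Proof. by move=> ab x; rewrite -smulA ab. Qed.

Lemma star0 (S : star_semigroup) : (0 : S)^* = 0.
Proof. by rewrite -{1}(smul0s (0 : S)^*) starM starK smul0s. Qed.

(** * The inverse semigroup of a separated graph *)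

Section SecRelations.
Variables (E : sepgraph) (A : adaptable E).
Local Notation S := (SEC A).
Implicit Types (v w : vertex E) (e f : edge E) (p : component E).

Definition pv v : S := \pi_(sec_type A)%qT (TV v).
Definition pe e : S := \pi_(sec_type A)%qT (TE e).
Definition pt c i v : S := \pi_(sec_type A)%qT (TT c i v).

Let smulE x y : (\pi_(sec_type A) x : S)%qT * (\pi_(sec_type A) y)%qT
  = \pi_(sec_type A)%qT (TMul x y).
Proof. exact: sec_mulE. Qed.
Let sstarE x : (\pi_(sec_type A) x : S)%qT ^* = \pi_(sec_type A)%qT (TStar x).
Proof. exact: sec_starE. Qed.

Lemma sec_ind (P : S -> Prop) :
  P 0 -> (forall v, P (pv v)) -> (forall e, P (pe e)) ->
  (forall c i v, P (pt c i v)) ->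
  (forall a b, P a -> P b -> P (a * b)) -> (forall a, P a -> P a^*) ->
  forall a, P a.
Proof.
move=> P0 Pv Pe Pt PM Ps a; rewrite -[a]reprK.
elim: (repr a) => [|||||x Px] //; first by move=> x Px y Py; rewrite -smulE; exact: PM.
by rewrite -sstarE; exact: Ps.
Qed.

Lemma pvv v : pv v * pv v = pv v.
Proof. by rewrite smulE; apply: sec_eq; constructor. Qed.
Lemma pv_orth v w : v <> w -> pv v * pv w = 0.
Proof. by move=> vw; rewrite smulE; apply: sec_eq; constructor. Qed.
Lemma pv_star v : (pv v)^* = pv v.
Proof. by rewrite sstarE; apply: sec_eq; constructor. Qed.
Lemma pe_src e : pv (src e) * pe e = pe e.
Proof. by rewrite smulE; apply: sec_eq; apply: srel_sym; constructor. Qed.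
Lemma pe_rng e : pe e * pv (rng e) = pe e.
Proof. by rewrite smulE; apply: sec_eq; apply: srel_sym; constructor. Qed.

Lemma sep_src v X e : sep v X -> X e -> src e = v.
Proof. by move=> vX Xe; have [/seteqP[+ _] _ _] := sep_partition v; apply; exists X. Qed.

Lemma sep_edge e : exists2 X, sep (src e) X & X e.
Proof.
have [/seteqP[_ +] _ _] := sep_partition (src e) => /(_ e erefl)[X ? ?].
by exists X.
Qed.

Lemma pe_iso e : (pe e)^* * pe e = pv (rng e).
Proof.
have [X eX Xe] := sep_edge e.
by rewrite sstarE smulE; apply: sec_eq; apply: R2_eq eX Xe.
Qed.
Lemma pe_orth v X e f : sep v X -> X e -> X f -> e <> f ->
  (pe e)^* * pe f = 0.
Proof.
by move=> vX Xe Xf ef; rewrite sstarE smulE; apply: sec_eq; apply: R2_neq vX Xe Xf ef.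
Qed.

Lemma ptC b c i j v : pt b i v * pt c j v = pt c j v * pt b i v.
Proof. by rewrite !smulE; apply: sec_eq; constructor. Qed.
Lemma ptTF i v : pt true i v * pt false i v = pv v.
Proof. by rewrite !smulE; apply: sec_eq; constructor. Qed.
Lemma ptV b i v : pt b i v * pt (~~ b) i v = pv v.
Proof. by case: b; [exact: ptTF|rewrite ptC; exact: ptTF]. Qed.
Lemma ptT_star i v : (pt true i v)^* = pt false i v.
Proof. by rewrite sstarE; apply: sec_eq; constructor. Qed.
Lemma pt_star b i v : (pt b i v)^* = pt (~~ b) i v.
Proof. by case: b; [exact: ptT_star|rewrite -ptT_star starK]. Qed.
Lemma pv_pt b i v : pv v * pt b i v = pt b i v.
Proof.
have tl : pv v * pt true i v = pt true i v.
  by rewrite smulE; apply: sec_eq; constructor.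
have tr : pt true i v * pv v = pt true i v.
  by rewrite smulE; apply: sec_eq; constructor.
by case: b => //; rewrite -ptT_star -{1}pv_star -starM tr.
Qed.
Lemma pt_pv b i v : pt b i v * pv v = pt b i v.
Proof. by rewrite -[RHS]starK pt_star -(pv_pt (~~ b)) starM pv_star pt_star negbK. Qed.

Lemma vle_trans (u v w : vertex E) : vle u v -> vle v w -> vle u w.
Proof.
move=> [s1 h1] [s2 h2]; exists (s2 ++ s1).
elim: s2 w h2 => [w /= ->//|e s2 IH w /= [_ we /IH h]].
by split.
Qed.

Lemma component_eqP p v : vset p v <-> comp_of v = p.
Proof.
split=> [|<-]; last by split; exists nil.
case: p => /= X; rewrite /vset /= => Xp; have := set_mem Xp => -[w _ XE] Xv.
apply: val_inj => /=; rewrite -XE; rewrite -XE in Xv.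
have [wv vw] := Xv.
by apply/seteqP; split => u [h1 h2]; split; apply: vle_trans; eassumption.
Qed.

Lemma vset_inhab p : exists v, vset p v.
Proof.
case: p => X Xp; have [v _ XE] := set_mem Xp.
by exists v; rewrite /vset /= -XE; split; exists nil.
Qed.

Lemma vset_inj p q v : vset p v -> vset q v -> p = q.
Proof. by move=> /component_eqP <- /component_eqP. Qed.

Lemma freeVreg p : free A p \/ reg A p.
Proof. exact: EM. Qed.

Lemma nX_gt0_minimal p : free A p -> (0 < nX A p)%N -> ~ cminimal p.
Proof. by move=> fp np /(free_minimal fp) n0; rewrite n0 in np. Qed.

Lemma block_sep p v (i : 'I_(nX A p)) : free A p -> vset p v ->
  sep v (block i).
Proof.
move=> fp pv0; rewrite (free_sep fp (nX_gt0_minimal fp _) pv0); first by exists i.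
exact: leq_ltn_trans (ltn_ord i).
Qed.

Lemma src_alpha p v (i : 'I_(nX A p)) : free A p -> vset p v -> src (alpha i) = v.
Proof. by move=> fp pv0; have [] := alpha_loop fp pv0 i. Qed.
Lemma rng_alpha p v (i : 'I_(nX A p)) : free A p -> vset p v -> rng (alpha i) = v.
Proof. by move=> fp pv0; have [] := alpha_loop fp pv0 i. Qed.
Lemma src_beta p v (i : 'I_(nX A p)) (t : 'I_(nbeta i)) :
  free A p -> vset p v -> src (beta t) = v.
Proof. by move=> fp pv0; apply: (sep_src (block_sep i fp pv0)); right; exists t. Qed.

Lemma free_edge p e : free A p -> vset p (src e) ->
  (exists i : 'I_(nX A p), e = alpha i) \/
  (exists (i : 'I_(nX A p)) (t : 'I_(nbeta i)), e = beta t).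
Proof.
move=> fp pe0; have nm : ~ cminimal p.
  by move=> mp; have : out_edges (src e) e by []; rewrite (free_sink fp pe0).2.
have [X + Xe] := sep_edge e.
rewrite (free_sep fp nm pe0) => -[i _ Xi].
by move: Xe; rewrite -Xi => -[->|[t _ <-]]; [left; exists i|right; exists i, t].
Qed.

Lemma pt_reg b i p e : reg A p -> vset p (src e) ->
  pt b i (src e) * pe e = pe e * pt b i (rng e).
Proof.
move=> rp /component_eqP ep; rewrite -ep in rp.
have h : pt true i (src e) * pe e = pe e * pt true i (rng e).
  by rewrite !smulE; apply: sec_eq; constructor.
case: b => //; rewrite -{1}pe_rng -(ptTF i) !smulA -(smulA _ (pe e)) -h !smulA.
by rewrite [pt false _ _ * _]ptC ptTF pe_src.
Qed.

Lemma pt_alpha b i p v (j : 'I_(nX A p)) : free A p -> vset p v ->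
  pt b i v * pe (alpha j) = pe (alpha j) * pt b i v.
Proof.
move=> fp vp; case: b; first by rewrite !smulE; apply: sec_eq; constructor.
have h : pt true i v * (pe (alpha j))^* = (pe (alpha j))^* * pt true i v.
  by rewrite sstarE !smulE; apply: sec_eq; constructor.
by rewrite -ptT_star -[pe _]starK -!starM h.
Qed.

Lemma pt_beta b i p v (j : 'I_(nX A p)) (s : 'I_(nbeta j)) : free A p -> vset p v ->
  pt b i v * pe (beta s) = pe (beta s) * pt b (i + nX A p - 1)%N (rng (beta s)).
Proof. by move=> fp vp; rewrite !smulE; apply: sec_eq; constructor. Qed.

Lemma pt_edge i p e : vset p (src e) -> exists2 i', (i' <= i + nX A p)%N &
  forall b, pt b i (src e) * pe e = pe e * pt b i' (rng e).
Proof.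
move=> pe0; case: (freeVreg p) => [fp|rp]; last first.
  by exists i; [exact: leq_addr|move=> b; exact: pt_reg rp _].
case: (free_edge fp pe0) => [[j ej]|[j [t ej]]]; rewrite ej in pe0 *.
- exists i; first exact: leq_addr.
  move=> b; rewrite (pt_alpha _ _ _ fp pe0).
  by rewrite (rng_alpha j fp pe0).
- by exists (i + nX A p - 1)%N; [exact: leq_subr|move=> b; rewrite (pt_beta _ _ _ fp pe0)].
Qed.

(* The ways in which e^* can be moved to the right of f. *)
Inductive edge_rel e f : Prop :=
  | ER_eq of e = f
  | ER_orth of (pe e)^* * pe f = 0
  | ER_comm of src e = rng e & src f = rng f & src e = src f
      & pe e * pe f = pe f * pe e
      & (pe e)^* * pe f = pe f * (pe e)^*
  | ER_alpha_beta i of src e = rng e & src e = src f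
      & pe e * pe f = pe f * pt true i (rng f)
      & (pe e)^* * pe f = pe f * pt false i (rng f)
  | ER_beta_alpha i of src f = rng f & src e = src f
      & pe f * pe e = pe e * pt true i (rng e)
      & (pe e)^* * pe f = pt true i (rng e) * (pe e)^*.

Lemma alphaC p (i j : 'I_(nX A p)) : free A p -> i <> j ->
  pe (alpha i) * pe (alpha j) = pe (alpha j) * pe (alpha i).
Proof. by move=> fp ij; rewrite !smulE; apply: sec_eq; constructor. Qed.

Lemma alpha_starC p (i j : 'I_(nX A p)) : free A p -> i <> j ->
  (pe (alpha i))^* * pe (alpha j) = pe (alpha j) * (pe (alpha i))^*.
Proof.
move=> fp ij; rewrite sstarE !smulE; apply: sec_eq; apply: srel_sym.
by constructor => //; exact: nesym.
Qed.

Lemma alpha_beta p (i j : 'I_(nX A p)) (t : 'I_(nbeta j)) : free A p -> i <> j ->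
  pe (alpha i) * pe (beta t) = pe (beta t) * pt true (unbump j i) (rng (beta t)).
Proof. by move=> fp ij; rewrite !smulE; apply: sec_eq; constructor. Qed.

Lemma alpha_star_beta p (i j : 'I_(nX A p)) (t : 'I_(nbeta j)) :
  free A p -> i <> j -> (pe (alpha i))^* * pe (beta t) =
  pe (beta t) * pt false (unbump j i) (rng (beta t)).
Proof. by move=> fp ij; rewrite sstarE !smulE; apply: sec_eq; constructor. Qed.

Lemma alpha_beta_orth p (i : 'I_(nX A p)) (t : 'I_(nbeta i)) : free A p ->
  (pe (alpha i))^* * pe (beta t) = 0.
Proof.
move=> fp; have [v vp] := vset_inhab p.
apply: (pe_orth (block_sep i fp vp)); [by left|by right; exists t|].
have [q [_ qp] qt] := beta_range fp t.
move=> ab; have : vset p (rng (beta t)) by rewrite -ab (rng_alpha _ fp vp).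
by move=> /(vset_inj qt).
Qed.

Lemma beta_orth p (i j : 'I_(nX A p)) (s : 'I_(nbeta i)) (t : 'I_(nbeta j)) :
  free A p -> Tagged (fun i => 'I_(nbeta i)) s <> Tagged _ t ->
  (pe (beta s))^* * pe (beta t) = 0.
Proof. by move=> fp st; rewrite sstarE !smulE; apply: sec_eq; constructor. Qed.

Lemma pe_orth_src e f : src e <> src f -> (pe e)^* * pe f = 0.
Proof.
move=> ef; rewrite -(pe_src e) -(pe_src f) starM pv_star !smulA.
by rewrite (smul_eqr (pv_orth ef)) smuls0 smul0s.
Qed.

(** Distinct sources are orthogonal by (R1), and a regular vertex has a single block, so (R2)
    applies there. At a free vertex: two loops commute by (R3), two betas are orthogonal by (R4),
    and a loop against a beta falls under (R2) in the same block and under (R8) otherwise. *)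
Lemma edge_relP e f : edge_rel e f.
Proof.
have [ef|ef] := EM (src e = src f); last by apply: ER_orth; exact: pe_orth_src.
have pe0 : vset (comp_of (src e)) (src e) by apply/component_eqP.
move: (comp_of (src e)) pe0 => p pe0; have pf0 := pe0; rewrite ef in pf0.
have [->|nef] := EM (e = f); first exact: ER_eq.
case: (freeVreg p) => [fp|rp]; last first.
  have [X XE] := reg_sep rp pe0.
  have [Y eY Ye] := sep_edge e; have [Z fZ Zf] := sep_edge f.
  have ZY : Z = Y by move: eY fZ; rewrite -ef XE /= => -> ->.
  by apply: ER_orth; apply: (pe_orth eY Ye _ nef); rewrite -ZY.
case: (free_edge fp pe0) (free_edge fp pf0) => [[i ei]|[i [s ei]]] [[j fj]|[j [t fj]]];
  rewrite ei fj in ef nef pe0 pf0 *.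
- have ij : i <> j by move=> ij; apply: nef; rewrite ij.
  apply: ER_comm => //; rewrite ?(rng_alpha _ fp pe0) ?(rng_alpha _ fp pf0) //.
    exact: alphaC.
  exact: alpha_starC.
- have [ij|ij] := EM (i = j).
    by subst j; apply: ER_orth; exact: alpha_beta_orth.
  apply: (@ER_alpha_beta _ _ (unbump j i)) => //.
  + by rewrite (rng_alpha _ fp pe0).
  + exact: alpha_beta.
  + exact: alpha_star_beta.
- have [ij|ij] := EM (i = j).
    by subst j; apply: ER_orth; rewrite -[_ * _]starK starM starK alpha_beta_orth// star0.
  have ji : j <> i by exact: nesym.
  apply: (@ER_beta_alpha _ _ (unbump i j)) => //.
  + by rewrite (rng_alpha _ fp pf0).
  + exact: alpha_beta.
  + by rewrite -[LHS]starK starM starK alpha_star_beta// starM pt_star.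
- apply: ER_orth; apply: beta_orth => // st; apply: nef.
  have ij := EqdepFacts.eq_sigT_fst st; subst j.
  by have /eqP := st; rewrite eq_Tagged => /eqP /= ->.
Qed.

End SecRelations.

Lemma comm_conj (S : star_semigroup) (q f p : S) : q^* = q ->
  q * f = f * q -> q * p = p * q -> q * (f * p * f^*) = f * p * f^* * q.
Proof.
move=> qs qf qp; have fq : q * f^* = f^* * q.
  by rewrite -{1}qs -{2}qs -!starM qf.
by rewrite !smulA qf (smul_eqr qp) smulA (smul_eqr fq) smulA.
Qed.

(** * Normal forms, and why S(E,C) is an inverse semigroup *)

Section NormalForm.
Variables (E : sepgraph) (A : adaptable E).
Local Notation S := (SEC A).
Local Notation pv := (pv A).
Local Notation pe := (pe A).
Local Notation pt := (pt A).
Implicit Types (v w : vertex E) (e f : edge E) (p : component E) (a b s x : S).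

Inductive positive : S -> Prop :=
  | positive0 : positive 0
  | positive_pv v : positive (pv v)
  | positive_pe e a : positive a -> positive (pe e * a)
  | positive_pt c i v a : positive a -> positive (pt c i v * a).

Definition supported s := s = 0 \/ exists v w, s = pv v * s /\ s = s * pv w.

Lemma supportedM a b : supported a -> supported b -> supported (a * b).
Proof.
move=> [->|[v [_ [av _]]]]; first by rewrite smul0s; left.
move=> [->|[_ [w [_ bw]]]]; first by rewrite smuls0; left.
by right; exists v, w; rewrite smulA -av -smulA -bw.
Qed.

Lemma supportedP s : supported s.
Proof.
elim/sec_ind: s => [|v|e|c i v|a b|a].
- by left.
- by right; exists v, v; rewrite pvv.
- by right; exists (src e), (rng e); rewrite pe_src pe_rng.
- by right; exists v, v; rewrite pv_pt pt_pv.
- exact: supportedM.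
- move=> [->|[v [w [av aw]]]]; first by left; rewrite star0.
  right; exists w, v; split; first by rewrite -[pv w]pv_star -starM -aw.
  by rewrite -[pv v]pv_star -starM -av.
Qed.

Lemma pv_mul v s : pv v * s = 0 \/ pv v * s = s.
Proof.
case: (supportedP s) => [->|[w [_ [sw _]]]]; first by left; rewrite smuls0.
have [<-|vw] := EM (w = v); first by right; rewrite -sw.
by left; rewrite sw smulA pv_orth ?smul0s //; exact: nesym.
Qed.

Lemma mul_pv v s : s * pv v = 0 \/ s * pv v = s.
Proof.
rewrite -[s * _]starK starM pv_star; case: (pv_mul v s^*) => ->.
  by left; rewrite star0.
by right; rewrite starK.
Qed.

(** In a^* a every letter meets its own adjoint, so the word collapses from the middle to the vertex
    where it ends; incompatible neighbouring letters give 0. *)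
Lemma positive_iso a : positive a ->
  a = 0 \/ exists w, a * pv w = a /\ a^* * a = pv w.
Proof.
elim=> [|v|e {}a _ IH|c i v {}a _ IH]; first by left.
- by right; exists v; rewrite pv_star pvv.
- case: (pv_mul (rng e) a) => ra; first by left; rewrite -pe_rng -smulA ra smuls0.
  case: IH => [->|[w [aw aa]]]; first by left; rewrite smuls0.
  right; exists w; rewrite -smulA aw; split=> //.
  by rewrite starM !smulA (smul_eqr (pe_iso A e)) -smulA ra.
- case: (pv_mul v a) => ra; first by left; rewrite -pt_pv -smulA ra smuls0.
  case: IH => [->|[w [aw aa]]]; first by left; rewrite smuls0.
  right; exists w; rewrite -smulA aw; split=> //.
  have tt : pt (~~ c) i v * pt c i v = pv v by rewrite ptC ptV.
  by rewrite starM pt_star !smulA (smul_eqr tt) -smulA ra.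
Qed.

Definition normal s := exists a b, [/\ positive a, positive b & s = a * b^*].

Lemma normal0 : normal 0.
Proof. by exists 0, 0; rewrite smul0s; split=> //; exact: positive0. Qed.

Lemma normal_pe e s : normal s -> normal (pe e * s).
Proof.
by move=> [a [b [pa pb ->]]]; exists (pe e * a), b; rewrite smulA; split=> //; constructor.
Qed.
Lemma normal_pt c i v s : normal s -> normal (pt c i v * s).
Proof.
by move=> [a [b [pa pb ->]]]; exists (pt c i v * a), b; rewrite smulA; split=> //; constructor.
Qed.
Lemma normal_pv v s : normal s -> normal (pv v * s).
Proof. by case: (pv_mul v s) => -> // _; exact: normal0. Qed.

Lemma pe_star_pt e c i : exists i',
  (pe e)^* * pt c i (src e) = pt c i' (rng e) * (pe e)^*.
Proof.
have pe0 : vset (comp_of (src e)) (src e) by apply/component_eqP.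
have [i' _ h] := pt_edge A i pe0; exists i'.
by rewrite -[LHS]starK starM starK pt_star h starM pt_star negbK.
Qed.

Lemma pe_star_pt0 e c i v : src e <> v -> (pe e)^* * pt c i v = 0.
Proof.
move=> ev; rewrite -(pe_src A e) -pv_pt starM pv_star !smulA.
by rewrite (smul_eqr (pv_orth A ev)) smuls0 smul0s.
Qed.

Lemma positiveM a b : positive a -> positive b -> positive (a * b).
Proof.
move=> pa pb; elim: pa => [|v|e {}a _ IH|c i v {}a _ IH].
- by rewrite smul0s; constructor.
- by case: (pv_mul v b) => -> //; constructor.
- by rewrite -smulA; constructor.
- by rewrite -smulA; constructor.
Qed.

(** The letter e^* travels to the right through the positive half. At each letter [edge_relP]
    cancels it, kills the word, or lets one of the two letters pass, possibly leaving a t behind. *)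
Lemma normal_pe_star e s : normal s -> normal ((pe e)^* * s).
Proof.
move=> [a [b [pa pb ->]]]; elim: pa e => [|v|f {}a pa IH|c i v {}a pa IH] e.
- by rewrite smul0s smuls0; exact: normal0.
- case: (pv_mul v b^*) => ->; first by rewrite smuls0; exact: normal0.
  exists (pv (rng e)), (b * pe e); split; first by constructor.
    by apply: positiveM => //; rewrite -pe_rng; do 2 constructor.
  by rewrite starM smulA -[pv _]pv_star -(starM (pe e)) pe_rng.
- have nab : normal (a * b^*) by exists a, b.
  rewrite !smulA; case: (edge_relP A e f) => [<-|->|_ _ _ _ ->|i _ _ _ ->|i _ _ _ ->].
  + by rewrite pe_iso -smulA; exact: normal_pv.
  + by rewrite !smul0s; exact: normal0.
  + by rewrite -!smulA; apply: normal_pe; rewrite smulA -smulA; exact: IH.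
  + by rewrite -!smulA; apply: normal_pe; exact: normal_pt.
  + by rewrite -!smulA; apply: normal_pt; exact: IH.
- rewrite !smulA; have [<-|ev] := EM (src e = v); last first.
    by rewrite pe_star_pt0 // !smul0s; exact: normal0.
  have [i' ->] := pe_star_pt e c i.
  by rewrite -!smulA; apply: normal_pt; exact: IH.
Qed.

Lemma normalP s : normal s.
Proof.
(* Treating [s] and its adjoint together lets the induction on generators pass through stars. *)
suff [h _] : (forall x, normal x -> normal (s * x)) /\ (forall x, normal x -> normal (s^* * x)).
  case: (supportedP s) => [->|[_ [w [_ ->]]]]; first exact: normal0.
  apply: h; exists (pv w), (pv w); rewrite pv_star pvv.
  by split=> //; constructor.
elim/sec_ind: s => [|v|e|c i v|a b [a1 a2] [b1 b2]|a [a1 a2]].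
- by split=> x _; rewrite ?star0 smul0s; exact: normal0.
- by rewrite pv_star; split=> x; exact: normal_pv.
- by split=> x; [exact: normal_pe|exact: normal_pe_star].
- by rewrite pt_star; split=> x; exact: normal_pt.
- by rewrite starM; split=> x nx; rewrite -smulA; auto.
- by rewrite starK.
Qed.

Lemma positive_range s : exists2 a, positive a & s * s^* = a * a^*.
Proof.
have [a [b [pa pb ->]]] := normalP s.
case: (positive_iso pb) => [->|[w [_ bb]]].
  by exists 0; [constructor|rewrite star0 !(smuls0, smul0s)].
rewrite starM starK !smulA (smul_eqr bb).
case: (mul_pv w a) => ->; last by exists a.
by exists 0; [constructor|rewrite !smul0s].
Qed.

(** With s = a b^*, both a^* a and b^* b are vertices (or a factor is 0), so they disappear from s
    s^* s. *)
Lemma sec_regular s : s * s^* * s = s.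
Proof.
have [a [b [pa pb ->]]] := normalP s.
case: (positive_iso pb) => [->|[w [bw bb]]].
  by rewrite star0 !(smuls0, smul0s).
case: (positive_iso pa) => [->|[v [av aa]]]; first by rewrite !smul0s.
have wb : pv w * b^* = b^* by rewrite -{2}bw starM pv_star.
rewrite starM starK !smulA (smul_eqr bb) -(smulA (a * pv w)) aa.
rewrite -(smulA (a * pv w)) ; case: (pv_mul v b^*) => vb; rewrite vb.
  by rewrite smuls0 -av -smulA vb smuls0.
by rewrite -smulA wb.
Qed.

(** Induction on the letters of a. A first letter f equal or orthogonal to e decides at once;
    otherwise e e^* either commutes with f, so the induction hypothesis applies, or absorbs f. *)
Lemma pe_range_comm e a : positive a ->
  pe e * (pe e)^* * (a * a^*) = a * a^* * (pe e * (pe e)^*).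
Proof.
have qs : (pe e * (pe e)^*)^* = pe e * (pe e)^* by rewrite starM starK.
elim=> [|v|f {}a _ IH|c i v {}a _ IH].
- by rewrite !(smul0s, smuls0).
- rewrite pv_star pvv; have [<-|ev] := EM (src e = v).
    by rewrite !smulA pe_src -[pv _]pv_star -!smulA -starM pe_src.
  rewrite -(pe_src A e) starM pv_star !smulA (pv_orth A (nesym ev)).
  by rewrite (smul_eqr (pv_orth A ev)) !(smul0s, smuls0).
- have -> : pe f * a * (pe f * a)^* = pe f * (a * a^*) * (pe f)^*.
    by rewrite starM !smulA.
  case: (edge_relP A e f) => [<-|ef|_ _ _ fe sfe|i _ _ fe sfe|i _ _ ef sef].
  + have re : pv (rng e) * (pe e)^* = (pe e)^*.
      by rewrite -{1}pv_star -starM pe_rng.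
    by rewrite !smulA !(smul_eqr (pe_iso A e)) pe_rng (smul_eqr re).
  + have fe : (pe f)^* * pe e = 0 by rewrite -[LHS]starK starM starK ef star0.
    by rewrite !smulA (smul_eqr ef) (smul_eqr fe) !(smul0s, smuls0).
  + apply: comm_conj => //.
    by rewrite -smulA sfe smulA fe smulA.
  + have ef : pe e * (pe e)^* * pe f = pe f.
      by rewrite -smulA sfe smulA fe -smulA ptV pe_rng.
    have fe' : (pe f)^* * (pe e * (pe e)^*) = (pe f)^*.
      by rewrite -qs -starM ef.
    by rewrite !smulA ef -[in RHS](smulA _ (pe e)) (smul_eqr fe').
  + apply: comm_conj => //.
    by rewrite -smulA sef !smulA ef.
- have -> : pt c i v * a * (pt c i v * a)^* = pt c i v * (a * a^*) * (pt c i v)^*.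
    by rewrite starM !smulA.
  have [ev|ev] := EM (src e = v); last first.
    rewrite -(pe_src A e) -pv_pt !starM !pv_star !smulA.
    rewrite (smul_eqr (pv_orth A ev)) (smul_eqr (pv_orth A (nesym ev))).
    by rewrite !(smul0s, smuls0).
  apply: comm_conj => //; subst v.
  have pe0 : vset (comp_of (src e)) (src e) by apply/component_eqP.
  have [i' _ h] := pt_edge A i pe0.
  have h' := congr1 (@star S) (h (~~ c)).
  rewrite !starM !pt_star !negbK in h'.
  by rewrite -smulA h' !smulA h.
Qed.

(** The induction step for [range_comm]: once g g^* commutes with y y^*, the letter g can be
    stripped from the word, at the price of replacing y by g^* y. *)
Lemma range_comm_mul (g b y : S) :
  g * g^* * (y * y^*) = y * y^* * (g * g^*) ->
  b * b^* * (g^* * y * (g^* * y)^*) = g^* * y * (g^* * y)^* * (b * b^*) ->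
  g * b * (g * b)^* * (y * y^*) = y * y^* * (g * b * (g * b)^*).
Proof.
have -> : g^* * y * (g^* * y)^* = g^* * (y * y^*) * g by rewrite starM starK !smulA.
have -> : g * b * (g * b)^* = g * (b * b^*) * g^* by rewrite starM !smulA.
move: (y * y^*) (b * b^*) => q p gq pq.
have gs : g^* * g * g^* = g^* by rewrite -{2}(starK g) sec_regular.
have g1 : q * g = g * (g^* * q * g) by rewrite !smulA gq -smulA sec_regular.
have g2 : g^* * q = g^* * q * g * g^*.
  by rewrite -(smulA _ g) -(smulA _ q) -gq !smulA gs.
have -> : g * p * g^* * q = g * (p * (g^* * q * g)) * g^*.
  by rewrite -(smulA _ g^*) [in LHS]g2 !smulA.
have -> : q * (g * p * g^*) = g * (g^* * q * g * p) * g^*.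
  by rewrite 2!smulA g1 !smulA.
by rewrite pq.
Qed.

Lemma pv_range_comm v x : pv v * (x * x^*) = x * x^* * pv v.
Proof.
rewrite -[in RHS]smulA -[pv v in RHS]pv_star -starM smulA.
by case: (pv_mul v x) => ->; rewrite ?star0 ?smuls0 ?smul0s.
Qed.

Lemma range_comm s x : s * s^* * (x * x^*) = x * x^* * (s * s^*).
Proof.
have [a pa ->] := positive_range s.
elim: pa x => [|v|e {}a _ IH|c i v {}a _ IH] x.
- by rewrite !(smul0s, smuls0).
- by rewrite pv_star pvv pv_range_comm.
- apply: range_comm_mul; last exact: IH.
  by have [y py ->] := positive_range x; exact: pe_range_comm.
- apply: range_comm_mul; last exact: IH.
  by rewrite pt_star ptV pv_range_comm.
Qed.

Lemma pv_path0 v w l : is_path setT v l w -> pv v = 0 -> pv w = 0.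
Proof.
elim: l v => [v -> //|e l IH v [_ ev /IH h] v0]; apply: h.
by rewrite -(pe_iso A) -pe_src ev v0 smul0s smuls0.
Qed.

(** At a free vertex the loop alpha of the block will do; at a regular vertex transitivity of E_p
    leads back. Along such a path the vanishing of a vertex is carried back to v. *)
Lemma sep_return v X : sep v X -> exists2 e, X e & exists l, is_path setT (rng e) l v.
Proof.
have vp : vset (comp_of v) v by apply/component_eqP.
move: (comp_of v) vp => p vp; case: (freeVreg A p) => [fp|rp] vX.
  have nm : ~ cminimal p.
    move=> mp; have [vX1 vX2 vX3] := sep_partition v.
    have [e Xe] := vX3 _ vX.
    have : out_edges v e by exact: sep_src vX Xe.
    by rewrite (free_sink fp vp).2.
  move: vX; rewrite (free_sep fp nm vp) => -[i _ <-].
  by exists (alpha i); [left|exists nil; exact: rng_alpha].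
have [e [_ [_ [pe0 ev] _]]] := reg_two rp vp.
have [Y] := reg_sep rp vp; have [Z vZ Ze] := sep_edge e => YE.
have ZX : Z = X by move: vZ vX; rewrite ev YE /= => -> ->.
exists e; first by rewrite -ZX.
have [_ rp0] := sub_edgeP pe0; have [l pl] := reg_transitive rp rp0 vp.
exists l; elim: l (rng e) pl {rp0} => //= f l IH u [_ fu h]; split=> //.
exact: IH.
Qed.

(* For idempotents [s]: the ranges of the edges of a block at v cover v. *)
Lemma block_cover v X s : sep v X -> (forall e, X e -> (pe e)^* * s = 0) ->
  pv v * s = 0.
Proof.
have [a [b [pa pb ->]]] := normalP s.
elim: pa v X {s} => [|w|f {}a pa IH|c i w {}a pa IH] v X vX X0.
- by rewrite smul0s smuls0.
- have [wv|wv] := EM (v = w); last by rewrite smulA (pv_orth A wv) smul0s.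
  subst w; rewrite smulA pvv.
  have X1 e : X e -> (pe e)^* * b^* = 0.
    move=> Xe; rewrite -(X0 e Xe) smulA; congr (_ * _).
    by rewrite -(pv_star A v) -starM -(sep_src vX Xe) pe_src.
  case: (positive_iso pb) => [->|[w [bw bb]]]; first by rewrite star0 smuls0.
  have [wv|wv] := EM (v = w); last first.
    by rewrite -bw starM pv_star smulA (pv_orth A wv) smul0s.
  subst w; have [e Xe [l lv]] := sep_return vX.
  (* Now b^* b = v, so e^* e = e^* b^* b e = 0. Thus the vertex [rng e] is 0, and the return path
     makes v equal to 0. *)
  suff -> : pv v = 0 by rewrite smul0s.
  apply: pv_path0 lv _.
  rewrite -(pe_iso A) -{2}pe_src (sep_src vX Xe) -bb !smulA X1//.
  by rewrite !smul0s.
- have [fv|fv] := EM (src f = v); last first.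
    by rewrite !smulA -(pe_src A f) smulA (pv_orth A (nesym fv)) !smul0s.
  have [Xf|nXf] := EM (X f).
    have h : pv (rng f) * a * b^* = 0.
      by have := X0 f Xf; rewrite !smulA pe_iso.
    have <- : pe f * (pv (rng f) * a * b^*) = pe f * a * b^* by rewrite !smulA pe_rng.
    by rewrite h !smuls0.
  (* An edge at v outside X exists only over a free component, where X is the block of some i and f
     lies in a block j different from i. *)
  have vp : vset (comp_of v) v by apply/component_eqP.
  move: (comp_of v) vp => p vp; case: (freeVreg A p) => [fp|rp]; last first.
    have [Y YE] := reg_sep rp vp; have [Z + Zf] := sep_edge f.
    by move: vX; rewrite fv YE /= => XY ZY; case: nXf; rewrite XY -ZY.
  have [i XE] : exists i : 'I_(nX A p), block i = X.
    move: vX; rewrite (free_sep fp _ vp); first by case=> i _ <-; exists i.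
    move=> mp; have : out_edges v f by [].
    by rewrite (free_sink fp vp).2.
  have rf : rng (alpha i) = v := rng_alpha i fp vp.
  have X0' e : X e -> (pe e)^* * pe f * (a * b^*) = 0.
    by move=> /X0; rewrite !smulA.
  have pf : vset p (src f) by rewrite fv.
  rewrite -smulA; case: (free_edge fp pf) => -[j].
    move=> fj; subst f; have ji : j <> i.
      by move=> ji; apply: nXf; rewrite -XE ji; left.
    have ij : i <> j by exact: nesym.
    have fva : pe (alpha j) = pe (alpha j) * pv v by rewrite -(rng_alpha j fp vp) pe_rng.
    (* For a loop f, each e^* with e in X passes f up to an invertible t, so X annihilates the
       remaining word as well. *)
    rewrite fva -smulA (IH v X vX) ?smuls0// => e Xe.
    have := Xe; rewrite -XE => -[ei|[t _ et]].
      have {}ei : e = alpha i := ei.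
      subst e; have := X0' _ Xe; rewrite alpha_starC// => /(congr1 (smul (pe (alpha j))^*)).
      rewrite smuls0 !smulA pe_iso (rng_alpha j fp vp) -{1}rf -{1}pv_star -starM pe_rng.
      by rewrite -smulA.
    subst e; have := X0' _ Xe.
    have -> : (pe (beta t))^* * pe (alpha j) =
        pt true (unbump i j) (rng (beta t)) * (pe (beta t))^*.
      by rewrite -[LHS]starK starM starK alpha_star_beta // starM pt_star.
    move=> /(congr1 (smul (pt false (unbump i j) (rng (beta t))))).
    rewrite smuls0 !smulA (ptV A false) -{1}pv_star -starM pe_rng.
    by rewrite -smulA.
  move=> [t ft]; subst f; have ji : j <> i.
    by move=> ji; apply: nXf; subst j; rewrite -XE; right; exists t.
  have ij : i <> j by exact: nesym.
  (* For f a beta, alpha_i^* passes f at the cost of an invertible t only, so alpha_i^* s = 0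
     already forces s = 0. *)
  have Xi : X (alpha i) by rewrite -XE; left.
  have := X0' _ Xi; rewrite alpha_star_beta //.
  set r := rng _; move=> /(congr1 (fun z =>
    pe (beta t) * (pt true (unbump j i) r * ((pe (beta t))^* * z)))).
  rewrite !smuls0 !smulA (smul_eqr (pe_iso A _)) -(smulA (pe _)) pt_pv.
  rewrite -(smulA (pe _)) ptTF pe_rng.
  by rewrite -!smulA => ->; rewrite smuls0.
- rewrite -!smulA; have [wv|wv] := EM (v = w); last first.
    by rewrite -(pv_pt A c i w) -!smulA smulA (pv_orth A wv) !smul0s.
  have -> : pt c i w * (a * b^*) = pt c i w * (pv v * (a * b^*)) by rewrite wv [RHS]smulA pt_pv.
  rewrite (IH v X vX) ?smuls0// => e Xe.
  have ev := sep_src vX Xe; have [i' h] := pe_star_pt e c i.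
  have := X0 e Xe; rewrite -wv -ev !smulA h.
  move=> /(congr1 (smul (pt (~~ c) i' (rng e)))); rewrite smuls0 !smulA.
  by rewrite [pt _ _ _ * _]ptC ptV -{1}pv_star -starM pe_rng -smulA.
Qed.

End NormalForm.

(** * Tight filters and germs of an inverse semigroup *)

Section InverseSemigroup.
Variable S : star_semigroup.
Hypothesis regular : forall s : S, s * s^* * s = s.
Hypothesis range_comm : forall s t : S, s * s^* * (t * t^*) = t * t^* * (s * s^*).
Implicit Types (s t u e f : S) (x y : tight_spectrum S).

Lemma regular_star s : s^* * s * s^* = s^*.
Proof. by rewrite -{2}(starK s) regular. Qed.

Lemma idem_range s : idem (s * s^*).
Proof. by rewrite /idem /= smulA regular. Qed.
Lemma idem_source s : idem (s^* * s).
Proof. by rewrite /idem /= smulA regular_star. Qed.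

(** Both e and e^* are idempotent, hence e^* e e e^* = e^* and e e^* e^* e = e; these products agree
    because the two ranges commute. *)
Lemma idem_star e : idem e -> e^* = e.
Proof.
move=> ee; have ee' : e^* * e^* = e^* by rewrite -starM ee.
have h : e^* * e * (e * e^*) = e * e^* * (e^* * e).
  by have := range_comm e^* e; rewrite starK.
have <- : e^* * e * (e * e^*) = e^* by rewrite !smulA (smul_eqr ee) regular_star.
by rewrite h !smulA (smul_eqr ee') regular.
Qed.

Lemma idem_rangeE e : idem e -> e * e^* = e.
Proof. by move=> ie; rewrite idem_star. Qed.

Lemma idemC e f : idem e -> idem f -> e * f = f * e.
Proof. by move=> ie jf; rewrite -(idem_rangeE ie) -(idem_rangeE jf) range_comm. Qed.

Lemma idemM e f : idem e -> idem f -> idem (e * f).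
Proof.
by move=> ie jf; rewrite /idem /= smulA -(smulA e) (idemC jf ie) smulA ie -smulA jf.
Qed.

Lemma idem_conj s f : idem f -> idem (s^* * f * s).
Proof.
move=> jf; rewrite /idem /= !smulA -(smulA (s^* * f)) -(smulA s^*).
by rewrite (idemC jf (idem_range s)) !smulA regular_star (smul_eqr jf).
Qed.

Lemma idem_conj' s f : idem f -> idem (s * f * s^*).
Proof. by move=> jf; have := idem_conj s^* jf; rewrite starK. Qed.

Lemma ileM e f : idem e -> idem f -> ile (e * f) e /\ ile (e * f) f.
Proof.
by move=> ie jf; split; rewrite /ile -smulA; [rewrite (idemC jf ie) smulA ie|rewrite jf].
Qed.

Lemma conjM s e f : idem e -> idem f ->
  s^* * e * s * (s^* * f * s) = s^* * (e * f) * s.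
Proof.
move=> ie jf; rewrite !smulA -(smulA (s^* * e)) -(smulA s^*).
by rewrite (idemC ie (idem_range s)) !smulA regular_star.
Qed.

Lemma filter_idem x e : fval x e -> idem e.
Proof. by move: e; have [[]] := set_valP x. Qed.
Lemma filter0 x : ~ fval x 0.
Proof. by have [[]] := set_valP x. Qed.
Lemma filterM x e f : fval x e -> fval x f -> fval x (e * f).
Proof. by move: e f; have [[]] := set_valP x. Qed.
Lemma filter_up x e f : idem f -> fval x e -> ile e f -> fval x f.
Proof. by move: e f; have [[]] := set_valP x. Qed.
Lemma filter_inhab x : exists e, fval x e.
Proof. by have [[]] := set_valP x. Qed.
Lemma filter_cover x e Z : fval x e -> finite_cover e Z -> exists2 z, Z z & fval x z.
Proof. by have [_ h] := set_valP x => xe; exact: h. Qed.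

Lemma filterMl x e f : idem e -> idem f -> fval x (e * f) -> fval x e.
Proof. by move=> ie jf h; apply: (filter_up ie h); exact: (ileM ie jf).1. Qed.
Lemma filterMr x e f : idem e -> idem f -> fval x (e * f) -> fval x f.
Proof. by move=> ie jf h; apply: (filter_up jf h); exact: (ileM ie jf).2. Qed.

Lemma fval_inj x y : (forall e, fval x e = fval y e) -> x = y.
Proof. by move=> xy; apply: val_inj; apply: funext. Qed.

Lemma ile_conj s e f : idem e -> idem f -> ile e f -> ile (s^* * e * s) (s^* * f * s).
Proof. by move=> ie jf ef; rewrite /ile conjM // ef. Qed.

Lemma conj_absorb s e : idem e -> s^* * e * s * s^* = s^* * e.
Proof.
move=> ie; rewrite -(smulA (s^* * e)) -(smulA s^*) (idemC ie (idem_range s)).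
by rewrite !smulA regular_star.
Qed.

Lemma filter_conj x s f : idem f -> fval x (s^* * f * s) -> fval x (s^* * s).
Proof.
move=> jf h; apply: (filter_up _ h); first exact: idem_source.
by rewrite /ile -!smulA (smulA s) regular.
Qed.

(** For tightness, a finite cover Z of e pulls back to the finite cover s^* Z s of s^* e s: a
    nonzero f below s^* e s is pushed forward to s f s^*, which meets some z in Z. *)
Lemma act_tight s x : fval x (s^* * s) -> tight (act_fun s x).
Proof.
move=> xs; have actP f : act_fun s x f <-> idem f /\ fval x (s^* * f * s).
  by split=> [/andP[/asboolP]|[? ?]] //; apply/andP; split=> //; exact/asboolP.
have ir := idem_range s.
split; first split.
- by move=> e /actP[].
- exists (s * s^*); apply/actP; split=> //.
  by rewrite !smulA regular_star.
- by move/actP => [_]; rewrite smuls0 smul0s; exact: filter0.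
- move=> e f /actP[ie xe] /actP[jf xf]; apply/actP; split; first exact: idemM.
  by rewrite -conjM//; exact: filterM.
- move=> e f jf /actP[ie xe] ef; apply/actP; split => //.
  by apply: (filter_up _ xe); [exact: idem_conj|exact: ile_conj].
move=> e /actP[ie xe] Z [Zfin Ze Zc].
have [|_ [z Zz <-] xz] := @filter_cover x _ [set s^* * z * s | z in Z] xe; last first.
  by exists z => //; apply/actP; split=> //; have [] := Ze _ Zz.
split; first exact: finite_image.
  move=> _ [z Zz <-]; have [iz ze] := Ze _ Zz.
  by split; [exact: idem_conj|exact: ile_conj].
move=> f [jf fe] f0.
have fs : f * (s^* * s) = f.
  have := fe; rewrite /ile -!smulA => fe'.
  by rewrite -{1}fe' -!smulA (smulA s) regular.
have sf : s^* * s * f = f by rewrite (idemC (idem_source s) jf).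
have [||z Zz fz] := Zc (s * f * s^*).
- split; first exact: idem_conj'.
  have h : s^* * e = s^* * e * s * s^*.
    by rewrite conj_absorb.
  have h' : s * f * (s^* * e * s * s^*) = s * (f * (s^* * e * s)) * s^*.
    by rewrite !smulA.
  by rewrite /ile -(smulA (s * f)) h h' fe.
- move=> h; apply: f0.
  have : s^* * (s * f * s^*) * s = 0 by rewrite h smuls0 smul0s.
  by rewrite !smulA sf -!smulA fs.
exists (s^* * z * s); first by exists z.
move=> h; apply: fz; have [iz ze] := Ze _ Zz.
have -> : s * f * s^* * z = s * (f * (s^* * z * s)) * s^*.
  by rewrite -(smulA (s * f)) -[in LHS](conj_absorb s iz) !smulA.
by rewrite h smuls0 smul0s.
Qed.

Lemma fval_act s x f : fval x (s^* * s) ->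
  fval (act s x) f = `[< idem f >] && fval x (s^* * f * s).
Proof.
by move=> xs; rewrite {1}/fval /act insubdK //; apply: mem_set; exact: act_tight.
Qed.

Lemma fval_actP s x f : fval x (s^* * s) -> fval (act s x) f <-> idem f /\ fval x (s^* * f * s).
Proof.
move=> xs; rewrite fval_act //.
by split=> [/andP[/asboolP]|[? ?]] //; apply/andP; split=> //; exact/asboolP.
Qed.

Lemma act_range s x : fval x (s^* * s) -> fval (act s x) (s * s^*).
Proof.
move=> xs; apply/fval_actP; rewrite // !smulA regular_star.
by split=> //; exact: idem_range.
Qed.

Lemma fval_source_mul s t x : fval x ((s * t)^* * (s * t)) ->
  fval x (t^* * t) /\ fval (act t x) (s^* * s).
Proof.
rewrite starM !smulA -(smulA t^*) => h.
have ht : fval x (t^* * t) by apply: filter_conj h; exact: idem_source.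
by split=> //; apply/fval_actP => //; split=> //; exact: idem_source.
Qed.

Lemma fval_mul_source s t x : fval x (t^* * t) -> fval (act t x) (s^* * s) ->
  fval x ((s * t)^* * (s * t)).
Proof. by move=> xt /(fval_actP _ xt)[_]; rewrite starM !smulA. Qed.

Lemma actM s t x : fval x ((s * t)^* * (s * t)) -> act (s * t) x = act s (act t x).
Proof.
move=> xst; have [xt xs] := fval_source_mul xst.
apply: fval_inj => f; rewrite (fval_act _ xst) (fval_act _ xs) (fval_act _ xt).
case: asboolP => //= jf; rewrite starM !smulA.
by rewrite asboolT //; exact: idem_conj.
Qed.

Lemma actK s x : fval x (s^* * s) -> act s^* (act s x) = x.
Proof.
move=> xs; have ys := act_range xs; apply: fval_inj => f.
have ys' : fval (act s x) (s^*^* * s^*) by rewrite starK.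
apply/idP/idP => [/(fval_actP _ ys')[jf /(fval_actP _ xs)[_]]|xf].
  rewrite starK !smulA -(smulA _ s^*) => h.
  have := filterMl (idemM (idem_source s) jf) (idem_source s) h.
  exact: filterMr (idem_source s) jf.
have jf := filter_idem xf; apply/(fval_actP _ ys'); split=> //.
apply/(fval_actP _ xs); rewrite starK; split; first exact: idem_conj'.
by rewrite !smulA -(smulA _ s^*); apply: filterM => //; exact: filterM.
Qed.

Lemma act_idem e x : fval x e -> act e x = x.
Proof.
move=> xe; have ie := filter_idem xe; have es := idem_star ie.
have xe' : fval x (e^* * e) by rewrite es ie.
apply: fval_inj => f; apply/idP/idP => [/(fval_actP _ xe')[jf]|xf].
  rewrite es => h; apply: (filterMr ie jf); exact: filterMl (idemM ie jf) ie h.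
have jf := filter_idem xf; apply/(fval_actP _ xe'); split=> //.
by rewrite es; apply: filterM => //; exact: filterM.
Qed.

End InverseSemigroup.

Section MoreActions.
Variable S : star_semigroup.
Hypothesis regular : forall s : S, s * s^* * s = s.
Hypothesis range_comm : forall s t : S, s * s^* * (t * t^*) = t * t^* * (s * s^*).
Implicit Types (s t u e f : S) (x y : tight_spectrum S).

Lemma filter_range_orth x s t : fval x (s * s^*) -> fval x (t * t^*) -> s^* * t <> 0.
Proof.
move=> xs xt st; apply: (@filter0 _ x); have := filterM xs xt.
by rewrite !smulA (smul_eqr st) smuls0 smul0s.
Qed.

Lemma fval_act_starP s x f : fval x (s * s^*) ->
  fval (act s^* x) f <-> idem f /\ fval x (s * f * s^*).
Proof.
move=> xs; have xs' : fval x (s^*^* * s^*) by rewrite starK.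
by have := fval_actP regular range_comm f xs'; rewrite starK.
Qed.

(** This is how a point is read letter by letter: [s] is stripped off before [t] is tested. *)
Lemma range_mulP s t x : fval x (s * t * (s * t)^*) <->
  fval x (s * s^*) /\ fval (act s^* x) (t * t^*).
Proof.
have E : s * t * (s * t)^* = s * (t * t^*) * s^* by rewrite starM !smulA.
rewrite E; split=> [h|[xs /(fval_act_starP _ xs)[]] //].
have xs : fval x (s * s^*).
  have := @filter_conj _ regular x s^* (t * t^*); rewrite starK; apply => //.
  exact: idem_range.
by split=> //; apply/(fval_act_starP _ xs); split=> //; exact: idem_range.
Qed.

Lemma act_starM s t x : fval x (s * t * (s * t)^*) ->
  act (s * t)^* x = act t^* (act s^* x).
Proof.
by move=> h; rewrite starM (actM regular range_comm)// starM !starK -starM.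
Qed.

Lemma range_actP s t x : fval x (s^* * s) ->
  fval (act s x) (s * t * (s * t)^*) <-> fval x (t * t^*).
Proof.
move=> xs; have h := act_range regular range_comm xs.
split=> [/range_mulP[_]|xt]; first by rewrite (actK regular range_comm).
by apply/range_mulP; split=> //; rewrite (actK regular range_comm).
Qed.

Lemma act_starK s x : fval x (s * s^*) -> act s (act s^* x) = x.
Proof.
by move=> xs; have := actK regular range_comm (s := s^*) (x := x); rewrite starK; apply.
Qed.

Lemma act_star_dom s x : fval x (s * s^*) -> fval (act s^* x) (s^* * s).
Proof.
by move=> xs; have := act_range regular range_comm (s := s^*) (x := x); rewrite starK; apply.
Qed.

Lemma filter_all (I : finType) (f : I -> S) x : (forall i, fval x (f i)) ->
  exists2 e, fval x e & forall y, fval y e -> forall i, fval y (f i).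
Proof.
move=> xf; suff [e xe he] : exists2 e, fval x e &
    forall y, fval y e -> forall i, i \in enum I -> fval y (f i).
  by exists e => // y ye i; apply: he => //; rewrite mem_enum.
elim: (enum I) => [|i l [e xe he]].
  by have [e xe] := filter_inhab x; exists e.
exists (f i * e); first exact: filterM.
have [ii ie] := (filter_idem (xf i), filter_idem xe).
move=> y h j; rewrite in_cons => /orP[/eqP ->|].
  exact: (filterMl regular range_comm ii ie h).
by apply: he; exact: (filterMr regular range_comm ii ie h).
Qed.

End MoreActions.

(** * Tight filters of S(E,C): vertices, first edges, trivial action of the t_i *)

Section Points.
Variables (E : sepgraph) (A : adaptable E).
Local Notation S := (SEC A).
Local Notation pv := (pv A).
Local Notation pe := (pe A).
Local Notation pt := (pt A).
Local Notation reg_S := (@sec_regular E A).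
Local Notation comm_S := (@range_comm E A).
Implicit Types (v w : vertex E) (e : edge E) (p : component E) (f a b s : S).
Implicit Types (x y : tight_spectrum S).

(** A t crosses an edge as a t at the range of that edge and crosses back unchanged. Consequently
    the t_i commute with all idempotents and fix every point. *)
Lemma pt_comm_range c i v a : pt c i v * (a * a^*) = a * a^* * pt c i v.
Proof.
have [b pb ->] := positive_range a.
elim: pb c i v => [|w|e {}b _ IH|d j w {}b _ IH] c i v.
- by rewrite !(smul0s, smuls0).
- rewrite pv_star pvv; have [->|vw] := EM (v = w); first by rewrite pv_pt pt_pv.
  rewrite -[pt c i v in LHS]pt_pv -[pt c i v in RHS]pv_pt smulA.
  by rewrite (smul_eqr (pv_orth A vw)) (pv_orth A (nesym vw)) !(smul0s, smuls0).
- have Q : pe e * b * (pe e * b)^* = pe e * (b * b^*) * (pe e)^* by rewrite starM !smulA.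
  have [ev|ev] := EM (src e = v); last first.
    rewrite Q -(pe_src A e) starM pv_star.
    rewrite -[pt c i v in LHS]pt_pv -[pt c i v in RHS]pv_pt !smulA.
    rewrite (smul_eqr (pv_orth A (nesym ev))) (smul_eqr (pv_orth A ev)).
    by rewrite !(smul0s, smuls0).
  subst v; have pe0 : vset (comp_of (src e)) (src e) by apply/component_eqP.
  have [i' _ h] := pt_edge A i pe0.
  have h' : (pe e)^* * pt c i (src e) = pt c i' (rng e) * (pe e)^*.
    by have /(congr1 (@star S)) := h (~~ c); rewrite !starM !pt_star negbK.
  rewrite Q; move: (b * b^*) IH => q IH.
  by rewrite !smulA h (smul_eqr (IH _ _ _)) (smul_eqr h') !smulA.
- have Q : pt d j w * b * (pt d j w * b)^* = pt d j w * (b * b^*) * (pt d j w)^*.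
    by rewrite starM !smulA.
  have [vw|vw] := EM (v = w); last first.
    rewrite Q -[pt d j w]pv_pt starM pv_star.
    rewrite -[pt c i v in LHS]pt_pv -[pt c i v in RHS]pv_pt !smulA.
    rewrite (smul_eqr (pv_orth A vw)) (smul_eqr (pv_orth A (nesym vw))).
    by rewrite !(smul0s, smuls0).
  subst w; rewrite Q pt_star; move: (b * b^*) IH => q IH.
  by rewrite !smulA ptC (smul_eqr (IH _ _ _)) (smul_eqr (ptC A _ _ _ _ _)) !smulA.
Qed.

Lemma pt_comm_idem c i v f : idem f -> pt c i v * f = f * pt c i v.
Proof. by move=> jf; rewrite -(idem_rangeE reg_S comm_S jf) pt_comm_range. Qed.

Lemma pv_source_pt c i v : (pt c i v)^* * pt c i v = pv v.
Proof. by rewrite pt_star ptC ptV. Qed.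

Lemma act_pt c i v x : fval x (pv v) -> act (pt c i v) x = x.
Proof.
move=> xv; have xt : fval x ((pt c i v)^* * pt c i v) by rewrite pv_source_pt.
have ptf f : idem f -> (pt c i v)^* * f * pt c i v = f * pv v.
  move=> jf; rewrite -smulA -pt_comm_idem // smulA pv_source_pt.
  by rewrite (idemC reg_S comm_S _ jf) //; exact: filter_idem xv.
apply: fval_inj => f; apply/idP/idP => [/(fval_actP reg_S comm_S _ xt)[jf]|xf].
  by rewrite ptf //; apply: (filterMl reg_S comm_S jf); exact: filter_idem xv.
have jf := filter_idem xf; apply/(fval_actP reg_S comm_S _ xt); split=> //.
by rewrite ptf //; exact: filterM.
Qed.

Lemma vtx_exists x : exists v, fval x (pv v).
Proof.
have [f xf] := filter_inhab x; have jf := filter_idem xf.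
case: (supportedP f) => [f0|[v [_ [fv _]]]]; first by rewrite f0 in xf; case: (filter0 xf).
have iv : idem (pv v) by exact: pvv.
by exists v; apply: (filter_up iv xf); rewrite /ile (idemC reg_S comm_S jf iv).
Qed.

Definition vtx x : vertex E := projT1 (cid (vtx_exists x)).

Lemma vtxP x : fval x (pv (vtx x)).
Proof. exact: projT2 (cid (vtx_exists x)). Qed.

Lemma vtxE x v : fval x (pv v) <-> vtx x = v.
Proof.
split=> [xv|<-]; last exact: vtxP.
have [//|vw] := EM (vtx x = v).
by have := filterM (vtxP x) xv; rewrite pv_orth // => /filter0.
Qed.

Definition component_at x : component E := comp_of (vtx x).

Lemma vset_comp x p : vset p (vtx x) <-> component_at x = p.
Proof. exact: component_eqP. Qed.

Lemma range_vtx x s : fval x (s * s^*) -> pv (vtx x) * s = s.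
Proof.
move=> xs; case: (pv_mul (vtx x) s) => // vs.
have := filterM (vtxP x) xs; rewrite smulA vs smul0s.
by move/filter0.
Qed.

Lemma vtx_range x s v : pv v * s = s -> fval x (s * s^*) -> vtx x = v.
Proof.
move=> vs xs; apply/vtxE; have iv : idem (pv v) by exact: pvv.
have := xs; rewrite -{1}vs -smulA.
by apply: (filterMl reg_S comm_S iv); exact: (idem_range reg_S).
Qed.

Lemma vtx_act_star x s w : s^* * s = pv w -> fval x (s * s^*) -> vtx (act s^* x) = w.
Proof. by move=> sw /(act_star_dom reg_S comm_S); rewrite sw => /vtxE. Qed.

Lemma pe_range_vtx x e : fval x (pe e * (pe e)^*) -> vtx x = src e.
Proof. exact/vtx_range/pe_src. Qed.

(** By [block_cover] the ranges of the edges of X form a cover of v, finite because the graph is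
    finitely separated; tightness selects one of them. *)
Lemma block_head x v X : fval x (pv v) -> sep v X ->
  exists2 e, X e & fval x (pe e * (pe e)^*).
Proof.
move=> xv vX; have iv : idem (pv v) by exact: pvv.
have [|_ [e Xe <-] xe] :=
  @filter_cover _ x (pv v) [set pe e * (pe e)^* | e in X] xv; last first.
  by exists e.
split; first exact: (finite_image _ (finitely_separated A vX)).
  move=> _ [e Xe <-]; split; first exact: (idem_range reg_S).
  rewrite /ile -smulA -[pv v]pv_star -starM -(sep_src vX Xe).
  by rewrite pe_src.
move=> f [jf fv] f0; apply: contrapT => nX; apply: f0.
rewrite -fv (idemC reg_S comm_S jf iv); apply: block_cover vX _ => e Xe.
have : f * (pe e * (pe e)^*) = 0.
  by apply: contrapT => fe; apply: nX; exists (pe e * (pe e)^*) => //; exists e.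
rewrite (idemC reg_S comm_S jf (idem_range reg_S _)) => h.
by rewrite -(regular_star reg_S) -!smulA [X in _ * X]smulA h smuls0.
Qed.

Lemma act_pe_dom x e : fval x ((pe e)^* * pe e) <-> vtx x = rng e.
Proof. by rewrite pe_iso; exact: vtxE. Qed.

Lemma vtx_act_pe x e : vtx x = rng e -> vtx (act (pe e) x) = src e.
Proof. by move=> /act_pe_dom xe; apply: pe_range_vtx; exact: (act_range reg_S comm_S). Qed.

End Points.

Local Open Scope ring_scope.

(** * Topology of the spectrum and of the germs *)

Lemma ptws_bool_eval (U : Type) (e : U) : continuous (fun h : {ptws U -> bool} => h e).
Proof. exact: (@proj_continuous {classic U} (fun _ => bool) e). Qed.

Lemma cvg_ptws_bool (U : Type) (T : topologicalType) (t : T)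
    (h : T -> {ptws U -> bool}) :
  (forall e, \forall u \near t, h u e = h t e) -> h u @[u --> t] --> h t.
Proof.
move=> he; apply/cvg_sup => e V [_ [[W oW <-] /= Wt] WV].
by apply: filterS (he e) => u hu; apply: WV; rewrite /= hu.
Qed.

Section SpectrumTopology.
Variable S : star_semigroup.
Implicit Types x : tight_spectrum S.

Lemma near_fval x e : \forall y \near x, fval y e = fval x e.
Proof.
have c : continuous (fun y : tight_spectrum S => fval y e).
  move=> y; apply: (@continuous_comp _ _ _ (@fval S)
    (fun h : {ptws S -> bool} => h e)); first exact: initial_continuous.
  exact: ptws_bool_eval.
exact: (c x [set fval x e] (discrete_set1 _)).
Qed.

Lemma cvg_tight_spectrum (T : topologicalType) (t : T) (h : T -> tight_spectrum S) :
  (forall e, \forall u \near t, fval (h u) e = fval (h t) e) ->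
  h u @[u --> t] --> h t.
Proof.
move=> he U [? /= [[W oW <-] /= Wht WU]].
have /(_ W (open_nbhs_nbhs (conj oW Wht))) := cvg_ptws_bool he.
move=> H; exact: (@filterS T (nbhs t) _ _ _ (fun u Wu => WU (h u) Wu) H).
Qed.

Lemma open_germ_from (V : set (germ S)) : open V <->
  exists2 D, D `<=` finI_from [set B | exists s (U : set (tight_spectrum S)),
    [/\ open U, U `<=` D_ (s^* * s)%S & B = theta s U]] id &
    \bigcup_(B in D) B = V.
Proof. by []. Qed.

Lemma theta_open s (U : set (tight_spectrum S)) : open U -> U `<=` D_ (s^* * s)%S ->
  open (theta s U).
Proof.
move=> oU Us; apply/open_germ_from; exists [set theta s U].
  by move=> _ ->; apply: (@finI_from1 _ _ _ id); exists s, U.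
by apply/seteqP; split => [g [_ ->]|g tg] //; exists (theta s U).
Qed.

Lemma cvg_germ (T : topologicalType) (t : T) (h : T -> germ S) :
  (forall s (U : set (tight_spectrum S)), open U -> U `<=` D_ (s^* * s)%S ->
    theta s U (h t) -> \forall u \near t, theta s U (h u)) ->
  h u @[u --> t] --> h t.
Proof.
move=> hU V hV; suff : \forall u \near t, V (h u) by [].
have := hV; rewrite nbhsE => -[W [/open_germ_from [D DI <-] [B DB Bt]] WV].
have [Z ZD ZB] := DI _ DB.
have : \forall u \near t, B (h u).
  rewrite -ZB; apply: (@filter_bigI _ _ Z (fun i => h @^-1` i)) => i iZ.
  have := ZD _ iZ; rewrite inE => -[s [U [oU Us iE]]].
  rewrite iE; apply: hU => //; rewrite -iE.
  by move: Bt; rewrite -ZB; apply.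
by apply: filterS => u Bu; apply: WV; exists B.
Qed.

End SpectrumTopology.

(** * Computing with germs independently of representatives *)

Section Germs.
Variable S : star_semigroup.
Hypothesis regular : forall s : S, (s * s^* * s = s)%S.
Hypothesis range_comm :
  forall s t : S, (s * s^* * (t * t^*) = t * t^* * (s * s^*))%S.
Variable g0 : germ S.
Implicit Types (s t u : S) (x y : tight_spectrum S).

(** The germ [s,x]; [g0] is the default value when x is outside the domain of s. *)
Definition mkgerm s x : germ S := insubd g0 (germ_class (s, x)).

Lemma val_mkgerm s x : fval x (s^* * s)%S -> val (mkgerm s x) = germ_class (s, x).
Proof. by move=> xs; rewrite insubdK //; apply: mem_set; exists (s, x). Qed.

Lemma mkgerm_eq s t x : fval x (s^* * s)%S -> fval x (t^* * t)%S ->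
  (exists f, fval x f /\ (s * f = t * f)%S) -> mkgerm s x = mkgerm t x.
Proof.
move=> xs xt [f [xf sf]]; apply: val_inj; rewrite !val_mkgerm //.
have sub s' t' : fval x (t'^* * t')%S -> (s' * f = t' * f)%S ->
    germ_class (s', x) `<=` germ_class (t', x).
  move=> xt' sf' [u y] [ud /= yx [h [ih xh sh]]]; subst y; split=> //=.
  exists (f * h)%S; split; [|exact: filterM|].
    by apply: (idemM regular range_comm) => //; exact: filter_idem xf.
  have := idemC regular range_comm (filter_idem xf) ih => fh.
  by rewrite smulA -sf' -smulA fh smulA sh -smulA.
by apply/seteqP; split; apply: sub.
Qed.

Lemma mkgermP (g : germ S) : exists s x,
  [/\ fval x (s^* * s)%S, germ_repr g = (s, x) & g = mkgerm s x].
Proof.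
case E : (germ_repr g) => [s x]; exists s, x.
have [] := projT2 (cid (germ_repr_subproof g)).
rewrite -/(germ_repr g) E => xs gE; split => //.
by apply: val_inj; rewrite val_mkgerm.
Qed.

Lemma germ_repr_mkgerm s x : fval x (s^* * s)%S -> exists t,
  [/\ germ_repr (mkgerm s x) = (t, x), fval x (t^* * t)%S
    & exists f, fval x f /\ (s * f = t * f)%S].
Proof.
move=> xs; have [t [y [yt E gE]]] := mkgermP (mkgerm s x).
have : germ_class (t, y) (t, y).
  split => //=; have [f yf] := filter_inhab y.
  by exists f; split=> //; exact: filter_idem yf.
rewrite -val_mkgerm // -gE val_mkgerm // => -[/= _ yx [f [_ xf sf]]].
by subst y; exists t; split=> //; exists f.
Qed.

Lemma germ_src_mkgerm s x : fval x (s^* * s)%S -> germ_src (mkgerm s x) = x.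
Proof. by move=> /germ_repr_mkgerm[t [E _ _]]; rewrite /germ_src E. Qed.

Lemma act_germ s t x : fval x (s^* * s)%S -> fval x (t^* * t)%S ->
  (exists f, fval x f /\ (s * f = t * f)%S) -> act s x = act t x.
Proof.
move=> xs xt [f [xf sf]]; have jf := filter_idem xf.
have fs := idem_star regular range_comm jf.
have act_le s' t' h : fval x (s'^* * s')%S -> fval x (t'^* * t')%S ->
    (s' * f = t' * f)%S -> fval (act s' x) h -> fval (act t' x) h.
  move=> xs' xt' sf' /(fval_actP regular range_comm _ xs')[ih xh].
  apply/(fval_actP regular range_comm _ xt'); split=> //.
  have : fval x (f * (s'^* * h * s') * f)%S by apply: filterM => //; exact: filterM.
  have -> : (f * (s'^* * h * s') * f = f * (t'^* * h * t') * f)%S.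
    have sf2 := congr1 (@star S) sf'; rewrite !starM fs in sf2.
    by rewrite !smulA sf2 -!smulA sf'.
  have it := idem_conj regular range_comm t' ih.
  move=> /(filterMl regular range_comm (idemM regular range_comm jf it) jf).
  exact: (filterMr regular range_comm).
by apply: fval_inj => h; apply/idP/idP; apply: act_le.
Qed.

Lemma germ_rng_mkgerm s x : fval x (s^* * s)%S -> germ_rng (mkgerm s x) = act s x.
Proof.
move=> xs; have [t [E xt sf]] := germ_repr_mkgerm xs.
by rewrite /germ_rng E /=; apply/esym/act_germ.
Qed.

Lemma germ_mul_mkgerm u s x : fval x (s^* * s)%S ->
  fval (act s x) (u^* * u)%S ->
  germ_mul (mkgerm u (act s x)) (mkgerm s x) = mkgerm (u * s)%S x.
Proof.
move=> xs xu; have [t [E xt [f [xf sf]]]] := germ_repr_mkgerm xs.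
have [v [E' xv [h [xh uh]]]] := germ_repr_mkgerm xu.
have actst : act s x = act t x by apply: act_germ => //; exists f.
have xtv := fval_mul_source regular range_comm xt.
have xus := fval_mul_source regular range_comm xs xu.
rewrite /germ_mul germ_src_mkgerm // E E' /=.
have -> : insubd (mkgerm s x) (germ_class ((v * t)%S, x)) = mkgerm (v * t)%S x.
  apply: val_inj; rewrite val_mkgerm; last by apply: xtv; rewrite -actst.
  rewrite insubdK //; apply: mem_set; exists ((v * t)%S, x) => //.
  by apply: xtv; rewrite -actst.
apply: mkgerm_eq => //; first by apply: xtv; rewrite -actst.
have jf := filter_idem xf.
have [jh xsh] := (fval_actP regular range_comm h xs).1 xh.
have ish := idem_conj regular range_comm s jh.
have fC := idemC regular range_comm jf ish.
(* Below f the two representatives of the right factor agree; s^* h s pulls back the idempotent h on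
   which those of the left factor agree. *)
exists (f * (s^* * h * s))%S; split; first exact: filterM.
have sh : (s * (s^* * h * s) = h * s)%S.
  rewrite !smulA (idemC regular range_comm (idem_range regular s) jh).
  by rewrite -smulA smulA -smulA regular.
have sk : (s * (f * (s^* * h * s)) = h * (s * f))%S by rewrite fC smulA sh -smulA.
have tk : (t * (f * (s^* * h * s)) = h * (s * f))%S by rewrite smulA -sf -smulA sk.
by rewrite -(smulA u) -(smulA v) sk tk !smulA uh.
Qed.

End Germs.

(** * From formal means to amenability *)

Section FiniteMeasure.
Context d (T : measurableType d) (R : realType).
Implicit Types l : seq (R * T).

(** A finite sum of point masses. The absolute values make every list define a measure; on the
    nonnegative lists used later they change nothing. *)
Fixpoint fmeas l : {measure set T -> \bar R} :=
  if l is p :: l' then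
    [the {measure set T -> \bar R} of
      measure_add (mscale (NngNum (normr_ge0 p.1)) (dirac p.2)) (fmeas l')]
  else mzero.

Lemma fmeasE l A : fmeas l A = (\sum_(p <- l) `|p.1| * (p.2 \in A)%:R)%:E.
Proof.
elim: l => [|p l IH]; first by rewrite big_nil.
rewrite big_cons EFinD -IH; exact: measure_addE.
Qed.

Lemma integral_mscale_dirac (c : {nonneg R}) a (h : T -> R) : measurable_fun setT h ->
  (\int[mscale c (\d_ a)]_x (h x)%:E = (c%:num * h a)%:E)%E.
Proof.
move=> mh; have mEh : measurable_fun setT (EFin \o h : T -> \bar R) by exact/measurable_EFinP.
rewrite integralE !ge0_integral_mscale//; last 2 first.
  exact: measurable_funeneg.
  exact: measurable_funepos.
rewrite !integral_dirac//; last 2 first.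
  exact: measurable_funeneg.
  exact: measurable_funepos.
rewrite !diracT !mul1e funeposE funenegE /=  -!EFin_max -!EFinM -EFinB.
by congr EFin; rewrite -mulrBr; congr (_ * _); case: leP => ?; case: leP => ?; lra.
Qed.

Lemma fmeas_integral l (f : T -> R) : measurable_fun setT f ->
  (fmeas l).-integrable setT (EFin \o f) /\
  (\int[fmeas l]_x (f x)%:E = (\sum_(p <- l) `|p.1| * f p.2)%:E)%E.
Proof.
move=> mf; have mEf : measurable_fun setT (EFin \o f : T -> \bar R) by exact/measurable_EFinP.
elim: l => [|p l [IHi IHE]].
  split; last by rewrite integral_measure_zero big_nil.
  by apply/integrableP; split=> //; rewrite integral_measure_zero.
have mnf : measurable_fun setT (fun x => `|f x|) by exact: measurableT_comp.
pose c := NngNum (normr_ge0 p.1).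
have i1 : (mscale c (\d_ (p.2))).-integrable setT (EFin \o f).
  apply/integrableP; split=> //.
  by under eq_integral do rewrite abse_EFin; rewrite integral_mscale_dirac// ltry.
split; last first.
  rewrite big_cons EFinD -IHE -(integral_mscale_dirac c)//.
  exact: integral_measure_add.
apply/integrableP; split=> //.
have -> : (\int[fmeas (p :: l)]_x `|(EFin \o f) x| =
  \int[mscale c (\d_ (p.2))]_x `|(EFin \o f) x| +
  \int[fmeas l]_x `|(EFin \o f) x|)%E.
  by apply: ge0_integral_measure_add => //; exact: measurableT_comp.
by apply: lte_add_pinfty; [case/integrableP: i1|case/integrableP: IHi].
Qed.

Lemma fmeas_Rintegral l (f : T -> R) : measurable_fun setT f ->
  (\int[fmeas l]_x f x)%R = \sum_(p <- l) `|p.1| * f p.2.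
Proof. by move=> mf; rewrite /Rintegral (fmeas_integral l mf).2. Qed.

End FiniteMeasure.

Section FiniteProbability.
Context d (T : measurableType d) (R : realType).
Variable l : seq (R * T).
Hypothesis l1 : \sum_(p <- l) `|p.1| = 1.

Definition fprob : set T -> \bar R := fmeas l.
HB.instance Definition _ := Measure.on fprob.

Lemma fprobT : fprob setT = 1%E.
Proof.
rewrite /fprob fmeasE -[X in _ = X%:E]l1; congr EFin; apply: eq_bigr => p _.
by rewrite in_setT mulr1.
Qed.

HB.instance Definition _ := Measure_isProbability.Build _ _ _ fprob fprobT.

Definition fprobability : probability T R := fprob.

End FiniteProbability.

(** * Formal means on the semigroup *)

Fixpoint lall (T : Type) (P : T -> Prop) (l : seq T) : Prop :=
  if l is a :: l' then P a /\ lall P l' else True.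

Lemma lall_cat T (P : T -> Prop) l1 l2 : lall P (l1 ++ l2) <-> lall P l1 /\ lall P l2.
Proof. by elim: l1 => [|a l1 IH] /=; tauto. Qed.

Lemma lall_map T U (f : T -> U) (P : U -> Prop) l :
  lall P (map f l) <-> lall (fun a => P (f a)) l.
Proof. by elim: l => [|a l IH] /=; tauto. Qed.

Lemma lall_impl T (P Q : T -> Prop) l : (forall a, P a -> Q a) -> lall P l -> lall Q l.
Proof. by move=> PQ; elim: l => //= a l IH [/PQ ? /IH]. Qed.

Lemma eq_sum_lall (R : pzRingType) T (P : T -> Prop) (l : seq T) (f g : T -> R) :
  lall P l -> (forall a, P a -> f a = g a) -> \sum_(a <- l) f a = \sum_(a <- l) g a.
Proof.
move=> + fg; elim: l => [|a l IH] /=; first by rewrite !big_nil.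
by move=> [/fg fga /IH lE]; rewrite !big_cons fga lE.
Qed.

(* A list of pairs (a, s) stands, for every x, for the measure that gives mass *)
(* a to the arrow [s, s^* x]; [carried x] is what makes it live on r^-1(x).    *)
Section FormalMeans.
Variables (R : realType) (S : star_semigroup).
Implicit Types (l : seq (R * S)) (phi : S -> R) (x : tight_spectrum S) (s u : S).

Definition ev l phi := \sum_(p <- l) p.1 * phi p.2.
Definition lmul u l := [seq (p.1, (u * p.2)%S) | p <- l].
Definition lscale (c : R) l := [seq (c * p.1, p.2) | p <- l].
Definition prob l := lall (fun p => 0 <= p.1) l /\ \sum_(p <- l) p.1 = 1.
Definition carried x l := lall (fun p => p.1 != 0 -> fval x (p.2 * p.2^*)%S) l.
(** The l^1 distance in dual form, measured on the semigroup itself before elements are identified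
    as germs. *)
Definition close (eps : R) l l' :=
  forall phi, (forall s, `|phi s| <= 1) -> `|ev l phi - ev l' phi| <= eps.

Lemma ev_cat l1 l2 phi : ev (l1 ++ l2) phi = ev l1 phi + ev l2 phi.
Proof. by rewrite /ev big_cat. Qed.
Lemma ev_lmul u l phi : ev (lmul u l) phi = ev l (fun s => phi (u * s)%S).
Proof. by rewrite /ev big_map. Qed.
Lemma ev_lscale c l phi : ev (lscale c l) phi = c * ev l phi.
Proof. by rewrite /ev big_map big_distrr; apply: eq_bigr => p _ /=; rewrite mulrA. Qed.

Lemma prob_ev_le l phi : prob l -> (forall s, `|phi s| <= 1) -> `|ev l phi| <= 1.
Proof.
move=> [l0 l1] phi1; apply: le_trans (ler_norm_sum _ _ _) _.
rewrite -[leRHS]l1; elim: l l0 {l1} => [|p l IH] /=; first by rewrite !big_nil.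
move=> [p0 /IH lle]; rewrite !big_cons lerD // normrM (ger0_norm p0).
by rewrite ler_piMr.
Qed.

Lemma prob_lmul u l : prob l -> prob (lmul u l).
Proof. by move=> [l0 l1]; split; [exact/lall_map|rewrite big_map]. Qed.

Lemma prob_mix c l l' : 0 <= c <= 1 -> prob l -> prob l' ->
  prob (lscale (1 - c) l ++ lscale c l').
Proof.
move=> /andP[c0 c1] [l0 l1] [l0' l1']; split.
  apply/lall_cat; split; apply/lall_map.
    by apply: lall_impl l0 => p p0; rewrite mulr_ge0 // subr_ge0.
  by apply: lall_impl l0' => p p0; rewrite mulr_ge0.
by rewrite big_cat !big_map -!big_distrr /= l1 l1' !mulr1 subrK.
Qed.

Lemma close_refl eps l : 0 <= eps -> close eps l l.
Proof. by move=> e0 phi _; rewrite subrr normr0. Qed.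

Lemma close_le e1 e2 l l' : e1 <= e2 -> close e1 l l' -> close e2 l l'.
Proof. by move=> e12 h phi phi1; exact: le_trans (h phi phi1) e12. Qed.

Lemma close_trans e1 e2 l l' l'' : close e1 l l' -> close e2 l' l'' ->
  close (e1 + e2) l l''.
Proof.
move=> h1 h2 phi phi1; apply: le_trans (lerD (h1 phi phi1) (h2 phi phi1)).
exact: ler_distD.
Qed.

Lemma close_lmul u e l l' : close e l l' -> close e (lmul u l) (lmul u l').
Proof. by move=> h phi phi1; rewrite !ev_lmul; exact: h. Qed.

End FormalMeans.

Lemma cvg_weighted_sum (R : realType) (U : Type) (T : topologicalType) (t : T)
    (h : U -> T -> R) (l : seq (R * U)) :
  lall (fun p => p.1 != 0 -> h p.2 y @[y --> t] --> h p.2 t) l ->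
  \sum_(p <- l) p.1 * h p.2 y @[y --> t] --> \sum_(p <- l) p.1 * h p.2 t.
Proof.
elim: l => [_|p l IH /= [ph /IH lh]].
  rewrite (_ : (fun y => _) = fun=> 0); first by rewrite big_nil; exact: cvg_cst.
  by apply/funext => y; rewrite big_nil.
rewrite (_ : (fun y => _) = fun y => p.1 * h p.2 y + \sum_(q <- l) q.1 * h q.2 y).
  rewrite big_cons; apply: cvgD => //.
  have [p0|/ph {}ph] := eqVneq p.1 0; last exact: cvgMl_tmp.
  rewrite p0 (_ : (fun y => _) = fun=> 0); first by rewrite mul0r; exact: cvg_cst.
  by apply/funext => y; rewrite mul0r.
by apply/funext => y; rewrite big_cons.
Qed.

(** * Approximately invariant formal means give amenability *)

Section MeansAmenable.
Variables (R : realType) (S : star_semigroup).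
Hypothesis regular : forall s : S, (s * s^* * s = s)%S.
Hypothesis range_comm :
  forall s t : S, (s * s^* * (t * t^*) = t * t^* * (s * s^*))%S.
Implicit Types (s t u : S) (x y : tight_spectrum S).

Lemma D_open e : open (D_ e : set (tight_spectrum S)).
Proof.
rewrite openE => x xe; apply: filterS (near_fval x e) => y /= ye.
by rewrite /D_ /= ye.
Qed.

Lemma near_D e x : fval x e -> \forall y \near x, fval y e.
Proof. by move=> xe; apply: filterS (near_fval x e) => y /= ->. Qed.

Lemma act_cvg s x : fval x (s^* * s)%S -> act s y @[y --> x] --> act s x.
Proof.
move=> xs; apply: cvg_tight_spectrum => e.
apply: filterS2 (near_D xs) (near_fval x (s^* * e * s)%S) => y ys ye.
by rewrite !(fval_act regular range_comm) // ye.
Qed.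

(* [s, s^* x], an arrow with range x; meaningful only if x contains s s^*. *)
Definition arrow (g0 : germ S) s x := mkgerm g0 s (act s^*%S x).

Section Arrow.
Variable g0 : germ S.
Variables (s : S) (x : tight_spectrum S).
Hypothesis xs : fval x (s * s^*)%S.

Let xs' : fval x ((s^*)^* * s^*)%S. Proof. by rewrite starK. Qed.

Lemma arrow_dom : fval (act s^*%S x) (s^* * s)%S.
Proof. by have := act_range regular range_comm xs'; rewrite starK. Qed.

Lemma arrow_act : act s (act s^*%S x) = x.
Proof. by have := actK regular range_comm xs'; rewrite starK. Qed.

Lemma ran_arrow : germ_rng (arrow g0 s x) = x.
Proof. by rewrite /arrow germ_rng_mkgerm ?arrow_act //; exact: arrow_dom. Qed.

(** That [s, s^* y] lies in Theta(u,U) holds as soon as s^* y is in U and contains an idempotent f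
    with s f = u f, and these conditions are open in y. *)
Lemma arrow_cvg : arrow g0 s y @[y --> x] --> arrow g0 s x.
Proof.
apply: cvg_germ => u U oU Us [z Uz].
have sd := arrow_dom; rewrite val_mkgerm // => E.
have : germ_class (u, z) (u, z).
  split => //=; first exact: Us.
  by have [f zf] := filter_inhab z; exists f; split=> //; exact: filter_idem zf.
rewrite -E => -[_ /= zx [f [jf xf sf]]]; rewrite {}zx in Uz.
have c := act_cvg xs'.
have n1 : \forall y \near x, U (act s^*%S y).
  by apply: c; exact: open_nbhs_nbhs.
have n2 : \forall y \near x, fval (act s^*%S y) f.
  by apply: (c [set y | fval y f]); exact: near_D.
apply: filterS3 n1 n2 (near_D xs) => y Uy yf ys.
have ys' : fval y ((s^*)^* * s^*)%S by rewrite starK.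
have yd : fval (act s^*%S y) (s^* * s)%S.
  by have := act_range regular range_comm ys'; rewrite starK.
exists (act s^*%S y) => //; rewrite -(@val_mkgerm _ g0 u); last exact: Us.
congr val; apply: mkgerm_eq => //; first exact: Us.
by exists f.
Qed.

End Arrow.

Lemma arrow_mul g0 u s x : fval x (u^* * u)%S -> fval x (s * s^*)%S ->
  germ_mul (mkgerm g0 u x) (arrow g0 s x) = arrow g0 (u * s)%S (act u x).
Proof.
move=> xu xs; have := arrow_act xs; have := arrow_dom xs.
rewrite /arrow; set y := act s^*%S x => ys yx.
rewrite -{1}yx germ_mul_mkgerm // ?yx //.
congr mkgerm; rewrite starM (actM regular range_comm); last first.
  rewrite starM !starK; apply/(fval_actP regular range_comm _ xu); split.
    by rewrite -(starM u); exact: (idem_range regular).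
  rewrite !smulA -(smulA _ u^*%S u) -(smulA _ s).
  by apply: filterM => //; exact: filterM.
by rewrite (actK regular range_comm).
Qed.

Section Amenable.
Variable F : nat -> tight_spectrum S -> seq (R * S).
Hypothesis F_prob : forall n x, prob (F n x).
Hypothesis F_carried : forall n x, carried x (F n x).
Hypothesis F_loc : forall n x,
  exists2 e, fval x e & forall y, fval y e -> F n y = F n x.
Hypothesis F_inv : forall u (eps : R), 0 < eps -> exists n0, forall n, (n0 <= n)%N ->
  forall x, fval x (u^* * u)%S -> close eps (lmul u (F n x)) (F n (act u x)).

Section Measures.
Variable g0 : germ S.

Definition germs n x : seq (R * borel g0) :=
  [seq (p.1, arrow g0 p.2 x : borel g0) | p <- F n x].

Lemma germs_norm1 n x : \sum_(p <- germs n x) `|p.1| = 1.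
Proof.
have [F0 F1] := F_prob n x; rewrite big_map -F1.
by apply: eq_sum_lall F0 _ => p /ger0_norm.
Qed.

Definition means n x : probability (borel g0) R := fprobability (germs_norm1 n x).

Lemma meansE n x A : means n x A =
  (\sum_(p <- F n x) p.1 * ((arrow g0 p.2 x : borel g0) \in A)%:R)%:E.
Proof.
rewrite [LHS]fmeasE big_map; congr EFin.
have [F0 _] := F_prob n x.
by apply: eq_sum_lall F0 _ => p /ger0_norm ->.
Qed.

Lemma continuous_borel_measurable (f : germ S -> R) : continuous f ->
  measurable_fun setT (f : borel g0 -> R).
Proof.
move=> /continuousP cf; apply: (measurability _ (RGenOpens.measurableE R)).
move=> _ [_ [a [b ->] <-]]; rewrite setTI; apply: sub_sigma_algebra.
exact/cf/interval_open.
Qed.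

(** Near x the list is constant, so an integral is a fixed finite combination of values
    f([s, s^* y]), each continuous in y when its weight is nonzero. *)
Lemma means_continuous n : @continuous_probability_system R (tight_groupoid S) g0 (means n).
Proof.
split=> [x|f [cf _]].
  rewrite meansE; congr EFin; have [_ F1] := F_prob n x; rewrite -[RHS]F1.
  apply: eq_sum_lall (F_carried n x) _ => p px /=.
  have [->|/px xp] := eqVneq p.1 0; first by rewrite mul0r.
  by rewrite mem_set ?mulr1 //; exact: ran_arrow.
move=> x; have [e xe Fe] := F_loc n x.
have mE y : Rintegral (means n y) [set: borel g0] f =
    \sum_(p <- F n y) p.1 * f (arrow g0 p.2 y).
  rewrite [LHS](fmeas_Rintegral _ (continuous_borel_measurable cf)) big_map.
  have [F0 _] := F_prob n y.
  by apply: eq_sum_lall F0 _ => p /ger0_norm ->.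
have nE : \forall y \near x, \sum_(p <- F n x) p.1 * f (arrow g0 p.2 y) =
    Rintegral (means n y) [set: borel g0] f.
  by apply: filterS (near_D xe) => y ye; rewrite mE Fe.
apply: cvg_trans (near_eq_cvg nE) _; rewrite mE.
apply: (@cvg_weighted_sum _ _ (tight_spectrum S) x (fun s y => f (arrow g0 s y))).
apply: lall_impl (F_carried n x) => p px /px xp.
apply: (@continuous_comp _ _ _ (arrow g0 p.2) f x); last exact: cf.
exact: arrow_cvg.
Qed.

Lemma translate_means n u x A : fval x (u^* * u)%S ->
  @translate R (tight_groupoid S) (mkgerm g0 u x) (means n x) A =
  (ev (lmul u (F n x)) (fun s => ((arrow g0 s (act u x) : borel g0) \in A)%:R))%:E.
Proof.
move=> xu; rewrite /translate meansE ev_lmul; congr EFin.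
apply: eq_sum_lall (F_carried n x) _ => p px.
have [->|/px xp] := eqVneq p.1 0; first by rewrite !mul0r.
congr (_ * _%:R); congr nat_of_bool; apply/idP/idP => [|Aa]; rewrite !inE.
  by move=> [_]; rewrite /= arrow_mul.
split; first by rewrite /= ran_arrow // germ_src_mkgerm.
by rewrite /= arrow_mul //; exact: set_mem.
Qed.

Lemma means_tv n u x (eps : R) : fval x (u^* * u)%S ->
  close eps (lmul u (F n x)) (F n (act u x)) ->
  (tv_norm (@translate R (tight_groupoid S) (mkgerm g0 u x) (means n x) :
      set (borel g0) -> \bar R) (means n (act u x)) <= eps%:E)%E.
Proof.
move=> xu ce; apply: ge_ereal_sup => _ [k [B [mB tB ->]]].
pose a i : R := ev (lmul u (F n x)) (fun s => ((arrow g0 s (act u x) : borel g0) \in B i)%:R).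
pose b i : R := ev (F n (act u x)) (fun s => ((arrow g0 s (act u x) : borel g0) \in B i)%:R).
(* The signs turn the sum of absolute values into one evaluation; since the sets B i are disjoint,
   this test function is bounded by 1. *)
pose phi s : R := \sum_(i < k) Num.sg (a i - b i) *
  ((arrow g0 s (act u x) : borel g0) \in B i)%:R.
have evphi l : ev l phi = \sum_(i < k) Num.sg (a i - b i) *
    ev l (fun s => ((arrow g0 s (act u x) : borel g0) \in B i)%:R).
  rewrite /ev; under eq_bigr do rewrite big_distrr /=; rewrite exchange_big /=.
  apply: eq_bigr => i _; rewrite big_distrr /=.
  by apply: eq_bigr => p _; rewrite mulrCA.
have phi1 s : `|phi s| <= 1.
  have [[j Bj]|nB] := pselect (exists j : 'I_k, B j (arrow g0 s (act u x))); last first.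
    rewrite /phi big1 ?normr0 ?ler01 // => i _.
    by rewrite memNset ?mulr0 // => Bi; apply: nB; exists i.
  rewrite /phi (bigD1 j) //= big1 ?addr0 => [|i ij].
    by rewrite mem_set // mulr1 normr_sg lern1; case: (_ != _).
  rewrite memNset ?mulr0 // => Bi; move/eqP: ij; apply; apply: val_inj.
  by apply: (tB i j) => //; exists (arrow g0 s (act u x)).
have -> : (\sum_(i < k) `|translate (G := tight_groupoid S) (mkgerm g0 u x)
      (means n x) (B i) - means n (act u x) (B i)|)%E
    = (ev (lmul u (F n x)) phi - ev (F n (act u x)) phi)%:E.
  rewrite !evphi -sumrB -sumEFin; apply: eq_bigr => i _.
  rewrite translate_means // meansE -EFinB abse_EFin -mulrBr.
  by rewrite -/(a i) -[X in `|_ - X|]/(b i) -/(b i) normrEsg.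
rewrite lee_fin; exact: le_trans (ler_norm _) (ce phi phi1).
Qed.

End Measures.

Theorem amenable_of_means : amenable R (tight_groupoid S).
Proof.
move=> g0; exists nat, (fun i j => (i <= j)%N), (means g0); split.
- split; [exact: (inhabits 0%N)|exact: leqnn| |].
    by move=> i j k ij jk; exact: leq_trans ij jk.
  by move=> i j; exists (maxn i j); rewrite leq_maxl leq_maxr.
- exact: means_continuous.
move=> K /compact_near_coveringP Kc eps eps0.
have := Kc nat \oo (fun n g => (tv_norm (translate g (means g0 n (dom g)) :
  set (borel g0) -> \bar R) (means g0 n (ran g)) < eps%:E)%E) _.
case; last first.
  move=> n0 _ h; exists n0 => n n0n g Kg; exact: h.
move=> g Kg; have [u [x [xu _ gE]]] := mkgermP g0 g.
(* Half of eps, because closeness is a weak inequality and the goal is strict. *)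
have e20 : 0 < eps / 2 by rewrite divr_gt0.
have [n0 inv] := F_inv u e20.
(* On this open neighbourhood of g all germs have the form [u,y], so one n0 serves them all;
   compactness of K does the rest. *)
exists (theta u (D_ (u^* * u)%S), [set n | (n0 <= n)%N]).
  split; last by exists n0.
  apply: open_nbhs_nbhs; split; first by apply: theta_open => //; exact: D_open.
  by exists x => //; rewrite gE val_mkgerm.
move=> [g' n] [[y yu g'E] n0n].
have {}g'E : g' = mkgerm g0 u y by apply: val_inj; rewrite g'E val_mkgerm.
subst g'; rewrite [dom _](germ_src_mkgerm g0 yu).
rewrite [ran _](germ_rng_mkgerm regular range_comm g0 yu).
apply: (le_lt_trans (y := (eps / 2)%:E)); first exact: means_tv (inv n n0n y yu).
by rewrite lte_fin ltr_pdivrMr // ltr_pMr // ltr1n.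
Qed.

End Amenable.
End MeansAmenable.

(** * Means on a single component *)

Section Averages.
Variables (R : realType) (S : star_semigroup).
Implicit Types (l : seq (R * S)) (phi : S -> R) (x : tight_spectrum S) (s u a b : S).
Implicit Types (L : nat -> seq (R * S)).

Definition avg N L : seq (R * S) :=
  lscale N%:R^-1 (flatten [seq L m | m <- iota 0 N]).

Lemma ev_avg N L phi : ev (avg N L) phi = N%:R^-1 * \sum_(m < N) ev (L m) phi.
Proof.
rewrite ev_lscale; congr (_ * _).
rewrite -(big_mkord predT (fun m => ev (L m) phi)) /index_iota subn0.
elim: (iota 0 N) => [|m ms IH] /=; first by rewrite /ev !big_nil.
by rewrite ev_cat IH big_cons.
Qed.

Lemma lall_avg N L (P : R * S -> Prop) :
  (forall p, P p -> P (N%:R^-1 * p.1, p.2)) ->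
  (forall m, (m < N)%N -> lall P (L m)) -> lall P (avg N L).
Proof.
move=> PZ h; apply/lall_map; have : forall m, m \in iota 0 N -> lall P (L m).
  by move=> m; rewrite mem_iota => /h.
elim: (iota 0 N) => [|m ms IH] //= hms; apply/lall_cat; split.
  by apply: lall_impl (hms m _); [move=> p; exact: PZ|rewrite in_cons eqxx].
by apply: IH => k kms; apply: hms; rewrite in_cons kms orbT.
Qed.

Lemma prob_sumE l : prob l <-> lall (fun p => 0 <= p.1) l /\ ev l (fun=> 1) = 1.
Proof.
have -> : ev l (fun=> 1) = \sum_(p <- l) p.1 by apply: eq_bigr => p _; rewrite mulr1.
by [].
Qed.

Lemma prob_avg N L : (0 < N)%N -> (forall m, prob (L m)) -> prob (avg N L).
Proof.
move=> N0 LP; apply/prob_sumE; split.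
  apply: lall_avg => // [p p0|m _]; first by rewrite mulr_ge0 // invr_ge0.
  by have [] := LP m.
rewrite ev_avg (eq_bigr (fun=> 1)) => [|m _]; last by have /prob_sumE[] := LP m.
by rewrite sumr_const card_ord mulVf // pnatr_eq0 -lt0n.
Qed.

Lemma carried_avg N L x : (forall m, (m < N)%N -> carried x (L m)) -> carried x (avg N L).
Proof.
by apply: lall_avg => p /= h; rewrite mulf_eq0 negb_or => /andP[_].
Qed.

Lemma lmulM a b l : lmul a (lmul b l) = lmul (a * b)%S l.
Proof. by rewrite /lmul -map_comp; apply: eq_map => p /=; rewrite smulA. Qed.

Lemma lmul_avg u N L : lmul u (avg N L) = avg N (fun m => lmul u (L m)).
Proof.
rewrite /avg /lmul /lscale -map_comp map_flatten -map_comp [in RHS]map_flatten -map_comp.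
by congr flatten; apply: eq_map => m /=; rewrite -!map_comp; apply: eq_map.
Qed.

Lemma close_avg N L L' eps : (0 < N)%N ->
  (forall m, (m < N)%N -> close eps (L m) (L' m)) -> close eps (avg N L) (avg N L').
Proof.
move=> N0 h phi phi1; rewrite !ev_avg -mulrBr -sumrB normrM ger0_norm ?invr_ge0 //.
have N0' : 0 < N%:R :> R by rewrite ltr0n.
rewrite ler_pdivrMl //; apply: le_trans (ler_norm_sum _ _ _) _.
rewrite (_ : N%:R * eps = \sum_(m < N) eps); last first.
  by rewrite sumr_const card_ord mulr_natl.
by apply: ler_sum => m _; exact: h.
Qed.

(** The difference telescopes to two boundary terms of mass 1, each with weight 1/N. *)
Lemma close_avg_shift N L : (0 < N)%N -> (forall m, prob (L m)) ->
  close (2 / N%:R) (avg N (fun m => L m.+1)) (avg N L).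
Proof.
move=> N0 LP phi phi1; rewrite !ev_avg -mulrBr normrM ger0_norm ?invr_ge0 //.
rewrite mulrC ler_pM2r ?invr_gt0 ?ltr0n //.
have -> : \sum_(m < N) ev (L m.+1) phi - \sum_(m < N) ev (L m) phi =
    ev (L N) phi - ev (L 0%N) phi.
  rewrite -sumrB -(big_mkord predT (fun m => ev (L m.+1) phi - ev (L m) phi)).
  by rewrite telescope_sumr.
apply: le_trans (ler_normB _ _) _.
by rewrite -[2]/(1 + 1) lerD //; exact: prob_ev_le.
Qed.

Definition avg_pow N a l := avg N (fun m => iter m (lmul a) l).

Lemma prob_iter a l m : prob l -> prob (iter m (lmul a) l).
Proof. by move=> lp; elim: m => //= m; exact: prob_lmul. Qed.

Lemma prob_avg_pow N a l : (0 < N)%N -> prob l -> prob (avg_pow N a l).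
Proof. by move=> N0 lp; apply: prob_avg => // m; exact: prob_iter. Qed.

Lemma avg_pow_inv N a l : (0 < N)%N -> prob l ->
  close (2 / N%:R) (lmul a (avg_pow N a l)) (avg_pow N a l).
Proof.
move=> N0 lp; rewrite lmul_avg.
by apply: (close_avg_shift (L := fun m => iter m (lmul a) l)) => // m; exact: prob_iter.
Qed.

Lemma avg_pow_comm N a b l eps : (0 < N)%N ->
  (forall s, (b * (a * s) = a * (b * s))%S) ->
  close eps (lmul b l) l -> close eps (lmul b (avg_pow N a l)) (avg_pow N a l).
Proof.
move=> N0 ab bl; rewrite lmul_avg; apply: close_avg => // m _.
suff -> : lmul b (iter m (lmul a) l) = iter m (lmul a) (lmul b l).
  by elim: m => //= m; exact: close_lmul.
elim: m => //= m <-; rewrite /lmul -!map_comp.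
by apply: eq_map => p /=; rewrite ab.
Qed.

Lemma carried_lmul u l x : fval x (u * u^*)%S ->
  (forall s : S, (s * s^* * s = s)%S) ->
  (forall s t : S, (s * s^* * (t * t^*) = t * t^* * (s * s^*))%S) ->
  carried (act u^*%S x) l -> carried x (lmul u l).
Proof.
move=> xu rS cS lc; apply/lall_map; apply: lall_impl lc => p h /= /h xp.
by apply/(range_mulP rS cS).
Qed.

End Averages.

(** * Boxes in the commuting elements t_i *)

Section Boxes.
Variables (R : realType) (E : sepgraph) (A : adaptable E).
Local Notation S := (SEC A).
Local Notation pv := (pv A).
Local Notation pe := (pe A).
Local Notation pt := (pt A).
Variable N : nat.
Hypothesis N0 : (0 < N)%N.

(** The uniform mean on the monomials in the first M of the t_i at v with exponents less than N: a
    Følner box. *)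
Fixpoint box v M : seq (R * S) :=
  if M is j.+1 then avg_pow N (pt true j v) (box v j) else [:: (1, pv v)].

Lemma prob_box v M : prob (box v M).
Proof.
elim: M => [|j IH] /=; last exact: prob_avg_pow.
by split; rewrite ?big_seq1 //=; split => //; rewrite ler01.
Qed.

Lemma box_inv v M i : (i < M)%N -> close (2 / N%:R) (lmul (pt true i v) (box v M)) (box v M).
Proof.
elim: M => [//|j IH]; rewrite ltnS leq_eqVlt => /orP[/eqP ->|ij] /=.
  by apply: avg_pow_inv => //; exact: prob_box.
by apply: avg_pow_comm => //; [move=> s; rewrite !smulA ptC|exact: IH].
Qed.

Lemma box_range v M : lall (fun p => (p.2 * p.2^* = pv v)%S) (box v M).
Proof.
elim: M => [|j IH].
  by split=> //; rewrite [(_, _).2]/= pv_star pvv.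
apply: lall_avg => // m _; elim: m => // m IHm.
apply/lall_map; apply: lall_impl IHm => p h; rewrite [(_, _).2]/=.
by rewrite starM !smulA -(smulA _ p.2) h pt_pv pt_star ptV.
Qed.

Lemma carried_box M (x : tight_spectrum S) : carried x (box (vtx x) M).
Proof. by apply: lall_impl (box_range _ _) => p -> _; exact: vtxP. Qed.

End Boxes.

(** * Interpolation between the mean of a component and the means below it *)

Section Extension.
Variables (R : realType) (E : sepgraph) (A : adaptable E).
Local Notation S := (SEC A).
Local Notation pv := (pv A).
Local Notation pe := (pe A).
Local Notation pt := (pt A).
Local Notation reg_S := (@sec_regular E A).
Local Notation comm_S := (@range_comm E A).
Implicit Types (x y : tight_spectrum S) (c d s : S) (e : edge E) (v w : vertex E).
Implicit Types (F G : tight_spectrum S -> seq (R * S)).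

Definition locally_constant_at T (F : tight_spectrum S -> T) x :=
  exists2 f, fval x f & forall y, fval y f -> F y = F x.

(** The induction invariant. Only M of the t_i are controlled, since each step up the poset consumes
    some of them. *)
Definition good (J : component E -> Prop) M (eps : R) F : Prop :=
  [/\ forall x, J (component_at x) -> prob (F x) /\ carried x (F x),
      forall x, J (component_at x) -> locally_constant_at F x,
      forall x i, J (component_at x) -> (i < M)%N ->
        close eps (lmul (pt true i (vtx x)) (F x)) (F x)
    & forall x e, J (comp_of (src e)) -> vtx x = rng e ->
        close eps (lmul (pe e) (F x)) (F (act (pe e) x))].

(** The common setting for regular and free p: [exit n c] says that c is a path of length n leaving
    p, [F] is the mean below, [B] the mean inside p. In [exit_step] the second alternative is that
    of a loop which turns into a t behind the exit path. *)
Variables (p : component E) (J : component E -> Prop) (M M' N : nat) (eps : R).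
Variables (F B : tight_spectrum S -> seq (R * S)) (exit : nat -> S -> Prop).
Hypothesis N0 : (0 < N)%N.
Hypothesis eps0 : 0 <= eps.
Hypothesis goodF : good J M' eps F.

Definition deep m x := forall n c, exit n c -> (n <= m)%N -> ~ fval x (c * c^*)%S.

Hypothesis exit_out : forall n c, exit n c -> exists v w,
  [/\ vset p v, (pv v * c = c)%S, (c^* * c = pv w)%S, J (comp_of w)
    & forall i, (i < M)%N -> exists2 j, (j < M')%N &
        (pt true i v * c = c * pt true j w)%S].
Hypothesis exit_inj : forall x n c m d, exit n c -> exit m d ->
  fval x (c * c^*)%S -> fval x (d * d^*)%S -> n = m /\ c = d.
Hypothesis B_prob : forall x, component_at x = p -> prob (B x).
Hypothesis B_carried : forall x, component_at x = p -> deep N x -> carried x (B x).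
Hypothesis B_deep : forall x m, component_at x = p -> (N <= m)%N -> deep m x ->
  exists2 f, fval x f & forall y, fval y f -> deep m y /\ B y = B x.
Hypothesis B_pt : forall x i, component_at x = p -> deep N x -> (i < M)%N ->
  close (2 / N%:R) (lmul (pt true i (vtx x)) (B x)) (B x).
Hypothesis B_pe : forall x e, vtx x = rng e -> vset p (src e) -> vset p (rng e) ->
  close (2 / N%:R) (lmul (pe e) (B x)) (B (act (pe e) x)).
Hypothesis exit_pe : forall e, vset p (src e) -> ~ vset p (rng e) -> exit 1 (pe e).
Hypothesis exit_back : forall x e n c, vtx x = rng e ->
  vset p (src e) -> vset p (rng e) -> exit n c ->
  fval (act (pe e) x) (c * c^*)%S -> exists m d, exit m d /\ fval x (d * d^*)%S.
Hypothesis exit_step : forall x e n c, vtx x = rng e ->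
  vset p (src e) -> vset p (rng e) -> exit n c -> fval x (c * c^*)%S ->
  exit n.+1 (pe e * c)%S \/ exists j w,
    [/\ (j < M')%N, (c^* * c = pv w)%S & (pe e * c = c * pt true j w)%S].

(* Interpolates between lower means (paths of length <= N) and B (>= 2N). *)
Definition weight n : R := (minn (n - N) N)%:R / N%:R.

Let NR0 : 0 < N%:R :> R. Proof. by rewrite ltr0n. Qed.

Lemma weight01 n : 0 <= weight n <= 1.
Proof.
rewrite /weight divr_ge0 //= ler_pdivrMr // mul1r ler_nat.
exact: geq_minr.
Qed.

Lemma weight0 n : (n <= N)%N -> weight n = 0.
Proof. by move=> nN; rewrite /weight (eqP nN) min0n mul0r. Qed.

Lemma weight1 n : (N.*2 <= n)%N -> weight n = 1.
Proof.
move=> nN; rewrite /weight (minn_idPr _) ?divff ?gt_eqF //.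
by rewrite leq_subRL ?addnn // (leq_trans _ nN) // -addnn leq_addr.
Qed.

Lemma weight_step n : `|weight n.+1 - weight n| <= N%:R^-1.
Proof.
rewrite /weight -mulrBl normrM [in X in _ * X]ger0_norm ?invr_ge0 ?ler0n //.
rewrite -[leRHS]mul1r ler_pM2r ?invr_gt0 //.
have [->|->] : minn (n.+1 - N) N = minn (n - N) N \/
  minn (n.+1 - N) N = (minn (n - N) N).+1 by lia.
  by rewrite subrr normr0.
by rewrite -natr1 addrAC subrr add0r normr1.
Qed.

Definition exit_at x (nc : nat * S) := exit nc.1 nc.2 /\ fval x (nc.2 * nc.2^*)%S.

(** Three cases instead of a single combination: for n at most N, [B x] need not be carried by x,
    and from 2N on the value must be exactly [B x], as for points that never leave. Points exiting
    late accumulate at the latter, so local constancy depends on this. *)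
Definition extend_exit_mean x (nc : nat * S) : seq (R * S) :=
  let l := lmul nc.2 (F (act nc.2^*%S x)) in
  if (nc.1 <= N)%N then l
  else if (N.*2 <= nc.1)%N then B x
  else lscale (1 - weight nc.1) l ++ lscale (weight nc.1) (B x).

Lemma mixE x n c : extend_exit_mean x (n, c) =
  if (n <= N)%N then lmul c (F (act c^*%S x))
  else if (N.*2 <= n)%N then B x
  else lscale (1 - weight n) (lmul c (F (act c^*%S x))) ++ lscale (weight n) (B x).
Proof. by []. Qed.

Definition extend x : seq (R * S) :=
  if pselect (exists nc, exit_at x nc) is left h
  then extend_exit_mean x (projT1 (cid h)) else B x.

Lemma extend_exit x n c : exit n c -> fval x (c * c^*)%S -> extend x = extend_exit_mean x (n, c).
Proof.
move=> nc xc; rewrite /extend; case: pselect => [h|]; last by case; exists (n, c).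
case: (cid h) => -[m d] /= [md xd].
by have /= [<- <-] := exit_inj nc md xc xd.
Qed.

Lemma extend_none x : (forall n c, exit n c -> ~ fval x (c * c^*)%S) -> extend x = B x.
Proof.
move=> h; rewrite /extend; case: pselect => // hx; exfalso.
by have [[n c] [/h]] := hx.
Qed.

Lemma extend_ev x n c phi : exit n c -> fval x (c * c^*)%S ->
  ev (extend x) phi = (1 - weight n) * ev (lmul c (F (act c^*%S x))) phi
    + weight n * ev (B x) phi.
Proof.
move=> nc xc; rewrite (extend_exit nc xc) !mixE.
case: leqP => [nN|_]; first by rewrite weight0 // subr0 mul1r mul0r addr0.
case: leqP => [nN|_]; first by rewrite weight1 // subrr mul1r mul0r add0r.
by rewrite ev_cat !ev_lscale.
Qed.

Lemma exit_J x n c : exit n c -> fval x (c * c^*)%S -> J (component_at (act c^*%S x)).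
Proof.
move=> /exit_out[v [w [_ _ cw Jw _]]] xc.
by rewrite /component_at (vtx_act_star cw xc).
Qed.

Lemma extend_prob x : component_at x = p -> prob (extend x).
Proof.
move=> xp; have [[[n c] [/= nc xc]]|h] := EM (exists nc, exit_at x nc); last first.
  rewrite extend_none; first exact: B_prob.
  by move=> n c nc xc; apply: h; exists (n, c).
have [Fp _ _ _] := goodF; rewrite (extend_exit nc xc) !mixE.
have lp := prob_lmul c (Fp _ (exit_J nc xc)).1.
case: leqP => _; first exact: lp.
case: leqP => _; first exact: B_prob.
by apply: (prob_mix (weight01 n) lp); exact: B_prob.
Qed.

Lemma exit_deep x n c m : exit n c -> fval x (c * c^*)%S -> (m < n)%N -> deep m x.
Proof.
move=> nc xc mn k d kd km xd; have [nk _] := exit_inj nc kd xc xd.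
by move: mn; rewrite ltnNge nk km.
Qed.

Lemma carried_lscale (a : R) l x : carried x l -> carried x (lscale a l).
Proof.
move=> lc; apply/lall_map; apply: lall_impl lc => q h /=.
by rewrite mulf_eq0 negb_or => /andP[_].
Qed.

Lemma extend_carried x : component_at x = p -> carried x (extend x).
Proof.
move=> xp; have [[[n c] [/= nc xc]]|h] := EM (exists nc, exit_at x nc); last first.
  have h' n c : exit n c -> ~ fval x (c * c^*)%S by move=> nc xc; apply: h; exists (n, c).
  by rewrite extend_none //; apply: B_carried => // n c /h'.
have [Fp _ _ _] := goodF; rewrite (extend_exit nc xc) !mixE.
have lc := carried_lmul xc reg_S comm_S (Fp _ (exit_J nc xc)).2.
case: leqP => nN; first exact: lc.
have Bc := B_carried xp (exit_deep nc xc nN).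
case: leqP => _; first exact: Bc.
by apply/lall_cat; split; exact: carried_lscale.
Qed.

Lemma extend_locally_constant x : component_at x = p -> locally_constant_at extend x.
Proof.
move=> xp; have NN2 : (N < N.*2)%N by lia.
have deepP : deep N.*2.-1 x -> locally_constant_at extend x.
  have N2 : (N <= N.*2.-1)%N by lia.
  have deep_ext y : deep N.*2.-1 y -> extend y = B y.
    move=> yd; have [[[n c] [/= nc yc]]|h] := EM (exists nc, exit_at y nc); last first.
      by rewrite extend_none // => n c nc yc; apply: h; exists (n, c).
    rewrite (extend_exit nc yc) mixE; have [nN|nN] := leqP n N.*2.-1.
      by case: (yd _ _ nc nN yc).
    have nN2 : (N.*2 <= n)%N by lia.
    by rewrite leqNgt (leq_trans NN2 nN2) /= nN2.
  move=> xd; have [f xf fP] := B_deep xp N2 xd.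
  by exists f => // y /fP[yd By]; rewrite !deep_ext.
have [[[n c] [/= nc xc]]|h] := EM (exists nc, exit_at x nc); last first.
  by apply: deepP => n c nc _ xc; apply: h; exists (n, c).
have [nN2|nN2] := leqP N.*2 n.
  by apply: deepP; apply: (exit_deep nc xc); lia.
have [_ /(_ _ (exit_J nc xc)) [f xf fP] _ _] := goodF.
(* The idempotent c f c^* in x forces the same exit path c and the same lower mean for all nearby
   points. *)
have [jf xcf] := (fval_act_starP reg_S comm_S _ xc).1 xf.
have pull y : fval y (c * f * c^*)%S -> fval y (c * c^*)%S /\
    F (act c^*%S y) = F (act c^*%S x).
  move=> yf; have yc : fval y (c * c^*)%S.
    by have := @filter_conj _ reg_S y c^*%S f; rewrite starK; apply.
  by split=> //; apply: fP; apply/(fval_act_starP reg_S comm_S).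
have [nN|nN] := leqP n N.
  exists (c * f * c^*)%S => // y /pull[yc Fy].
  by rewrite (extend_exit nc yc) (extend_exit nc xc) !mixE nN Fy.
have [g xg gP] := B_deep xp (leqnn N) (exit_deep nc xc nN).
exists (c * f * c^* * g)%S; first exact: filterM.
have [ia ig] := (filter_idem xcf, filter_idem xg).
move=> y yfg; have [yc Fy] := pull y (filterMl reg_S comm_S ia ig yfg).
have [_ By] := gP y (filterMr reg_S comm_S ia ig yfg).
by rewrite (extend_exit nc yc) (extend_exit nc xc) !mixE Fy By.
Qed.

Let N4 : 2 / N%:R + 2 / N%:R = 4 / N%:R :> R.
Proof. by rewrite -mulrDl -natrD. Qed.

Let N2ge0 : 0 <= 2 / N%:R :> R.
Proof. by rewrite divr_ge0. Qed.

Lemma convex_close (a a' b b' r d e : R) : 0 <= r <= 1 -> 0 <= d -> 0 <= e ->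
  `|a - a'| <= d -> `|b - b'| <= e ->
  `|((1 - r) * a + r * b) - ((1 - r) * a' + r * b')| <= d + e.
Proof.
move=> /andP[r0 r1] d0 e0 ad be.
have -> : ((1 - r) * a + r * b) - ((1 - r) * a' + r * b') =
  (1 - r) * (a - a') + r * (b - b') by ring.
apply: le_trans (ler_normD _ _) _; rewrite !normrM (ger0_norm r0) ger0_norm ?subr_ge0 //.
apply: lerD; [apply: le_trans ad|apply: le_trans be]; rewrite ler_piMl //.
by rewrite gerBl.
Qed.

Lemma convex_step (a b b' r r' d e : R) : `|r' - r| <= d -> 0 <= r' <= 1 ->
  `|a| <= 1 -> `|b| <= 1 -> `|b - b'| <= e ->
  `|((1 - r) * a + r * b) - ((1 - r') * a + r' * b')| <= d + d + e.
Proof.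
move=> rd /andP[r0 r1] a1 b1 be.
have -> : ((1 - r) * a + r * b) - ((1 - r') * a + r' * b') =
  (r' - r) * a - (r' - r) * b + r' * (b - b') by ring.
apply: le_trans (ler_normD _ _) _; apply: lerD.
  apply: le_trans (ler_normB _ _) _; rewrite !normrM.
  by apply: lerD; apply: le_trans rd; rewrite ler_piMr.
by rewrite normrM (ger0_norm r0); apply: le_trans be; rewrite ler_piMl.
Qed.

Lemma extend_pt x i : component_at x = p -> (i < M)%N ->
  close (eps + 4 / N%:R) (lmul (pt true i (vtx x)) (extend x)) (extend x).
Proof.
move=> xp iM; have [[[n c] [/= nc xc]]|h] := EM (exists nc, exit_at x nc); last first.
  have h' n c : exit n c -> ~ fval x (c * c^*)%S by move=> nc xc; apply: h; exists (n, c).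
  rewrite extend_none //; apply: close_le (B_pt xp _ iM); last by move=> n c /h'.
  by rewrite -N4 addrA lerDr addr_ge0.
move=> phi phi1; rewrite ev_lmul !(extend_ev _ nc xc).
have [v [w [vp vc cw Jw /(_ i iM)[j jM tc]]]] := exit_out nc.
have [_ _ /(_ (act c^*%S x) j (exit_J nc xc) jM) Ft _] := goodF.
rewrite (vtx_act_star cw xc) in Ft; have vx := vtx_range vc xc; rewrite vx.
have ac : `|ev (lmul c (F (act c^*%S x))) (fun s => phi (pt true i v * s)%S) -
    ev (lmul c (F (act c^*%S x))) phi| <= eps.
  have := Ft (fun s => phi (c * s)%S) (fun s => phi1 _).
  rewrite !ev_lmul; congr (`| _ - _ | <= _).
  by apply: eq_bigr => q _; rewrite !smulA tc.
have le4 : eps + 2 / N%:R <= eps + 4 / N%:R by rewrite -N4 addrA lerDl.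
have [nN|nN] := leqP n N.
  rewrite weight0 // subr0 !mul1r !mul0r !addr0; apply: le_trans ac _.
  by apply: le_trans le4; rewrite lerDl.
apply: le_trans le4; apply: convex_close => //; first exact: weight01.
have := B_pt xp (exit_deep nc xc nN) iM; rewrite vx.
by move=> /(_ phi phi1); rewrite ev_lmul.
Qed.

(** Prepending e either makes e c the exit path, so that the lower part is unchanged and the weight
    moves by at most 1/N, or keeps c with e c = c t_j, so that the weight is unchanged and F absorbs
    t_j. *)
Lemma extend_pe x e : vtx x = rng e -> vset p (src e) -> vset p (rng e) ->
  close (eps + 4 / N%:R) (lmul (pe e) (extend x)) (extend (act (pe e) x)).
Proof.
move=> xe sp rp; have xd : fval x ((pe e)^* * pe e)%S by apply/act_pe_dom.
have xp : component_at x = p by apply/vset_comp; rewrite xe.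
have zp : component_at (act (pe e) x) = p by apply/vset_comp; rewrite vtx_act_pe.
have Be := B_pe xe sp rp.
have [[[n c] [/= nc xc]]|h] := EM (exists nc, exit_at x nc); last first.
  have h' n c : exit n c -> ~ fval x (c * c^*)%S by move=> nc xc; apply: h; exists (n, c).
  rewrite !extend_none //; last first.
    by move=> n c nc zc; have [m [d [/h']]] := exit_back xe sp rp nc zc.
  apply: close_le Be; have := eps0; have := N2ge0; lra.
have le4 : eps + 2 / N%:R <= eps + 4 / N%:R by rewrite -N4 addrA lerDl.
have zec : fval (act (pe e) x) (pe e * c * (pe e * c)^*)%S.
  exact/(range_actP reg_S comm_S).
have actc : act (pe e * c)^*%S (act (pe e) x) = act c^*%S x.
  by rewrite (act_starM reg_S comm_S) // (actK reg_S comm_S).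
have [Fp _ Ft _] := goodF; have [lp _] := Fp _ (exit_J nc xc).
have lcp := prob_lmul (pe e * c)%S lp.
move=> phi phi1; rewrite ev_lmul (extend_ev _ nc xc).
have -> : ev (lmul c (F (act c^*%S x))) (fun s => phi (pe e * s)%S) =
    ev (lmul (pe e * c)%S (F (act c^*%S x))) phi.
  by rewrite !ev_lmul; apply: eq_bigr => q _; rewrite smulA.
have {}Be : `|ev (B x) (fun s => phi (pe e * s)%S) - ev (B (act (pe e) x)) phi| <= 2 / N%:R.
  by have := Be phi phi1; rewrite ev_lmul.
have [nec|[j [w [jM cw ec]]]] := exit_step xe sp rp nc xc.
  rewrite (extend_ev _ nec zec) actc.
  have a1 := prob_ev_le lcp phi1.
  have ws := weight_step n.
  have b2 := prob_ev_le (B_prob xp) (fun s => phi1 (pe e * s)%S).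
  apply: le_trans (convex_step ws (weight01 n.+1) a1 b2 Be) _.
  (* The weight change costs 1/N on the lower mean and 1/N on B, and the invariance of B costs
     2/N. *)
  rewrite (_ : 4 / N%:R = N%:R^-1 + N%:R^-1 + 2 / N%:R) ?lerDr //.
  by ring.
have cR : (c * pv w = c)%S by rewrite -cw smulA sec_regular.
(* As t_j is unitary over w, the elements e c and c have the same range, and c is still the exit
   path after e. *)
have ecR : (pe e * c * (pe e * c)^* = c * c^*)%S.
  by rewrite ec starM pt_star !smulA (smul_eqr (ptTF _ _ _)) cR.
have zc : fval (act (pe e) x) (c * c^*)%S by rewrite -ecR.
have actc' : act c^*%S (act (pe e) x) = act c^*%S x.
  rewrite -actc ec (act_starM reg_S comm_S) -?ec // pt_star act_pt //.
  exact/vtxE/vtx_act_star.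
rewrite (extend_ev _ nc zc) actc'.
have ac : `|ev (lmul (pe e * c)%S (F (act c^*%S x))) phi -
    ev (lmul c (F (act c^*%S x))) phi| <= eps.
  have := Ft (act c^*%S x) j (exit_J nc xc) jM.
  rewrite (vtx_act_star cw xc) => /(_ (fun s => phi (c * s)%S) (fun s => phi1 _)).
  rewrite !ev_lmul; congr (`| _ - _ | <= _).
  by apply: eq_bigr => q _; rewrite ec !smulA.
by apply: le_trans le4; apply: convex_close => //; exact: weight01.
Qed.

Lemma extend_exit_pe x e : vtx x = rng e -> vset p (src e) -> ~ vset p (rng e) ->
  extend (act (pe e) x) = lmul (pe e) (F x).
Proof.
move=> xe sp rp; have xd : fval x ((pe e)^* * pe e)%S by apply/act_pe_dom.
have ze := act_range reg_S comm_S xd.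
rewrite (extend_exit (exit_pe sp rp) ze) mixE N0.
by rewrite (actK reg_S comm_S).
Qed.

End Extension.

Definition extends (R : realType) (E : sepgraph) (A : adaptable E)
    (p : component E) M (eps : R) (F G : tight_spectrum (SEC A) -> seq (R * SEC A)) :=
  [/\ forall x, component_at x = p -> prob (G x) /\ carried x (G x),
      forall x, component_at x = p -> locally_constant_at G x,
      forall x i, component_at x = p -> (i < M)%N ->
        close eps (lmul (pt A true i (vtx x)) (G x)) (G x)
    & forall x e, vset p (src e) -> vtx x = rng e ->
        (vset p (rng e) -> close eps (lmul (pe A e) (G x)) (G (act (pe A e) x))) /\
        (~ vset p (rng e) -> close eps (lmul (pe A e) (F x)) (G (act (pe A e) x)))].

(** * Regular components: averaging over prefixes *)

Section RegularComponent.
Variables (R : realType) (E : sepgraph) (A : adaptable E).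
Local Notation S := (SEC A).
Local Notation pv := (pv A).
Local Notation pe := (pe A).
Local Notation pt := (pt A).
Local Notation reg_S := (@sec_regular E A).
Local Notation comm_S := (@range_comm E A).
Implicit Types (x y : tight_spectrum S) (c d s : S) (e : edge E) (v w : vertex E).

Variables (p : component E) (J : component E -> Prop) (M N : nat).
Hypothesis rp : reg A p.
Hypothesis J_below : forall q, clt q p -> J q.
Hypothesis N0 : (0 < N)%N.

Fixpoint rexit n w c : Prop :=
  if n is m.+1 then exists e, [/\ src e = w, vset p (src e) &
    [/\ m = 0%N, ~ vset p (rng e) & c = pe e] \/
    (vset p (rng e) /\ exists2 d, rexit m (rng e) d & c = (pe e * d)%S)]
  else False.

Definition reg_exit n c := exists w, rexit n w c.

Lemma reg_edge_out e : vset p (src e) -> ~ vset p (rng e) -> J (comp_of (rng e)).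
Proof.
move=> sp rp'; case: (reg_edge rp sp) => [/sub_edgeP[_ /rp']//|[q qp qe]].
by move/component_eqP: qe => ->; exact: J_below.
Qed.

Lemma rexit_out n w c : rexit n w c -> [/\ vset p w, (pv w * c = c)%S &
  exists u, [/\ (c^* * c = pv u)%S, J (comp_of u)
    & forall i, (pt true i w * c = c * pt true i u)%S]].
Proof.
elim: n w c => [//|n IH] w c [e [<- sp [[_ re ->]|[re [d /IH[_ rd [u [du Ju td]]] ->]]]]].
  split=> //; first by rewrite pe_src.
  exists (rng e); rewrite pe_iso; split=> //; first exact: reg_edge_out.
  by move=> i; exact: pt_reg rp sp.
split=> //; first by rewrite smulA pe_src.
exists u; split=> //; first by rewrite starM !smulA (smul_eqr (pe_iso A e)) -smulA rd.
by move=> i; rewrite smulA (pt_reg _ _ rp sp) -!smulA td.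
Qed.

Lemma reg_head x : component_at x = p ->
  exists2 e, fval x (pe e * (pe e)^*)%S & vset p (src e).
Proof.
move=> /vset_comp xp; have [X XE] := reg_sep rp xp.
have [|e Xe xe] := @block_head _ A x (vtx x) X (vtxP x); first by rewrite XE.
by exists e => //; rewrite -(pe_range_vtx xe).
Qed.

(** A regular vertex has only one block, and distinct edges of a block have orthogonal ranges. *)
Lemma reg_head_inj x e e' : component_at x = p -> fval x (pe e * (pe e)^*)%S ->
  fval x (pe e' * (pe e')^*)%S -> e = e'.
Proof.
move=> /vset_comp xp xe xe'; apply: contrapT => ne.
have [X XE] := reg_sep rp xp.
have inX f : fval x (pe f * (pe f)^*)%S -> X f.
  move=> /pe_range_vtx xf; have [Y + Yf] := sep_edge f.
  by rewrite -xf XE /= => <-.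
apply: (filter_range_orth xe xe').
by apply: (@pe_orth _ A (vtx x) X) => //; [rewrite XE|exact: inX|exact: inX].
Qed.

Lemma rexit_inj n m w w' c d x : rexit n w c -> rexit m w' d ->
  fval x (c * c^*)%S -> fval x (d * d^*)%S -> n = m /\ c = d.
Proof.
elim: n m w w' c d x => [//|n IH] [//|m] w w' c d x.
move=> [e [_ sp he]] [f [_ _ hf]] xc xd.
have head_edge g (k : nat) b : [/\ k = 0%N, ~ vset p (rng g) & b = pe g] \/
    (vset p (rng g) /\ exists2 b', rexit k (rng g) b' & b = (pe g * b')%S) ->
    fval x (b * b^*)%S -> fval x (pe g * (pe g)^*)%S.
  by move=> [[_ _ ->]//|[_ [b' _ ->]]] /(range_mulP reg_S comm_S)[].
have xe := head_edge _ _ _ he xc; have xf := head_edge _ _ _ hf xd.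
have xp : component_at x = p by apply/vset_comp; rewrite (pe_range_vtx xe).
have ef := reg_head_inj xp xe xf; subst f.
case: he hf => [[-> nr ->]|[re [c' hc' cE]]] [[-> nr' ->]|[re' [d' hd' dE]]] //.
rewrite cE in xc *; rewrite dE in xd *.
have [_ yc] := (range_mulP reg_S comm_S _ _ _).1 xc.
have [_ yd] := (range_mulP reg_S comm_S _ _ _).1 xd.
by have [-> ->] := IH _ _ _ _ _ _ hc' hd' yc yd.
Qed.

Definition head_edge x : S :=
  if pselect (exists e, fval x (pe e * (pe e)^*)%S) is left h
  then pe (projT1 (cid h)) else szero.

Lemma head_edgeE x e : component_at x = p -> fval x (pe e * (pe e)^*)%S -> head_edge x = pe e.
Proof.
move=> xp xe; rewrite /head_edge; case: pselect => [h|]; last by case; exists e.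
by case: (cid h) => f /= /(reg_head_inj xp xe) ->.
Qed.

(** The prefix of x of length k, followed by a box in the t_i at the vertex it reaches. *)
Fixpoint walk_mean k x : seq (R * S) :=
  if k is j.+1 then lmul (head_edge x) (walk_mean j (act (head_edge x)^*%S x))
  else box R A N (vtx x) M.

Definition reg_mean x := avg N (walk_mean^~ x).

Lemma prob_walk_mean k x : prob (walk_mean k x).
Proof.
elim: k x => [|k IH] x; first exact: prob_box.
by apply: prob_lmul; exact: IH.
Qed.

Lemma walk_pe k x e : vset p (src e) -> vtx x = rng e ->
  walk_mean k.+1 (act (pe e) x) = lmul (pe e) (walk_mean k x).
Proof.
move=> sp xe; have xd := (act_pe_dom x e).2 xe.
have zp : component_at (act (pe e) x) = p by apply/vset_comp; rewrite vtx_act_pe.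
have ze := act_range reg_S comm_S xd.
by rewrite [LHS]/walk_mean -/walk_mean (head_edgeE zp ze) (actK reg_S comm_S).
Qed.

Local Notation deep := (deep reg_exit).

Lemma deep_step m x : component_at x = p -> deep m.+1 x -> exists e,
  [/\ fval x (pe e * (pe e)^*)%S, vset p (src e), vset p (rng e)
    & deep m (act (pe e)^*%S x)].
Proof.
move=> xp xd; have [e xe sp] := reg_head xp.
have re : vset p (rng e).
  apply: contrapT => nr; apply: (xd 1 (pe e)) => //.
  by exists (src e); exists e; split=> //; left.
exists e; split=> // n c [w nc] nm yc.
have wE : w = rng e.
  have [_ wc _] := rexit_out nc.
  by rewrite -(vtx_range wc yc) (vtx_act_star (pe_iso A e) xe).
subst w; apply: (xd n.+1 (pe e * c)%S) => //.
  by exists (src e), e; split=> //; right; split=> //; exists c.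
exact/(range_mulP reg_S comm_S).
Qed.

Lemma walk_succ k x e : component_at x = p -> fval x (pe e * (pe e)^*)%S ->
  walk_mean k.+1 x = lmul (pe e) (walk_mean k (act (pe e)^*%S x)).
Proof. by move=> xp xe; rewrite [LHS]/walk_mean -/walk_mean (head_edgeE xp xe). Qed.

Lemma comp_act_star_pe x e : fval x (pe e * (pe e)^*)%S -> vset p (rng e) ->
  component_at (act (pe e)^*%S x) = p.
Proof. by move=> xe re; apply/vset_comp; rewrite (vtx_act_star (pe_iso A e) xe). Qed.

Lemma walk_carried m k x : component_at x = p -> deep m x -> (k <= m)%N ->
  carried x (walk_mean k x).
Proof.
elim: k m x => [|k IH] [|m] x xp xd //; try by move=> _; exact: carried_box.
rewrite ltnS => km; have [e [xe sp re yd]] := deep_step xp xd.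
rewrite (walk_succ _ xp xe); apply: carried_lmul => //; [exact: reg_S|exact: comm_S|].
exact: IH (comp_act_star_pe xe re) yd km.
Qed.

Lemma walk_pt m k x i : component_at x = p -> deep m x -> (k <= m)%N -> (i < M)%N ->
  close (2 / N%:R) (lmul (pt true i (vtx x)) (walk_mean k x)) (walk_mean k x).
Proof.
move=> + + + iM; elim: k m x => [|k IH] [|m] x xp xd //;
  try by move=> _; exact: box_inv.
rewrite ltnS => km; have [e [xe sp re yd]] := deep_step xp xd.
rewrite (walk_succ _ xp xe) (pe_range_vtx xe).
have := IH _ _ (comp_act_star_pe xe re) yd km.
rewrite (vtx_act_star (pe_iso A e) xe) => /(close_lmul (pe e)).
by rewrite !lmulM (pt_reg _ _ rp sp).
Qed.

(** The range of the prefix of length m, with its end vertex, is an idempotent in x that fixes the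
    first m edges of every point containing it. *)
Lemma deep_near m x : component_at x = p -> deep m x -> exists2 f, fval x f &
  forall y, fval y f -> deep m y /\ forall k, (k <= m)%N -> walk_mean k y = walk_mean k x.
Proof.
elim: m x => [|m IH] x xp xd.
  exists (pv (vtx x)); first exact: vtxP.
  move=> y /vtxE yx; split.
    move=> n c [w nc]; rewrite leqn0 => /eqP n0; rewrite n0 in nc.
    by case: nc.
  by move=> k; rewrite leqn0 => /eqP ->; rewrite /= yx.
have [e [xe sp re zd]] := deep_step xp xd.
have [f zf fP] := IH _ (comp_act_star_pe xe re) zd.
have [jf xf] := (fval_act_starP reg_S comm_S f xe).1 zf.
exists (pe e * f * (pe e)^*)%S => // y yf.
have ye : fval y (pe e * (pe e)^*)%S.
  by have := @filter_conj _ reg_S y (pe e)^*%S f; rewrite starK; apply.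
have yp : component_at y = p by apply/vset_comp; rewrite (pe_range_vtx ye).
have [ud uw] := fP (act (pe e)^*%S y) ((fval_act_starP reg_S comm_S f ye).2 (conj jf yf)).
split; last first.
  case=> [|k] km; first by rewrite /= (pe_range_vtx ye) (pe_range_vtx xe).
  by rewrite (walk_succ _ yp ye) (walk_succ _ xp xe) uw.
move=> [|n] c [w] // [g [_ _ gP]] nm yc.
have yg : fval y (pe g * (pe g)^*)%S.
  by case: gP yc => [[_ _ ->]//|[_ [b' _ ->]]] /(range_mulP reg_S comm_S)[].
have eg := reg_head_inj yp ye yg; subst g.
case: gP => [[_ /(_ re)]//|[_ [d nd cE]]].
move: yc; rewrite cE => /(range_mulP reg_S comm_S)[_ ud'].
by apply: (ud n d) ud' => //; exists (rng e).
Qed.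

Theorem reg_extension (eps : R) (F : tight_spectrum S -> seq (R * S)) :
  0 <= eps -> good J M eps F -> exists G, extends p M (eps + 4 / N%:R) F G.
Proof.
move=> eps0 goodF.
have h1 n c : reg_exit n c -> exists v w,
  [/\ vset p v, (pv v * c = c)%S, (c^* * c = pv w)%S, J (comp_of w)
    & forall i, (i < M)%N -> exists2 j, (j < M)%N &
        (pt true i v * c = c * pt true j w)%S].
  move=> [w /rexit_out[wp wc [u [cu Ju tu]]]]; exists w, u; split=> // i iM.
  by exists i.
have h2 x n c m d : reg_exit n c -> reg_exit m d ->
  fval x (c * c^*)%S -> fval x (d * d^*)%S -> n = m /\ c = d.
  by move=> [w nc] [w' md]; exact: rexit_inj nc md.
have h3 x : component_at x = p -> prob (reg_mean x).
  by move=> _; apply: prob_avg => // m; exact: prob_walk_mean.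
have h4 x : component_at x = p -> deep N x -> carried x (reg_mean x).
  by move=> xp xd; apply: carried_avg => m /ltnW mN; exact: walk_carried xp xd mN.
have h5 x m : component_at x = p -> (N <= m)%N -> deep m x ->
  exists2 f, fval x f & forall y, fval y f -> deep m y /\ reg_mean y = reg_mean x.
  move=> xp Nm xd; have [f xf fP] := deep_near xp xd.
  exists f => // y /fP[yd yw]; split=> //; rewrite /reg_mean /avg; congr (lscale _ (flatten _)).
  apply/eq_in_map => k; rewrite mem_iota add0n => /andP[_ kN].
  by apply: yw; rewrite (leq_trans _ Nm) // ltnW.
have h6 x i : component_at x = p -> deep N x -> (i < M)%N ->
  close (2 / N%:R) (lmul (pt true i (vtx x)) (reg_mean x)) (reg_mean x).
  move=> xp xd iM; rewrite lmul_avg; apply: close_avg => // m /ltnW mN.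
  exact: walk_pt xp xd mN iM.
have h7 x e : vtx x = rng e -> vset p (src e) -> vset p (rng e) ->
  close (2 / N%:R) (lmul (pe e) (reg_mean x)) (reg_mean (act (pe e) x)).
  move=> xe sp re; rewrite lmul_avg.
  (* Prepending e turns the prefix of length m of x into the prefix of length m + 1 of e x:
     invariance is that of an average under a shift. *)
  rewrite (_ : (fun m => lmul (pe e) (walk_mean m x)) = fun m => walk_mean m.+1 (act (pe e) x)).
    by apply: (close_avg_shift (L := walk_mean^~ (act (pe e) x))) => // m; exact: prob_walk_mean.
  by apply/funext => m; rewrite walk_pe.
have h8 e : vset p (src e) -> ~ vset p (rng e) -> reg_exit 1 (pe e).
  by move=> sp re; exists (src e), e; split=> //; left.
have h9 x e n c : vtx x = rng e -> vset p (src e) -> vset p (rng e) -> reg_exit n c ->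
  fval (act (pe e) x) (c * c^*)%S -> exists m d, reg_exit m d /\ fval x (d * d^*)%S.
  move=> xe sp re [w]; case: n => // n [g [_ _ gP]] zc.
  have xd := (act_pe_dom x e).2 xe; have ze := act_range reg_S comm_S xd.
  have zp : component_at (act (pe e) x) = p by apply/vset_comp; rewrite vtx_act_pe.
  have zg : fval (act (pe e) x) (pe g * (pe g)^*)%S.
    by case: gP zc => [[_ _ ->]//|[_ [b' _ ->]]] /(range_mulP reg_S comm_S)[].
  have eg := reg_head_inj zp ze zg; subst g.
  case: gP => [[_ /(_ re)]//|[_ [d nd cE]]]; exists n, d; split; first by exists (rng e).
  by move: zc; rewrite cE => /(range_mulP reg_S comm_S)[_]; rewrite (actK reg_S comm_S).
have h10 x e n c : vtx x = rng e -> vset p (src e) -> vset p (rng e) ->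
  reg_exit n c -> fval x (c * c^*)%S ->
  reg_exit n.+1 (pe e * c)%S \/ exists j w,
    [/\ (j < M)%N, (c^* * c = pv w)%S & (pe e * c = c * pt true j w)%S].
  move=> xe sp re [w nc] xc; left; exists (src e), e; split=> //; right; split=> //.
  exists c => //; have [_ wc _] := rexit_out nc.
  by rewrite -xe (vtx_range wc xc).
exists (extend N F reg_mean reg_exit); split.
- move=> x xp; split; first exact: (extend_prob N0 goodF h1 h2 h3).
  exact: (extend_carried goodF h1 h2 h4).
- by move=> x xp; exact: (extend_locally_constant N0 eps0 goodF h1 h2 h5).
- by move=> x i xp iM; exact: (extend_pt N0 eps0 goodF h1 h2 h6).
- move=> x e sp xe; split=> re; first exact: (extend_pe N0 eps0 goodF h1 h2 h3 h7 h9 h10).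
  rewrite (extend_exit_pe _ _ _ h2 h8) //; apply: close_refl.
  by rewrite addr_ge0 // divr_ge0.
Qed.

End RegularComponent.

(** * Free components: boxes in the commuting loops *)

Section FreeComponent.
Variables (R : realType) (E : sepgraph) (A : adaptable E).
Local Notation S := (SEC A).
Local Notation pv := (pv A).
Local Notation pe := (pe A).
Local Notation pt := (pt A).
Local Notation reg_S := (@sec_regular E A).
Local Notation comm_S := (@range_comm E A).
Implicit Types (x y : tight_spectrum S) (c d s : S) (e : edge E).

Variables (p : component E) (v : vertex E) (J : component E -> Prop) (M N : nat).
Hypothesis fp : free A p.
Hypothesis pE : vset p = [set v].
Hypothesis J_below : forall q, clt q p -> J q.
Hypothesis N0 : (0 < N)%N.
Local Notation K := (nX A p).
Implicit Types (i j : 'I_K).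

Let vp : vset p v. Proof. by rewrite pE. Qed.

Definition pe_alpha i : S := pe (alpha i).

Lemma pe_alpha_iso i : ((pe_alpha i)^* * pe_alpha i = pv v)%S.
Proof. by rewrite /pe_alpha pe_iso (rng_alpha i fp vp). Qed.
Lemma pv_pe_alpha i : (pv v * pe_alpha i = pe_alpha i)%S.
Proof. by rewrite /pe_alpha -[in LHS](src_alpha i fp vp) pe_src. Qed.

(** The exit path alpha_i^m beta(i,t). Loops of other blocks are absent, because (R8) moves them
    behind beta, where they become t's. *)
Fixpoint beta_path i (t : 'I_(nbeta i)) m : S :=
  if m is k.+1 then (pe_alpha i * beta_path t k)%S else pe (beta t).

Lemma fpathS i (t : 'I_(nbeta i)) m : beta_path t m.+1 = (pe_alpha i * beta_path t m)%S.
Proof. by []. Qed.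

Lemma pv_fpath i (t : 'I_(nbeta i)) m : (pv v * beta_path t m = beta_path t m)%S.
Proof.
case: m => [|m]; first by rewrite -[in LHS](src_beta t fp vp) pe_src.
by rewrite fpathS smulA pv_pe_alpha.
Qed.

Lemma fpath_iso i (t : 'I_(nbeta i)) m :
  ((beta_path t m)^* * beta_path t m = pv (rng (beta t)))%S.
Proof.
elim: m => [|m IH]; first exact: pe_iso.
by rewrite fpathS starM !smulA (smul_eqr (pe_alpha_iso i)) -smulA pv_fpath.
Qed.

Lemma pt_fpath b k i (t : 'I_(nbeta i)) m :
  (pt b k v * beta_path t m = beta_path t m * pt b (k + K - 1)%N (rng (beta t)))%S.
Proof.
elim: m => [|m IH]; first exact: pt_beta.
by rewrite fpathS smulA (pt_alpha _ _ _ fp vp) -!smulA IH.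
Qed.

Lemma al_fpath i j (t : 'I_(nbeta j)) m : i <> j ->
  (pe_alpha i * beta_path t m = beta_path t m * pt true (unbump j i) (rng (beta t)))%S.
Proof.
move=> ij; elim: m => [|m IH]; first exact: alpha_beta.
by rewrite fpathS smulA /pe_alpha (alphaC fp ij) -!smulA IH.
Qed.

Lemma al_star_fpath i j (t : 'I_(nbeta j)) m : i <> j ->
  ((pe_alpha i)^* * beta_path t m = beta_path t m * pt false (unbump j i) (rng (beta t)))%S.
Proof.
move=> ij; elim: m => [|m IH]; first exact: alpha_star_beta.
by rewrite fpathS smulA /pe_alpha (alpha_starC fp ij) -!smulA IH.
Qed.

Lemma beta_star_fpath i j (t : 'I_(nbeta i)) (u : 'I_(nbeta j)) m : i <> j ->
  ((pe (beta t))^* * beta_path u m = 0)%S.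
Proof.
move=> ij; elim: m => [|m IH].
  by apply: beta_orth => // tu; apply: ij; exact: (EqdepFacts.eq_sigT_fst tu).
rewrite fpathS smulA.
have -> : ((pe (beta t))^* * pe_alpha j =
    pt true (unbump i j) (rng (beta t)) * (pe (beta t))^*)%S.
  rewrite -[LHS]starK starM starK alpha_star_beta //; last exact: nesym.
  by rewrite starM pt_star.
by rewrite -smulA IH smuls0.
Qed.

Lemma fpath_orth i j (t : 'I_(nbeta i)) (u : 'I_(nbeta j)) m n : i <> j ->
  ((beta_path t m)^* * beta_path u n = 0)%S.
Proof.
move=> ij; elim: m => [|m IH]; first exact: beta_star_fpath.
by rewrite fpathS starM -smulA al_star_fpath // smulA IH smul0s.
Qed.

Lemma al_star_beta i (t : 'I_(nbeta i)) : ((pe_alpha i)^* * pe (beta t) = 0)%S.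
Proof. exact: alpha_beta_orth. Qed.

Lemma fpath_orth_lt i (t u : 'I_(nbeta i)) m n : (m < n)%N ->
  ((beta_path t m)^* * beta_path u n = 0)%S.
Proof.
elim: m n => [|m IH] [//|n] mn.
  rewrite fpathS smulA -[X in (X * _)%S]starK starM starK al_star_beta star0.
  by rewrite smul0s.
by rewrite !fpathS starM smulA (smul_eqr (pe_alpha_iso i)) -smulA pv_fpath IH.
Qed.

Lemma fpath_orth_eq i (t u : 'I_(nbeta i)) m : t <> u ->
  ((beta_path t m)^* * beta_path u m = 0)%S.
Proof.
move=> tu; elim: m => [|m IH].
  by apply: beta_orth => // /eqP; rewrite eq_Tagged => /eqP.
by rewrite !fpathS starM smulA (smul_eqr (pe_alpha_iso i)) -smulA pv_fpath.
Qed.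

Definition free_exit n c := exists i (t : 'I_(nbeta i)) m, n = m.+1 /\ c = beta_path t m.

(** Different exit paths have orthogonal ranges: for different blocks by (R4) and (R8), for
    different exponents by orthogonality of alpha_i and beta(i,t), for different t by (R4). *)
Lemma free_exit_inj x n c m d : free_exit n c -> free_exit m d ->
  fval x (c * c^*)%S -> fval x (d * d^*)%S -> n = m /\ c = d.
Proof.
move=> [i [t [a [-> ->]]]] [j [u [b [-> ->]]]] xc xd.
have [ij|ij] := EM (i = j); last first.
  by case: (filter_range_orth xc xd); exact: fpath_orth.
subst j; have [ab|ab|ab] := ltngtP a b.
- by case: (filter_range_orth xc xd); exact: fpath_orth_lt.
- by case: (filter_range_orth xd xc); exact: fpath_orth_lt.
subst b; have [<-//|tu] := EM (t = u).
by case: (filter_range_orth xc xd); exact: fpath_orth_eq.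
Qed.

Fixpoint apow i m : S := if m is k.+1 then (pe_alpha i * apow i k)%S else pv v.

Lemma apowS i m : apow i m.+1 = (pe_alpha i * apow i m)%S. Proof. by []. Qed.

Lemma pe_alpha_pv i : (pe_alpha i * pv v = pe_alpha i)%S.
Proof. by rewrite /pe_alpha -(rng_alpha i fp vp) pe_rng. Qed.

Lemma pv_apow i m : (pv v * apow i m = apow i m)%S.
Proof. by case: m => [|m]; rewrite ?apowS ?smulA ?pv_pe_alpha //; exact: pvv. Qed.

Lemma apow_iso i m : ((apow i m)^* * apow i m = pv v)%S.
Proof.
elim: m => [|m IH]; first by rewrite pv_star; exact: pvv.
by rewrite apowS starM !smulA (smul_eqr (pe_alpha_iso i)) -smulA pv_apow.
Qed.

Lemma apowD i m n : (apow i m * apow i n = apow i (m + n))%S.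
Proof.
elim: m => [|m IH]; first exact: pv_apow.
by rewrite addSn !apowS -smulA IH.
Qed.

Lemma apow_beta i (t : 'I_(nbeta i)) m : (apow i m * pe (beta t) = beta_path t m)%S.
Proof.
elim: m => [|m IH]; first exact: (pv_fpath t 0).
by rewrite apowS fpathS -smulA IH.
Qed.

Lemma apow_fpath_orth i (t : 'I_(nbeta i)) m n : (n < m)%N ->
  ((apow i m)^* * beta_path t n = 0)%S.
Proof.
elim: n m => [|n IH] [//|m] nm; rewrite apowS starM.
  by rewrite -smulA al_star_beta smuls0.
by rewrite fpathS smulA (smul_eqr (pe_alpha_iso i)) -smulA pv_fpath IH.
Qed.

Lemma pe_alpha_apow i j m : i <> j -> (pe_alpha i * apow j m = apow j m * pe_alpha i)%S.
Proof.
move=> ij; elim: m => [|m IH]; first by rewrite pv_pe_alpha pe_alpha_pv.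
by rewrite apowS smulA /pe_alpha (alphaC fp ij) -!smulA IH.
Qed.

Lemma pe_alpha_apow_star i j m : i <> j ->
  (pe_alpha i * (apow j m)^* = (apow j m)^* * pe_alpha i)%S.
Proof.
move=> ij; elim: m => [|m IH]; first by rewrite pv_star pv_pe_alpha pe_alpha_pv.
have ji : j <> i by exact: nesym.
by rewrite apowS starM smulA IH -smulA -(alpha_starC fp ji) smulA.
Qed.

Local Notation deep := (deep free_exit).

Lemma vtx_free x : component_at x = p -> vtx x = v.
Proof. by move=> /vset_comp; rewrite pE. Qed.

(** After alpha_i^m the point picks an edge of block i; a beta would complete an exit path of length
    m + 1, so it picks alpha_i again. *)
Lemma deep_apow m x i : vtx x = v -> deep m x -> fval x (apow i m * (apow i m)^*)%S.
Proof.
move=> xv; elim: m => [|m IH] xd.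
  by rewrite pv_star pvv; apply/vtxE.
have xm : fval x (apow i m * (apow i m)^*)%S.
  by apply: IH => n c nc nm; exact: (xd n c nc (leqW nm)).
have zv : fval (act (apow i m)^*%S x) (pv v) by apply/vtxE/(vtx_act_star (apow_iso i m)).
have [e] := block_head zv (block_sep i fp vp).
case=> [ei ze|[t _ <-] ze].
  have {}ei : e = alpha i := ei; rewrite ei in ze.
  have -> : apow i m.+1 = (apow i m * pe_alpha i)%S.
    by rewrite -addn1 -apowD apowS pe_alpha_pv.
  exact/(range_mulP reg_S comm_S).
case: (xd m.+1 (beta_path t m)) => //; first by exists i, t, m.
by rewrite -apow_beta; exact/(range_mulP reg_S comm_S).
Qed.

Lemma apow_deep m x : (forall i, fval x (apow i m * (apow i m)^*)%S) -> deep m x.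
Proof.
move=> xm n c [i [t [k [-> ->]]]] km xc.
by apply: (filter_range_orth (xm i) xc); exact: apow_fpath_orth.
Qed.

(** A Følner box in the loops listed in l, applied to the box in the t_i. It is the same for all
    points over v. *)
Definition free_mean (l : seq 'I_K) : seq (R * S) :=
  foldr (fun i l => avg_pow N (pe_alpha i) l) (box R A N v M) l.

Lemma prob_free_mean l : prob (free_mean l).
Proof. by elim: l => [|i l IH]; [exact: prob_box|exact: prob_avg_pow]. Qed.

Lemma free_mean_pt l k : (k < M)%N ->
  close (2 / N%:R) (lmul (pt true k v) (free_mean l)) (free_mean l).
Proof.
move=> kM; elim: l => [|i l IH]; first exact: box_inv.
by apply: avg_pow_comm => // s; rewrite !smulA (pt_alpha _ _ _ fp vp).
Qed.

Lemma free_mean_al l i : i \in l ->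
  close (2 / N%:R) (lmul (pe_alpha i) (free_mean l)) (free_mean l).
Proof.
elim: l => // j l IH il; have [->|ij] := EM (i = j).
  by apply: avg_pow_inv => //; exact: prob_free_mean.
apply: avg_pow_comm => //; first by move=> s; rewrite !smulA /pe_alpha (alphaC fp ij).
by apply: IH; move: il; rewrite in_cons => /orP[/eqP|].
Qed.

Lemma apow_act i j m x : i <> j -> fval x (pe_alpha i * (pe_alpha i)^*)%S ->
  fval x (apow j m * (apow j m)^*)%S ->
  fval (act (pe_alpha i)^*%S x) (apow j m * (apow j m)^*)%S.
Proof.
move=> ij xi xj; apply/(fval_act_starP reg_S comm_S _ xi); split.
  exact: (idem_range reg_S).
rewrite smulA pe_alpha_apow // -(smulA (apow j m)) pe_alpha_apow_star //.
rewrite smulA -(smulA _ (pe_alpha i)).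
exact: filterM.
Qed.

Lemma free_mean_carried l x : uniq l -> vtx x = v ->
  (forall i, i \in l -> fval x (apow i N * (apow i N)^*)%S) ->
  carried x (free_mean l).
Proof.
elim: l x => [|i l IH] x.
  move=> _ xv _; change (carried x (box R A N v M)).
  by rewrite -xv; exact: carried_box.
move=> /andP[il ul] xv xl; apply: carried_avg => m mN.
have xm : fval x (apow i m * (apow i m)^*)%S.
  have := xl i (mem_head _ _); rewrite -(subnKC (ltnW mN)) -apowD.
  by move=> /(range_mulP reg_S comm_S)[].
have {}xl j : j \in l -> fval x (apow j N * (apow j N)^*)%S.
  by move=> jl; apply: xl; rewrite in_cons jl orbT.
elim: m {mN} x xv xl xm => [|m IHm] x xv xl xm; first exact: IH.
have [xi ym] := (range_mulP reg_S comm_S _ _ _).1 xm.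
apply: carried_lmul => //; [exact: reg_S|exact: comm_S|].
apply: IHm => //; first exact: (vtx_act_star (pe_alpha_iso i) xi).
move=> j jl; apply: apow_act => //; last exact: xl.
by move=> ij; move: il; rewrite ij jl.
Qed.

Lemma free_internal e : vset p (src e) -> vset p (rng e) -> exists i, e = alpha i.
Proof.
move=> sp re; case: (free_edge fp sp) => [[i ->]|[i [t et]]]; first by exists i.
have [q [_ qp] qt] := beta_range fp t; rewrite -et in qt.
by case: qp; exact: vset_inj qt re.
Qed.

(** The bound M + K below serves two purposes: t_k passes a beta with its index raised by K - 1, and
    a loop of another block becomes a t of index less than K. *)
Theorem free_extension (eps : R) (F : tight_spectrum S -> seq (R * S)) :
  0 <= eps -> good J (M + K) eps F -> exists G, extends p M (eps + 4 / N%:R) F G.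
Proof.
move=> eps0 goodF; pose B x : seq (R * S) := free_mean (enum 'I_K).
have h1 n c : free_exit n c -> exists u w,
  [/\ vset p u, (pv u * c = c)%S, (c^* * c = pv w)%S, J (comp_of w)
    & forall k, (k < M)%N -> exists2 l, (l < M + K)%N &
        (pt true k u * c = c * pt true l w)%S].
  move=> [i [t [m [_ ->]]]]; exists v, (rng (beta t)); split.
  - exact: vp.
  - exact: pv_fpath.
  - exact: fpath_iso.
  - have [q qp /component_eqP ->] := beta_range fp t; exact: J_below.
  - move=> k kM; exists (k + K - 1)%N; last exact: pt_fpath.
    have := ltn_ord i; lia.
have h2 := free_exit_inj.
have h3 x : component_at x = p -> prob (B x) by move=> _; exact: prob_free_mean.
have h4 x : component_at x = p -> deep N x -> carried x (B x).
  move=> /vtx_free xv xd; apply: free_mean_carried => //; first exact: enum_uniq.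
  by move=> i _; exact: deep_apow.
have h5 x m : component_at x = p -> (N <= m)%N -> deep m x ->
  exists2 f, fval x f & forall y, fval y f -> deep m y /\ B y = B x.
  move=> /vtx_free xv _ xd; have [f xf fP] := filter_all reg_S comm_S
    (fun i => deep_apow i xv xd).
  by exists f => // y /fP ym; split=> //; exact: apow_deep.
have h6 x k : component_at x = p -> deep N x -> (k < M)%N ->
  close (2 / N%:R) (lmul (pt true k (vtx x)) (B x)) (B x).
  by move=> /vtx_free -> _; exact: free_mean_pt.
have h7 x e : vtx x = rng e -> vset p (src e) -> vset p (rng e) ->
  close (2 / N%:R) (lmul (pe e) (B x)) (B (act (pe e) x)).
  move=> _ sp re; have [i ->] := free_internal sp re.
  by apply: free_mean_al; rewrite mem_enum.
have h8 e : vset p (src e) -> ~ vset p (rng e) -> free_exit 1 (pe e).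
  move=> sp re; case: (free_edge fp sp) => [[i ei]|[i [t ->]]]; last by exists i, t, 0%N.
  by case: re; rewrite ei (rng_alpha i fp vp).
have al_range i j (t : 'I_(nbeta j)) m : i <> j ->
    (pe_alpha i * beta_path t m * (pe_alpha i * beta_path t m)^* =
     beta_path t m * (beta_path t m)^*)%S.
  move=> ij; rewrite al_fpath // starM pt_star !smulA (smul_eqr (ptTF _ _ _)).
  by rewrite -(fpath_iso t m) smulA sec_regular.
have h9 x e n c : vtx x = rng e -> vset p (src e) -> vset p (rng e) -> free_exit n c ->
  fval (act (pe e) x) (c * c^*)%S -> exists m d, free_exit m d /\ fval x (d * d^*)%S.
  move=> xe sp re; have xd := (act_pe_dom x e).2 xe; have ze := act_range reg_S comm_S xd.
  have [i ei] := free_internal sp re; subst e.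
  move=> [j [t [m [_ ->]]]] zc.
  have [ij|ij] := EM (i = j); last first.
    exists m.+1, (beta_path t m); split; first by exists j, t, m.
    by rewrite -(al_range i) // in zc; exact: (range_actP reg_S comm_S _ xd).1 zc.
  (* A point of the form alpha_i x cannot start with beta(i,t); otherwise one alpha_i is removed
     from its exit path. *)
  subst j; case: m zc => [|m] zc.
    by case: (filter_range_orth ze zc); exact: al_star_beta.
  exists m.+1, (beta_path t m); split; first by exists i, t, m.
  exact: (range_actP reg_S comm_S _ xd).1 zc.
have h10 x e n c : vtx x = rng e -> vset p (src e) -> vset p (rng e) ->
  free_exit n c -> fval x (c * c^*)%S ->
  free_exit n.+1 (pe e * c)%S \/ exists l w,
    [/\ (l < M + K)%N, (c^* * c = pv w)%S & (pe e * c = c * pt true l w)%S].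
  move=> xe sp re [j [t [m [-> ->]]]] _; have [i ei] := free_internal sp re; subst e.
  have [ij|ij] := EM (i = j); first by subst j; left; exists i, t, m.+1.
  right; exists (unbump j i), (rng (beta t)); split.
  - have := ltn_ord i; rewrite /unbump; lia.
  - exact: fpath_iso.
  - exact: al_fpath.
exists (extend N F B free_exit); split.
- move=> x xp; split; first exact: (extend_prob N0 goodF h1 h2 h3).
  exact: (extend_carried goodF h1 h2 h4).
- by move=> x xp; exact: (extend_locally_constant N0 eps0 goodF h1 h2 h5).
- by move=> x k xp kM; exact: (extend_pt N0 eps0 goodF h1 h2 h6).
- move=> x e sp xe; split=> re; first exact: (extend_pe N0 eps0 goodF h1 h2 h3 h7 h9 h10).
  rewrite (extend_exit_pe _ _ _ h2 h8) //; apply: close_refl.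
  by rewrite addr_ge0 // divr_ge0.
Qed.

End FreeComponent.

(** * Induction on the height of components *)

Section Components.
Variables (E : sepgraph) (A : adaptable E).
Implicit Types (p q r : component E) (e : edge E).

Lemma vset_vle p v w : vset p v -> vset p w -> vle v w.
Proof. by move=> /component_eqP <- []. Qed.

Lemma cle_trans p q r : cle p q -> cle q r -> cle p r.
Proof.
move=> [v [w [pv0 qw vw]]] [v' [w' [qv' rw' vw']]]; exists v, w'; split=> //.
exact: vle_trans vw (vle_trans (vset_vle qw qv') vw').
Qed.

Lemma cle_anti p q : cle p q -> cle q p -> p = q.
Proof.
move=> [v [w [pv0 qw vw]]] [w' [v' [qw' pv' wv']]].
have wv : vle w v := vle_trans (vset_vle qw qw') (vle_trans wv' (vset_vle pv' pv0)).
apply: (vset_inj _ qw); move/component_eqP: pv0 => <-.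
by split.
Qed.

Lemma clt_trans p q r : clt p q -> clt q r -> clt p r.
Proof.
move=> [pq npq] [qr nqr]; split; first exact: cle_trans pq qr.
by move=> pr; subst r; apply: npq; exact: cle_anti.
Qed.

(* The components of height less than n. *)
Fixpoint lower n p : Prop := if n is m.+1 then forall q, clt q p -> lower m q else False.

Lemma lowerS n p : lower n p -> lower n.+1 p.
Proof. by elim: n p => // n IH p h q /h /IH. Qed.

Lemma lower_edge n e : lower n (comp_of (src e)) -> lower n (comp_of (rng e)).
Proof.
case: n => // n h; have [->//|ne] := EM (comp_of (rng e) = comp_of (src e)).
apply/lowerS/h; split=> //; exists (rng e), (src e); split; [exact/component_eqP|exact/component_eqP|].
by exists [:: e].
Qed.

(** Passing to a strictly smaller component strictly shrinks the finite set of components below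
    it. *)
Lemma lower_all : exists n, forall p, lower n p.
Proof.
have fin (B : set (component E)) : finite_set B.
  exact: sub_finite_set (finite_components A).
pose below p : set (component E) := [set q | clt q p].
exists (#|` fset_set [set: component E]|)%fset.+1 => p.
suff h n : ((#|` fset_set (below p)|)%fset < n)%N -> lower n p.
  apply: h; rewrite ltnS; apply: fsubset_leq_card.
  by rewrite -fset_set_sub //; exact: fin.
elim: n p => // n IH p; rewrite ltnS => pn q qp; apply: IH.
apply: leq_trans pn; apply: fproper_ltn_card.
rewrite fproperEneq; apply/andP; split; last first.
  by rewrite -fset_set_sub // => r rq; exact: clt_trans rq qp.
apply/eqP => /(congr1 (fun X : {fset _} => [set` X])); rewrite !fset_setK //.
by move=> /seteqP[_ /(_ q qp)[_]]; apply.
Qed.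

Lemma nX_bounded : exists K, forall p, (nX A p <= K)%N.
Proof.
have /finite_seqP[s sE] := finite_components A.
exists (\max_(p <- s) nX A p) => p.
have ps : p \in s by have : [set: component E] p by []; rewrite sE.
exact: leq_bigmax_seq.
Qed.

End Components.

(** * Assembling the means over all components *)

Section Construction.
Variables (R : realType) (E : sepgraph) (A : adaptable E).
Local Notation S := (SEC A).
Local Notation reg_S := (@sec_regular E A).
Local Notation comm_S := (@range_comm E A).
Implicit Types (F G : tight_spectrum S -> seq (R * S)) (p : component E).

Lemma good_le J M M' (eps : R) F : (M <= M')%N -> good J M' eps F -> good J M eps F.
Proof.
move=> MM [h1 h2 h3 h4]; split=> // x i xJ iM; apply: h3 => //.
exact: leq_trans MM.
Qed.

Lemma extends_le p M (eps eps' : R) F G : eps <= eps' -> extends p M eps F G ->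
  extends p M eps' F G.
Proof.
move=> ee [h1 h2 h3 h4]; split=> //.
  by move=> x i xp iM; apply: close_le ee (h3 x i xp iM).
move=> x e sp xe; have [a b] := h4 x e sp xe.
by split=> re; apply: close_le ee _; [exact: a|exact: b].
Qed.

Lemma extension p J M K (eps : R) F : (nX A p <= K)%N -> (forall q, clt q p -> J q) ->
  0 < eps -> good J (M + K) (eps / 2) F -> exists G, extends p M eps F G.
Proof.
move=> pK Jp eps0 goodF; have e2 : 0 <= eps / 2 by rewrite divr_ge0 // ltW.
(* Chosen so that the loss 4/N of the extension step is at most eps/2. *)
pose N := Num.bound (8 / eps).
have e8 : 0 <= 8 / eps by rewrite divr_ge0 // ltW.
have NR : 8 / eps < N%:R := archi_boundP e8.
have NR0 : 0 < N%:R :> R by exact: le_lt_trans NR.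
have N0 : (0 < N)%N by rewrite -(ltr0n R).
have small : eps / 2 + 4 / N%:R <= eps.
  have : 4 / N%:R <= eps / 2.
    rewrite ler_pdivrMr //; move: NR; rewrite ltr_pdivrMr // => NR.
    by rewrite mulrAC ler_pdivlMr // mulrC (mulrC eps); move/ltW: NR; rewrite -natrM.
  lra.
suff [G] : exists G, extends p M (eps / 2 + 4 / N%:R) F G.
  by exists G; apply: extends_le small _.
case: (freeVreg A p) => [fp|rp].
  have [v pE] := free_vertex fp.
  apply: (free_extension fp pE Jp N0 e2); apply: good_le goodF.
  by rewrite leq_add2l.
by apply: (reg_extension rp Jp N0 e2); apply: good_le goodF; exact: leq_addr.
Qed.

(** Induction on the height with M and eps universally quantified, since each level asks the one
    below for M + K and eps / 2, K bounding the number of loops at all free vertices. *)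
Lemma good_exists n M (eps : R) : 0 < eps -> exists F, good (@lower E n) M eps F.
Proof.
elim: n M eps => [|n IH] M eps eps0; first by exists (fun=> [::]); split.
have [K KP] := nX_bounded A.
have e2 : 0 < eps / 2 by rewrite divr_gt0.
have [F goodF] := IH (M + K)%N _ e2; have [F1 F2 F3 F4] := good_le (leq_addr K M) goodF.
have /choice[G GP] : forall p, exists G, lower n.+1 p -> extends p M eps F G.
  move=> p; have [lp|nlp] := EM (lower n.+1 p); last by exists F.
  by have [G Gp] := extension (KP p) lp eps0 goodF; exists G.
pose F' x := if pselect (lower n (component_at x)) then F x else G (component_at x) x.
have F'F x : lower n (component_at x) -> F' x = F x by rewrite /F'; case: pselect.
have F'G x : ~ lower n (component_at x) -> F' x = G (component_at x) x by rewrite /F'; case: pselect.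
have le2 : eps / 2 <= eps by lra.
exists F'; split.
- move=> x xn; have [xl|xl] := EM (lower n (component_at x)); first by rewrite F'F //; exact: F1.
  by rewrite F'G //; have [h _ _ _] := GP _ xn; exact: h.
- move=> x xn; suff [f xf fP] : exists2 f, fval x f &
      forall y, fval y f -> component_at y = component_at x -> F' y = F' x.
    (* The vertex idempotent keeps nearby points over the same component, so the same clause of F'
       applies to them. *)
    exists (f * pv A (vtx x))%S; first exact: filterM (vtxP x).
    have [jf iv] := (filter_idem xf, filter_idem (vtxP x)).
    move=> y yf; apply: fP; first exact: (filterMl reg_S comm_S jf iv yf).
    have yv := filterMr reg_S comm_S jf iv yf.
    by rewrite /component_at ((vtxE y (vtx x)).1 yv).
  have [xl|xl] := EM (lower n (component_at x)).
    have [f xf fP] := F2 x xl; exists f => // y yf yx.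
    by rewrite !F'F ?yx // fP.
  have [_ /(_ x erefl)[f xf fP] _ _] := GP _ xn; exists f => // y yf yx.
  by rewrite !F'G ?yx // fP.
- move=> x i xn iM; have [xl|xl] := EM (lower n (component_at x)).
    by rewrite F'F //; apply: close_le le2 _; exact: F3.
  by rewrite F'G //; have [_ _ h _] := GP _ xn; exact: h.
- move=> x e en xe; have xc : component_at x = comp_of (rng e) by rewrite /component_at xe.
  have zc : component_at (act (pe A e) x) = comp_of (src e) by rewrite /component_at vtx_act_pe.
  have [el|el] := EM (lower n (comp_of (src e))).
    rewrite !F'F ?zc ?xc //; last exact: lower_edge.
    by apply: close_le le2 _; exact: F4.
  have pe0 : vset (comp_of (src e)) (src e) by apply/component_eqP.
  rewrite (F'G (act _ _)) ?zc //; have [_ _ _ /(_ x e pe0 xe)[h1 h2]] := GP _ en.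
  have [re|re] := EM (vset (comp_of (src e)) (rng e)).
    have rs : comp_of (rng e) = comp_of (src e) by apply/component_eqP.
    by rewrite F'G ?xc rs //; exact: h1.
  rewrite F'F ?xc; first exact: h2.
  apply: en; split; last by move=> /component_eqP.
  by exists (rng e), (src e); split; [exact/component_eqP|exact/component_eqP|exists [:: e]].
Qed.

Lemma amenable_sec : amenable R (tight_groupoid S).
Proof.
have [n0 n0P] := lower_all A.
(* Both the error and the range of controlled t_i improve with n, so each single generator is
   eventually handled. *)
have /choice[F FP] : forall n : nat, exists F, good (fun=> True) n (n.+1%:R^-1 : R) F.
  move=> n; have n1 : 0 < n.+1%:R^-1 :> R by rewrite invr_gt0.
  have [F [h1 h2 h3 h4]] := good_exists n0 n n1; exists F; split.
  - by move=> x _; exact: h1.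
  - by move=> x _; exact: h2.
  - by move=> x i _; exact: h3.
  - by move=> x e _; exact: h4.
have small (eps : R) : 0 < eps -> exists m, forall n, (m <= n)%N -> n.+1%:R^-1 <= eps.
  move=> eps0; exists (Num.bound (eps^-1)) => n mn.
  have e0 : 0 <= eps^-1 by rewrite invr_ge0 ltW.
  have h := archi_boundP e0.
  rewrite -[leRHS]invrK lef_pV2 ?posrE ?invr_gt0 //.
  by apply: ltW; apply: lt_le_trans h _; rewrite ler_nat ltnW.
apply: (amenable_of_means reg_S comm_S (F := F)).
- by move=> n x; have [h _ _ _] := FP n; exact: (h x I).1.
- by move=> n x; have [h _ _ _] := FP n; exact: (h x I).2.
- by move=> n x; have [_ h _ _] := FP n; exact: (h x I).
pose inv u := forall eps : R, 0 < eps -> exists n0, forall n, (n0 <= n)%N ->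
  forall x, fval x (u^* * u)%S -> close eps (lmul u (F n x)) (F n (act u x)).
suff h : forall u, inv u /\ inv (u^*)%S by move=> u; have [] := h u.
have ev_vtx n x phi : ev (F n x) (fun s => phi (pv A (vtx x) * s)%S) = ev (F n x) phi.
  have [/(_ x I)[_ Fc] _ _ _] := FP n; apply: eq_sum_lall Fc _ => q qx.
  by have [->|/qx /range_vtx ->] := eqVneq q.1 0; rewrite ?mul0r.
have invM u w : inv u -> inv w -> inv (u * w)%S.
  move=> iu iw eps eps0; have e2 : 0 < eps / 2 by rewrite divr_gt0.
  have [n1 h1] := iu _ e2; have [n2 h2] := iw _ e2.
  exists (maxn n1 n2) => n; rewrite geq_max => /andP[nn1 nn2] x xuw.
  have [xw yu] := fval_source_mul reg_S comm_S xuw.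
  rewrite (actM reg_S comm_S) // -lmulM.
  rewrite [eps](_ : _ = eps / 2 + eps / 2); last by lra.
  apply: close_trans (close_lmul u (h2 n nn2 x xw)) _.
  exact: h1.
have inv_pv v : inv (pv A v).
  move=> eps eps0; exists 0%N => n _ x; rewrite pv_star pvv => xv phi phi1.
  rewrite (act_idem reg_S comm_S xv) ev_lmul.
  have vx := (vtxE x v).1 xv; rewrite -vx ev_vtx subrr normr0; exact: ltW.
move=> u; elim/sec_ind: u => [|v|e|c i v|u w [iu iu'] [iw iw']|u [iu iu']].
- rewrite star0; split=> eps _; exists 0%N => n _ x; rewrite smuls0 => /filter0//.
- by rewrite pv_star.
- have pe_inv : inv (pe A e).
    move=> eps /small[m mP]; exists m => n mn x xe.
    have [_ _ _ /(_ x e I)h] := FP n; apply: close_le (mP n mn) _.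
    by apply: h; apply/act_pe_dom.
  (* For e^* at x, use the estimate for e at e^* x and multiply it by e^*; the factor e^* e is a
     vertex that F(e^* x) absorbs. *)
  split=> // eps eps0; have [m mP] := pe_inv _ eps0; exists m => n mn x; rewrite starK => xe.
  have ye := act_star_dom reg_S comm_S xe; have yv := (act_pe_dom _ e).1 ye.
  move=> phi phi1; have := mP n mn _ ye (fun s => phi ((pe A e)^* * s)%S) (fun s => phi1 _).
  rewrite (act_starK reg_S comm_S) // !ev_lmul distrC.
  congr (`| _ - _ | <= _).
  rewrite -[RHS]ev_vtx yv -(pe_iso A); apply: eq_bigr => q _.
  by rewrite smulA.
- have ptT_inv j w : inv (pt A true j w).
    move=> eps /small[m mP]; exists (maxn m j.+1) => n; rewrite geq_max => /andP[mn jn] x.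
    rewrite pv_source_pt => xw; rewrite act_pt //.
    have [_ _ /(_ x j I jn)h _] := FP n; apply: close_le (mP n mn) _.
    by rewrite -((vtxE x w).1 xw).
  have ptF_inv j w : inv (pt A false j w).
    move=> eps eps0; have [m mP] := ptT_inv j w _ eps0; exists m => n mn x.
    rewrite pv_source_pt => xw; rewrite act_pt // => phi phi1.
    have xt : fval x ((pt A true j w)^* * pt A true j w)%S by rewrite pv_source_pt.
    have := mP n mn x xt (fun s => phi (pt A false j w * s)%S) (fun s => phi1 _).
    rewrite act_pt // !ev_lmul distrC; congr (`| _ - _ | <= _).
    rewrite -[RHS]ev_vtx ((vtxE x w).1 xw); apply: eq_bigr => q _.
    by rewrite smulA (ptV A false).
  by rewrite pt_star; case: c; split.
- by rewrite starM; split; exact: invM.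
- by rewrite starK.
Qed.

End Construction.

Theorem proposition6p2 :
  forall (R : realType) (E : sepgraph) (A : adaptable E),
    amenable R (tight_groupoid (SEC A)).
Proof. exact: amenable_sec. Qed.
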